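(* Let $k>0$, $b>0$, let $\alpha,\mu,\omega,\gamma\in\mathbb{C}$ with $\operatorname{Re}(\alpha)>0$, $\operatorname{Re}(\mu)>0$, let $m=[\operatorname{Re}(\mu)/k]+1$, and let $f\in AC^{m}[0,b]$. Then the regularized $k$-Prabhakar derivative and the $k$-Prabhakar derivative of $f$ are related, for (almost every) $t\in(0,b)$, by $${}_{k}^{C}D_{\alpha,\mu,\omega}^{\gamma}f(t)={}_{k}D_{\alpha,\mu,\omega}^{\gamma}f(t)-\sum_{n=0}^{m-1}k^{n}\,t^{\frac{nk-\mu}{k}}\,E_{k,\alpha,(n+1)k-\mu}^{-\gamma}\big(\omega t^{\frac{\alpha}{k}}\big)f^{(n)}(0^{+}).$$
   Context: $[\cdot]$ in the definition of $m$ is the integer part. $AC^{n}[a,b]$ is the set of $f:[a,b]\to\mathbb{R}$ with $\frac{d^{n-1}}{dt^{n-1}}f$ absolutely continuous on $[a,b]$. The $k$-gamma function is $\Gamma_k(z)=\int_0^\infty e^{-t^k/k}t^{z-1}\,dt$ for $\operatorname{Re}z>0$, extended meromorphically by $\Gamma_k(z)=k^{\frac{z}{k}-1}\Gamma(z/k)$, with $1/\Gamma_k=0$ at its poles; the $k$-Pochhammer symbol is $(\gamma)_{n,k}=\gamma(\gamma+k)\cdots(\gamma+(n-1)k)$, $(\gamma)_{0,k}=1$. The $k$-Mittag-Leffler function is $E_{k,\alpha,\mu}^{\gamma}(z)=\sum_{n=0}^\infty \frac{(\gamma)_{n,k}}{\Gamma_k(\alpha n+\mu)}\frac{z^n}{n!}$.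 The $k$-Prabhakar integral (for $\operatorname{Re}\alpha,\operatorname{Re}\mu>0$) is $$\big({}_{k}P_{\alpha,\mu,\omega}^{\gamma}f\big)(x)=\int_0^x\frac{(x-t)^{\frac{\mu}{k}-1}}{k}E_{k,\alpha,\mu}^{\gamma}\big[\omega(x-t)^{\frac{\alpha}{k}}\big]f(t)\,dt .$$ With $m=[\operatorname{Re}(\mu)/k]+1$, the $k$-Prabhakar derivative and its regularized version are $${}_{k}D_{\alpha,\mu,\omega}^{\gamma}f(t)=\Big(\frac{d}{dt}\Big)^{m}k^{m}\,{}_{k}P_{\alpha,mk-\mu,\omega}^{-\gamma}f(t),\qquad {}_{k}^{C}D_{\alpha,\mu,\omega}^{\gamma}f(t)=k^{m}\,{}_{k}P_{\alpha,mk-\mu,\omega}^{-\gamma}\Big(\frac{d}{dt}\Big)^{m}f(t).$$ *)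

(* Defs.v *)
From HB Require Import structures.
From mathcomp Require Import all_boot all_order all_algebra.
From mathcomp Require Import complex.
From mathcomp Require Import all_classical all_reals all_analysis.

Set Implicit Arguments.
Unset Strict Implicit.
Unset Printing Implicit Defensive.

Import Order.TTheory GRing.Theory Num.Theory.
Import numFieldNormedType.Exports.

Local Open Scope classical_set_scope.
Local Open Scope ring_scope.
Local Open Scope complex_scope.

Section ComplexCalculus.
Context {R : realType}.
Local Notation C := R[i].
Local Notation mu := (@lebesgue_measure R).

(* x ^ z = exp (z * ln x) with the principal logarithm; meaningful (and used
   below) only for a real base x > 0. *)
Definition cpowR (x : R) (z : C) : C :=
  (expR (complex.Re z * ln x) * cos (complex.Im z * ln x)) +i*
  (expR (complex.Re z * ln x) * sin (complex.Im z * ln x)).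

Definition cintegrable (D : set R) (g : R -> C) : Prop :=
  mu.-integrable D (fun t => (complex.Re (g t))%:E) /\
  mu.-integrable D (fun t => (complex.Im (g t))%:E).

Definition cintegral (D : set R) (g : R -> C) : C :=
  (\int[mu]_(t in D) complex.Re (g t)) +i*
  (\int[mu]_(t in D) complex.Im (g t)).

Definition cderivable (g : R -> C) (t : R) : Prop :=
  derivable (fun s => complex.Re (g s)) t 1 /\
  derivable (fun s => complex.Im (g s)) t 1.

Definition cderive (g : R -> C) (t : R) : C :=
  derive1 (fun s => complex.Re (g s)) t +i*
  derive1 (fun s => complex.Im (g s)) t.

Definition cderiven (n : nat) (g : R -> C) : R -> C := iter n cderive g.

(* g is n times differentiable at t: it is n - 1 times differentiable on a
   neighbourhood of t, and its (n - 1)-st derivative is differentiable at t. *)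
Fixpoint cnderivable (n : nat) (g : R -> C) (t : R) : Prop :=
  if n is n'.+1 then
    (\forall s \near t, cnderivable n' g s) /\ cderivable (cderiven n' g) t
  else True.

End ComplexCalculus.

Section AbsoluteContinuity.
Context {R : realType}.

Definition abs_continuous (a b : R) (f : R -> R) : Prop :=
  forall e : R, 0 < e -> exists2 d : R, 0 < d &
    forall (n : nat) (u v : 'I_n -> R),
      (forall i, a <= u i /\ u i < v i /\ v i <= b) ->
      trivIset setT (fun i => [set` `]u i, v i[]) ->
      \sum_(i < n) (v i - u i) < d ->
      \sum_(i < n) `|f (v i) - f (u i)| < e.

(* Derivatives of a function defined on A only: the increments stay in A, so
   that on a segment they are one-sided at the endpoints. *)
Definition quot_in (f : R -> R) (x y : R) : R := (f y - f x) / (y - x).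

Definition derivable_in (A : set R) (f : R -> R) (x : R) : Prop :=
  cvg (quot_in f x y @[y --> within A x^']).

Definition derive_in (A : set R) (f : R -> R) (x : R) : R :=
  lim (quot_in f x y @[y --> within A x^']).

Definition deriven_in (n : nat) (A : set R) (f : R -> R) : R -> R :=
  iter n (derive_in A) f.

(* AC^n[a,b] for n >= 1. *)
Definition ACn (n : nat) (a b : R) (f : R -> R) : Prop :=
  (forall i x, (i < n.-1)%N -> x \in `[a, b] ->
     derivable_in [set` `[a, b]] (deriven_in i [set` `[a, b]] f) x) /\
  abs_continuous a b (deriven_in n.-1 [set` `[a, b]] f).

End AbsoluteContinuity.

Section KPrabhakar.
Context {R : realType}.
Local Notation C := R[i].

Definition Gamma_int (z : C) : C :=
  cintegral [set` `]0, +oo[] (fun t : R => (expR (- t))%:C * cpowR t (z - 1)).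

(* The least n such that 0 < Re z + n. *)
Definition Gamma_shift (z : C) : nat :=
  if 0 < complex.Re z then 0%N else (Num.truncn (- complex.Re z)).+1.

(* Meromorphic continuation Gamma z = Gamma (z + n) / (z (z+1) ... (z+n-1)).
   At a pole one factor of the denominator vanishes, hence Gamma z = 0 there
   and (Gamma z)^-1 = 0, the value of the entire function 1/Gamma. *)
Definition Gamma (z : C) : C :=
  let n := Gamma_shift z in
  Gamma_int (z + n%:R) / \prod_(j < n) (z + j%:R).

Definition kGamma_int (k : R) (z : C) : C :=
  cintegral [set` `]0, +oo[]
    (fun t : R => (expR (- (t `^ k / k)))%:C * cpowR t (z - 1)).

(* As for Gamma, (kGamma k z)^-1 = 0 at the poles. *)
Definition kGamma (k : R) (z : C) : C :=
  if 0 < complex.Re z then kGamma_int k z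
  else cpowR k (z / k%:C - 1) * Gamma (z / k%:C).

Definition kPochhammer (k : R) (g : C) (n : nat) : C :=
  \prod_(j < n) (g + j%:R * k%:C).

Definition kMittagLeffler (k : R) (alpha mu g z : C) : C :=
  lim ((series (fun n : nat =>
    kPochhammer k g n / kGamma k (alpha * n%:R + mu) * (z ^+ n / n`!%:R))
    : nat -> C^o) @ \oo).

Definition kPrabhakar_integrand
    (k : R) (alpha mu omega g : C) (f : R -> R) (x t : R) : C :=
  cpowR (x - t) (mu / k%:C - 1) / k%:C *
  kMittagLeffler k alpha mu g (omega * cpowR (x - t) (alpha / k%:C)) *
  (f t)%:C.

Definition kPrabhakar
    (k : R) (alpha mu omega g : C) (f : R -> R) (x : R) : C :=
  cintegral [set` `]0, x[] (kPrabhakar_integrand k alpha mu omega g f x).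

Definition kPrabhakar_cvg
    (k : R) (alpha mu omega g : C) (f : R -> R) (x : R) : Prop :=
  cintegrable [set` `]0, x[] (kPrabhakar_integrand k alpha mu omega g f x).

Definition kPrabhakar_order (k : R) (mu : C) : nat :=
  (Num.truncn (complex.Re mu / k)).+1.

Definition kPrabhakarD
    (k : R) (alpha mu omega g : C) (f : R -> R) (t : R) : C :=
  let m := kPrabhakar_order k mu in
  cderiven m (fun s =>
    (k ^+ m)%:C * kPrabhakar k alpha ((m%:R * k)%:C - mu) omega (- g) f s) t.

Definition kPrabhakarD_exists
    (k : R) (alpha mu omega g : C) (f : R -> R) (t : R) : Prop :=
  let m := kPrabhakar_order k mu in
  (\forall s \near t,
     kPrabhakar_cvg k alpha ((m%:R * k)%:C - mu) omega (- g) f s) /\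
  cnderivable m (fun s =>
    (k ^+ m)%:C * kPrabhakar k alpha ((m%:R * k)%:C - mu) omega (- g) f s) t.

Definition kPrabhakarCD
    (k : R) (alpha mu omega g : C) (f : R -> R) (t : R) : C :=
  let m := kPrabhakar_order k mu in
  (k ^+ m)%:C *
  kPrabhakar k alpha ((m%:R * k)%:C - mu) omega (- g) (derive1n m f) t.

Definition kPrabhakarCD_exists
    (k : R) (alpha mu omega g : C) (f : R -> R) (t : R) : Prop :=
  let m := kPrabhakar_order k mu in
  kPrabhakar_cvg k alpha ((m%:R * k)%:C - mu) omega (- g) (derive1n m f) t.

End KPrabhakar.

(* Main.v *)
Require Import Defs.
From HB Require Import structures.
From mathcomp Require Import all_boot all_order all_algebra.
From mathcomp Require Import complex ring lra.
From mathcomp Require Import all_classical all_reals all_analysis.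
From mathcomp Require Import finmap measurable_realfun.
Import Order.TTheory GRing.Theory Num.Theory.
Import numFieldNormedType.Exports.
Local Open Scope classical_set_scope.
Local Open Scope ring_scope.
Local Open Scope complex_scope.

(** Let K be the kernel of the k-Prabhakar integral, multiplied by k ^ m, with
parameter nu = m k - mu, so that the two derivatives of f are the convolution of
K with the m-th derivative of f and the m-th derivative of the convolution of K
with f. For f = f(0) + integral of f', Fubini gives [integral_conv_primitive]:
the convolution of K with f is f(0) times a primitive of K plus a primitive of
the convolution of K with f'. Differentiating, (K * f)' = f(0) K + K * f'.
Repeating this m times moves all the derivatives onto f and leaves the sum over
p < m of the p-th derivative of f at 0 times the (m-1-p)-th derivative of K, see
[derive1n_conv] and, for the last derivative, which exists almost everywhere
only, [ae_derive1n_conv].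

It remains to differentiate K. It is a series of complex powers of u; the
functional equation of Gamma, in the form [kGamma_inv_recursion], valid for
every complex parameter, says that the derivative of a term with parameter s is,
up to the factor 1 / k, the term with parameter s - k. Summing termwise,
[is_cderive_kker] identifies the (m-1-p)-th derivative of K with k ^ p times the
Mittag-Leffler term with parameter (p + 1) k - mu. Termwise differentiation and
the integrability of K near 0 need that 1 / kGamma (alpha n + s) decays faster
than every geometric sequence in n. As alpha is complex, this is not a matter of
the real Gamma function alone: [kGamma_inv_bound] rests on a lower bound for
|Gamma (x + i y)| when y is of the order of x. For y small compared with sqrt x
the integrand hardly turns, and the functional equation transports the bound
from x + n back to x at the cost of a factor exp (- y ^ 2 / (2 (x - 1))).

The hypothesis on f says that its (m-1)-st derivative on [0, b] is absolutely
continuous. It is the primitive of an integrable function ([ac_on_density]): it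
is the difference of two nondecreasing absolutely continuous functions, whose
Stieltjes measures have densities by the Radon-Nikodym theorem. By Lebesgue
differentiation the density is the m-th derivative almost everywhere, and the
latter is Borel measurable ([measurable_derive1]), so the Prabhakar integral of
derive1n m f makes sense.

The convolutions are those of the real and imaginary parts of the kernel. *)

Set Implicit Arguments.
Unset Strict Implicit.
Unset Printing Implicit Defensive.

Local Notation Re := complex.Re.
Local Notation Im := complex.Im.
Local Notation normc := ComplexField.Normc.normc.

(** * Absolute continuity and bounded variation *)

Definition clamp {R : realType} (a b x : R) : R := Num.max a (Num.min b x).

Lemma clamp_itv (R : realType) (a b x : R) : a <= b -> a <= clamp a b x <= b.
Proof. by move=> ab; rewrite /clamp le_max lexx ge_max ab ge_min lexx. Qed.

Lemma clamp_id (R : realType) (a b x : R) : a <= x <= b -> clamp a b x = x.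
Proof. by move=> /andP[ax xb]; rewrite /clamp (min_idPr xb) (max_idPr ax). Qed.

Lemma le_clamp (R : realType) (a b x y : R) : x <= y -> clamp a b x <= clamp a b y.
Proof.
move=> xy; rewrite /clamp /Num.max /Num.min.
by do ! case: ifPn => //; rewrite ?ltNge ?negbK -?ltNge => *; lra.
Qed.

Lemma clampB_le (R : realType) (a b x y : R) : a <= b -> x <= y ->
  clamp a b y - clamp a b x <= y - x.
Proof.
move=> ab xy; rewrite /clamp /Num.max /Num.min.
by do ! case: ifPn => //; rewrite ?ltNge ?negbK -?ltNge => *; lra.
Qed.

(** Disjointness, up to endpoints, of the intervals coded by two pairs. *)
Definition apart {R : realType} (p q : R * R) : bool := (p.2 <= q.1) || (q.2 <= p.1).

Definition inside {R : realType} (a b : R) (p : R * R) : bool :=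
  [&& a <= p.1, p.1 < p.2 & p.2 <= b].

(** Absolute continuity phrased with sequences of intervals, which are easier
to refine and concatenate than families indexed by ordinals. *)
Definition ac_on {R : realType} (a b : R) (f : R -> R) : Prop :=
  forall e : R, 0 < e -> exists2 d : R, 0 < d & forall s : seq (R * R),
    all (inside a b) s -> pairwise apart s ->
    \sum_(p <- s) (p.2 - p.1) < d -> \sum_(p <- s) `|f p.2 - f p.1| < e.

Definition ac_line {R : realType} (f : R -> R) : Prop :=
  forall e : R, 0 < e -> exists2 d : R, 0 < d & forall s : seq (R * R),
    all (fun p => p.1 < p.2) s -> pairwise apart s ->
    \sum_(p <- s) (p.2 - p.1) < d -> \sum_(p <- s) `|f p.2 - f p.1| < e.

Lemma abs_continuous_ac_on (R : realType) (a b : R) (f : R -> R) :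
  abs_continuous a b f -> ac_on a b f.
Proof.
move=> acf e e0; have [d d0 fd] := acf e e0; exists d => // s s0 ds sd.
have s_itv p : p \in s -> a <= p.1 /\ p.1 < p.2 /\ p.2 <= b.
  by move=> /(allP s0) /and3P[].
have := fd (size s) (fun i => (nth (0, 0) s i).1) (fun i => (nth (0, 0) s i).2).
rewrite -(big_mkord xpredT (fun i => (nth (0, 0) s i).2 - (nth (0, 0) s i).1)).
rewrite -(big_mkord xpredT
  (fun i => `|f (nth (0, 0) s i).2 - f (nth (0, 0) s i).1|)).
rewrite -(big_nth (0, 0) xpredT (fun p => p.2 - p.1)).
rewrite -(big_nth (0, 0) xpredT (fun p => `|f p.2 - f p.1|)); apply => //.
  by move=> i; apply: s_itv; rewrite mem_nth.
have H (i j : 'I_(size s)) x : (i < j)%N ->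
    x \in `](nth (0, 0) s i).1, (nth (0, 0) s i).2[ ->
    x \in `](nth (0, 0) s j).1, (nth (0, 0) s j).2[ -> False.
  move=> ij; rewrite !in_itv/= => /andP[x1 x2] /andP[x3 x4].
  have := pairwiseP (0, 0) ds; move=> /(_ i j); rewrite !inE !ltn_ord.
  by move=> /(_ isT isT ij); rewrite /apart => /orP[]; lra.
move=> i j _ _ [x []] /= xi xj; apply: val_inj => /=.
by case: (ltngtP i j) => // ij; [case: (H _ _ _ ij xi xj)|case: (H _ _ _ ij xj xi)].
Qed.

Lemma ac_on_line (R : realType) (a b : R) (f : R -> R) : a <= b ->
  ac_on a b f -> ac_line (f \o clamp a b).
Proof.
move=> ab acf e e0; have [d d0 fd] := acf e e0; exists d => // s s0 ds sd.
pose c (p : R * R) := (clamp a b p.1, clamp a b p.2).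
pose s2 := [seq p <- map c s | p.1 < p.2].
have s2E F : \sum_(p <- s2) F p = \sum_(p <- s | (c p).1 < (c p).2) F (c p).
  by rewrite /s2 big_filter big_map.
have -> : \sum_(p <- s) `|(f \o clamp a b) p.2 - (f \o clamp a b) p.1| =
          \sum_(p <- s2) `|f p.2 - f p.1|.
  rewrite s2E [LHS](bigID (fun p => (c p).1 < (c p).2))/= [X in _ + X]big1_seq ?addr0//.
  move=> p /andP[pp ps]; have /(le_clamp a b) := ltW (allP s0 _ ps).
  by rewrite le_eqVlt (negbTE pp) orbF => /eqP ->; rewrite subrr normr0.
apply: fd.
- apply/allP => p; rewrite mem_filter => /andP[pp /mapP[q _ pE]].
  rewrite /inside pp pE/=.
  by have /andP[-> _] := @clamp_itv R a b q.1 ab; have /andP[_ ->] := @clamp_itv R a b q.2 ab.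
- apply: (subseq_pairwise (filter_subseq _ _)); rewrite pairwise_map.
  apply: sub_pairwise ds => p q; rewrite /apart/= => /orP[] /(le_clamp a b) -> //.
  by rewrite orbT.
- apply: le_lt_trans sd; rewrite s2E [leRHS](bigID (fun p => (c p).1 < (c p).2))/=.
  rewrite -[leLHS]addr0 lerD//; rewrite big_seq_cond [leRHS]big_seq_cond.
    by apply: ler_sum => p /andP[/(allP s0) pp _]; apply: clampB_le => //; exact: ltW.
  by apply: sumr_ge0 => p /andP[/(allP s0) /ltW]; rewrite subr_ge0.
Qed.

(** The intervals of the partition x :: s, as pairs of endpoints. *)
Definition steps {R : realType} (x : R) (s : seq R) : seq (R * R) :=
  [seq (q.2, q.1) | q <- zip s (x :: s)].

Lemma itv_partition_steps (R : realType) (h : R -> R) (x y : R) (s : seq R) :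
  itv_partition x y s ->
  [/\ all (inside x y) (steps x s), pairwise apart (steps x s),
      \sum_(p <- steps x s) (p.2 - p.1) = y - x &
      \sum_(p <- steps x s) `|h p.2 - h p.1| = variation x y h s].
Proof.
move=> xs; rewrite (variation_zip _ xs).
split; last by rewrite big_map.
3: { rewrite big_map; elim: s x xs => [|z s IH] x xs.
    by move: xs => /itv_partition_nil ->; rewrite /= big_nil subrr.
  by rewrite big_cons (IH _ (itv_partition_cons xs))/=; lra. }
all: elim: s x xs => // z s IH x /[dup] xs [/= /andP[xz zs] lz].
- have zy := itv_partition_le (itv_partition_cons xs).
  rewrite /steps/= {1}/inside/= lexx xz zy/=.
  apply: sub_all (IH z (itv_partition_cons xs)) => p /and3P[zp pp py].
  by rewrite /inside pp py (le_trans (ltW xz)).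
- rewrite /steps/= -/(steps z s) (IH _ (itv_partition_cons xs)) andbT.
  have : all (inside z y) (steps z s).
    elim: s z {IH xs lz xz zs} (itv_partition_cons xs) => // z' s IH z /[dup] xs.
    move=> [/= /andP[xz zs] lz].
    have zy := itv_partition_le (itv_partition_cons xs).
    rewrite /steps/= {1}/inside/= lexx xz zy/=.
    apply: sub_all (IH z' (itv_partition_cons xs)) => p /and3P[zp pp py].
    by rewrite /inside pp py (le_trans (ltW xz)).
  by apply: sub_all => p /and3P[zp _ _]; rewrite /apart/= zp.
Qed.

(** On an interval shorter than the modulus of continuity for 1, the variation is
at most 1, and finitely many such intervals cover the segment. *)
Lemma ac_on_bounded_variation (R : realType) (a b : R) (f : R -> R) : a <= b ->
  ac_on a b f -> bounded_variation a b f.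
Proof.
move=> ab acf; apply/bounded_variationP => //.
rewrite ge0_fin_numE ?total_variation_ge0//.
have [d d0 fd] := acf 1 ltr01.
have short x y : a <= x -> x <= y -> y <= b -> y - x < d ->
    (total_variation x y f <= 1)%E.
  move=> ax xy yb xyd; apply: ge_ereal_sup => _ [_ [s xs <-] <-].
  have [s1 s2 s3 s4] := itv_partition_steps f xs.
  rewrite lee_fin -s4; apply/ltW/fd => //; last by rewrite s3.
  apply: sub_all s1 => p /and3P[zp pp py].
  by rewrite /inside pp (le_trans ax)//= (le_trans py).
have long n : forall x, a <= x -> x <= b -> x <= a + n%:R * (d / 2) ->
    (total_variation a x f <= n%:R%:E)%E.
  elim: n => [|n IH] x ax xb xn.
    have -> : x = a by lra.
    by rewrite total_variationxx.
  have [xle|ltx] := leP x (a + n%:R * (d / 2)).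
    by apply: le_trans (IH x ax xb xle) _; rewrite lee_fin ler_nat.
  have anx : a <= a + n%:R * (d / 2) by rewrite lerDl mulr_ge0//; lra.
  rewrite (@total_variationD _ _ _ (a + n%:R * (d / 2)))// ?(ltW ltx)//.
  rewrite -(natr1 n) EFinD leeD// ?IH//; first by rewrite (le_trans (ltW ltx)).
  apply: short => //; rewrite ?(ltW ltx)//.
  by move: xn; rewrite -(natr1 n) mulrDl mul1r; lra.
apply: (@le_lt_trans _ _ (Num.bound ((b - a) / (d / 2)))%:R%:E); last by rewrite ltry.
apply: long => //; rewrite -lerBlDl -ler_pdivrMr ?divr_gt0//.
by apply/ltW/archi_boundP/divr_ge0; [rewrite subr_ge0|rewrite ltW// divr_gt0].
Qed.

Section variation_function.
Context {R : realType} (a b : R) (f : R -> R).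
Hypotheses (ab : a <= b) (acf : ac_on a b f).

Let V x := fine (total_variation a x f).

Let bv x y : a <= x -> x <= y -> y <= b -> bounded_variation x y f.
Proof.
move=> ax xy yb; have := ac_on_bounded_variation ab acf.
move=> /(bounded_variationl (le_trans ax xy) yb).
exact: bounded_variationr.
Qed.

Let fin x y : a <= x -> x <= y -> y <= b -> total_variation x y f \is a fin_num.
Proof. by move=> *; apply/bounded_variationP => //; exact: bv. Qed.

Lemma variation_functionB x y : a <= x -> x <= y -> y <= b ->
  ((V y - V x)%:E = total_variation x y f)%E.
Proof.
move=> ax xy yb; rewrite /V (total_variationD f ax xy) fineD ?fin//; last first.
  exact: le_trans yb.
by rewrite addrAC subrr add0r fineK// fin.
Qed.

Lemma variation_function_ge x y : a <= x -> x <= y -> y <= b ->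
  `|f y - f x| <= V y - V x.
Proof.
by move=> ax xy yb; rewrite -lee_fin variation_functionB// total_variation_ge.
Qed.

(** Each interval of the family is cut along a partition whose sum of increments
comes within eta of the variation on that interval. *)
Let refine (eta : R) s : 0 < eta -> all (inside a b) s -> pairwise apart s ->
  exists t, [/\ all (inside a b) t, pairwise apart t,
    \sum_(p <- t) (p.2 - p.1) = \sum_(p <- s) (p.2 - p.1),
    \sum_(p <- s) (V p.2 - V p.1) <=
      \sum_(p <- t) `|f p.2 - f p.1| + eta * (size s)%:R &
    forall q, q \in t -> exists2 p, p \in s & inside p.1 p.2 q].
Proof.
move=> eta0; elim: s => [_ _|p s IH].
  by exists [::]; split => //; rewrite !big_nil mulr0 addr0.
move=> /= /andP[ip ins] /andP[ps pws]; have [t [int pwt len tot sub]] := IH ins pws.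
have /and3P[ap pp pb] := ip.
have [_ [_ [l pl <-] <-] lV] : exists2 x : \bar R,
    [set x%:E | x in variations p.1 p.2 f] x & ((V p.2 - V p.1 - eta)%:E < x)%E.
  apply: ereal_sup_gt; rewrite EFinB variation_functionB ?(ltW pp)//.
  by rewrite lteBlDr// lteDl ?lte_fin// fin ?(ltW pp).
have [l1 l2 l3 l4] := itv_partition_steps f pl.
exists (steps p.1 l ++ t); split.
- rewrite all_cat int andbT; apply: sub_all l1 => q /and3P[pq qq qp].
  by rewrite /inside qq (le_trans ap)//= (le_trans qp).
- rewrite pairwise_cat l2 pwt !andbT/=; apply/allrelP => q r ql rt.
  have /and3P[pq qq qp] := allP l1 _ ql.
  have [p' p's /and3P[p'r rr rp']] := sub _ rt.
  have := allP ps _ p's; rewrite /apart => /orP[] h; apply/orP; [left|right]; lra.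
- by rewrite big_cat big_cons/= l3 len.
- move: lV; rewrite big_cat !big_cons/= l4 lte_fin => lV.
  by rewrite -(natr1 (size s)) mulrDr mulr1; lra.
- move=> q; rewrite mem_cat => /orP[ql|/sub [p' p's ?]].
    by exists p; [rewrite mem_head|exact: (allP l1)].
  by exists p' => //; rewrite in_cons p's orbT.
Qed.

(** Refining each interval of a family into a partition that almost realizes its
variation changes neither the disjointness nor the total length, so that the
modulus of absolute continuity of f also serves for its variation. *)
Lemma ac_on_variation_function : ac_on a b V.
Proof.
move=> e e0; have e20 : 0 < e / 2 by lra.
have [d d0 fd] := acf e20.
exists d => // s ins pws sd.
have eta0 : 0 < e / 2 / (size s).+1%:R :> R by rewrite !divr_gt0.
have [t [int pwt len tot _]] := refine eta0 ins pws.
have := fd t int pwt; rewrite len => /(_ sd) ft.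
have -> : \sum_(p <- s) `|V p.2 - V p.1| = \sum_(p <- s) (V p.2 - V p.1).
  rewrite !big_seq; apply: eq_bigr => p /(allP ins) /and3P[ap pp pb]; rewrite ger0_norm//.
  by rewrite (le_trans (normr_ge0 (f p.2 - f p.1)))// variation_function_ge// ltW.
apply: (le_lt_trans tot).
have : e / 2 / (size s).+1%:R * (size s)%:R <= e / 2.
  by rewrite mulrAC ler_pdivrMr// ler_wpM2l ?ler_nat//; lra.
set z := _ * (size s)%:R; move: ft; set w := \sum_(p <- t) _; lra.
Qed.

End variation_function.

(** * Densities of absolutely continuous functions *)

Lemma lebesgue_stieltjes_oc (R : realType) (F : cumulative R R) (x y : R) :
  x <= y -> lebesgue_stieltjes_measure F `]x, y] = (F y - F x)%:E.
Proof.
move=> xy; rewrite /lebesgue_stieltjes_measure /measure_extension/=.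
rewrite measurable_mu_extE/=; last exact: is_ocitv.
by rewrite wlength_itv_bnd.
Qed.

(** A finite union of half-open intervals is a finite union of pairwise disjoint
ones, to which absolute continuity applies. *)
Lemma ac_line_stieltjes_finite (R : realType) (F : cumulative R R) (e d : R)
    (A : nat -> set R) (n : nat) :
  (forall s : seq (R * R), all (fun p => p.1 < p.2) s -> pairwise apart s ->
    \sum_(p <- s) (p.2 - p.1) < d -> \sum_(p <- s) `|F p.2 - F p.1| < e) ->
  (forall i, ocitv (A i)) ->
  (lebesgue_measure (\big[setU/set0]_(i < n) A i) < d%:E)%E ->
  (lebesgue_stieltjes_measure F (\big[setU/set0]_(i < n) A i) <= e%:E)%E.
Proof.
move=> acF oA; set B := (X in lebesgue_measure X) => Bd.
have mB : measurable (B : set (SetRing.type (ocitv_type R))).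
  by apply: bigsetU_measurable => i _; exact: (sub_gen_smallest (oA i)).
have [D [finD D0 trD mD BD]] := SetRing.ring_finite_set mB.
have /choice[g gP] : forall X : set R, exists p : R * R,
    X \in D -> p.1 < p.2 /\ X = `]p.1, p.2]%classic.
  move=> X; have [XD|] := boolP (X \in D); last by exists (0, 0).
  have [X0|[p p12 Xp]] := (ocitvP X).1 (mD X XD).
    by move: (D0 X); rewrite X0 => /(_ _)[]//; rewrite -X0; exact: set_mem.
  by exists p.
have meas X : X \in D -> measurable (X : set R).
  by move=> /gP[_ ->]; exact: measurable_itv.
have sumE (G : cumulative R R) :
    lebesgue_stieltjes_measure G B = (\sum_(X <- fset_set D) (G (g X).2 - G (g X).1))%:E.
  rewrite BD (@measure_fin_bigcup _ _ _ (lebesgue_stieltjes_measure G))//; last first.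
    by move=> X DX; apply: meas; exact: mem_set.
  rewrite fsbig_finite//= -sumEFin; apply: eq_big_seq => X.
  rewrite in_fset_set// => /gP[p12 {1}->].
  by rewrite lebesgue_stieltjes_oc ?EFinB// ltW.
pose s := [seq g X | X <- fset_set D].
have := acF s; rewrite !big_map => ineq.
rewrite sumE lee_fin (le_trans (ler_norm _))// (le_trans (ler_norm_sum _ _ _))//.
apply/ltW/ineq.
- by apply/allP => _ /mapP[X + ->]; rewrite in_fset_set// => /gP[].
- rewrite /s pairwise_map.
  have : pairwise [rel x y | x != y] (fset_set D) by rewrite -uniq_pairwise fset_uniq.
  apply: (@sub_in_pairwise _ (mem D)); last first.
    by apply/allP => X; rewrite in_fset_set.
  move=> X Y XD YD /= XY; rewrite /apart; apply/negPn/negP => /norP[].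
  rewrite -!ltNge => h1 h2; have [p1 XE] := gP _ XD; have [p2 YE] := gP _ YD.
  move: XY => /negP; apply; apply/eqP/trD; [exact: set_mem|exact: set_mem|].
  move: (g X) (g Y) p1 p2 h1 h2 XE YE => x y p1 p2 h1 h2 -> ->.
  exists (Num.min x.2 y.2); split => /=; rewrite in_itv/= ge_min lexx ?orbT andbT.
    by rewrite lt_min p1 h2.
  by rewrite lt_min p2 h1.
- by move: Bd; rewrite /lebesgue_measure sumE lte_fin.
Qed.

(** A Lebesgue-null set is covered by countably many half-open intervals of small
total length, and the Stieltjes measures of their finite unions are small. *)
Lemma ac_line_stieltjes_dominated (R : realType) (F : cumulative R R) : ac_line F ->
  lebesgue_stieltjes_measure F `<< @lebesgue_measure R.
Proof.
move=> acF; apply/null_content_dominatesP => E mE E0.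
apply/eqP; rewrite eq_le measure_ge0 andbT; apply/lee_addgt0Pr => e e0; rewrite add0e.
have [d d0 Fd] := acF e e0.
have : (lebesgue_measure E < d%:E)%E by rewrite E0 lte_fin.
move=> /ereal_inf_lt[_ [A [oA EA] <-]] Ad.
have mA i : measurable (A i : set R).
  by move: (oA i) => -[p _ <-]; exact: measurable_itv.
have mU n : measurable (\big[setU/set0]_(i < n) A i : set R).
  by apply: bigsetU_measurable => i _; exact: mA.
have AUE : \bigcup_n (\big[setU/set0]_(i < n) A i) = \bigcup_n A n.
  apply/seteqP; split => [x [k _]|x [k _ Ak]].
    by rewrite -bigcup_mkord => -[i _ Ai]; exists i.
  by exists k.+1 => //; rewrite -bigcup_mkord; exists k => //=.
apply: (@le_trans _ _ (lebesgue_stieltjes_measure F (\bigcup_n A n))).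
  apply: (le_measure (lebesgue_stieltjes_measure F)); [| |exact: EA]; apply: mem_set => //.
  by apply: bigcup_measurable => i _; exact: mA.
have := @nondecreasing_cvg_mu _ _ _ (lebesgue_stieltjes_measure F)
  (fun n => \big[setU/set0]_(i < n) A i) mU.
rewrite AUE => /(_ (bigcup_measurable (fun i _ => mA i))).
have nd : nondecreasing_seq (fun n => \big[setU/set0]_(i < n) A i).
  by move=> p q pq; apply/subsetPset; exact: subset_bigsetU.
move=> /(_ nd) cv; rewrite -(cvg_lim _ cv)//; apply: lime_le.
  by apply/cvg_ex; eexists; exact: cv.
apply: nearW => n /=; apply: (ac_line_stieltjes_finite Fd) => //.
apply: le_lt_trans Ad.
apply: (@le_trans _ _ (\sum_(i < n) lebesgue_measure (A i))%E).
  by apply: (@Boole_inequality _ _ _ lebesgue_measure) => i _; exact: mA.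
rewrite (@eq_bigr _ _ _ _ _ _ _ (fun i : 'I_n => wlength idfun (A i))).
  rewrite -(big_mkord xpredT (fun i => wlength idfun (A i))).
  exact: nneseries_lim_ge.
move=> i _; rewrite /lebesgue_measure /lebesgue_stieltjes_measure /measure_extension/=.
by rewrite measurable_mu_extE.
Qed.

Lemma ac_line_continuous (R : realType) (F : R -> R) : ac_line F -> continuous F.
Proof.
move=> acF x; apply/cvgrPdist_lt => e e0.
have [d d0 Fd] := acF e e0; near=> y.
have : `|x - y| < d by near: y; apply: cvgr_dist_lt d0; exact: cvg_id.
case: (ltgtP x y) => [xy|yx|-> _]; last by rewrite subrr normr0.
- rewrite ltr0_norm ?subr_lt0// opprB => xyd.
  by have := Fd [:: (x, y)]; rewrite !big_seq1/= xy distrC; apply.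
- rewrite gtr0_norm ?subr_gt0// => xyd.
  by have := Fd [:: (y, x)]; rewrite !big_seq1/= yx; apply.
Unshelve. all: by end_near. Qed.

Lemma cumulative_ac_line (R : realType) (F : R -> R) :
  {homo F : x y / x <= y} -> ac_line F -> exists G : cumulative R R, G = F :> (R -> R).
Proof.
move=> ndF acF; suff rcF : right_continuous F.
  by exists (HB.pack_for (cumulative R R) F (isCumulative.Build R _ R F ndF rcF)).
exact/right_continuousW/ac_line_continuous.
Qed.

(** The Stieltjes measure of F is absolutely continuous with respect to the
Lebesgue measure; phi is its Radon-Nikodym density. *)
Lemma nondecreasing_ac_density (R : realType) (a b : R) (F : R -> R) :
  {homo F : x y / x <= y} -> ac_line F ->
  exists phi : R -> R, lebesgue_measure.-integrable setT (EFin \o phi) /\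
  forall x, a <= x <= b -> F x = F a + \int[lebesgue_measure]_(t in `]a, x]) phi t.
Proof.
move=> ndF acF; have [G GF] := cumulative_ac_line ndF acF.
pose nu : {measure set (measurableTypeR R) -> \bar R} := lebesgue_stieltjes_measure G.
have nuab : (nu `]a, b]%classic < +oo)%E.
  have [ab|ba] := leP a b; first by rewrite /nu/= lebesgue_stieltjes_oc// ltry.
  by rewrite set_itv_ge ?measure0 ?ltry// -leNgt bnd_simp ltW.
have mab : measurable (`]a, b]%classic : set (measurableTypeR R)) by exact: measurable_itv.
pose nu_ab : {finite_measure set (measurableTypeR R) -> \bar R} := mfrestr mab nuab.
have dom : nu_ab `<< @lebesgue_measure R.
  have /null_content_dominatesP nuD : nu `<< @lebesgue_measure R.
    by apply: ac_line_stieltjes_dominated; rewrite GF.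
  apply/null_content_dominatesP => E mE E0.
  rewrite /nu_ab/= /mfrestr /mrestr; apply/eqP; rewrite eq_le measure_ge0 andbT -(nuD E mE E0).
  by apply: le_measure => //; apply: mem_set => //; exact: measurableI.
have [psi [psi0 psif ipsi psiE]] := radon_nikodym_sigma_finite dom.
exists (fine \o psi).
have psifE : EFin \o (fine \o psi) = psi by apply/funext => t/=; rewrite fineK.
split; first by rewrite psifE.
move=> x /andP[ax xb]; rewrite /Rintegral.
rewrite -[X in _ + fine X](_ : (F x - F a)%:E = _) ?subrKC//.
transitivity (nu_ab `]a, x]%classic); last first.
  rewrite psiE; last exact: measurable_itv.
  by apply: eq_integral => t _; rewrite -[RHS]/((EFin \o (fine \o psi)) t) psifE.
rewrite /nu_ab /= /mfrestr /mrestr setIidl.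
  by rewrite /nu/= lebesgue_stieltjes_oc// GF.
by apply: subset_itvl; rewrite bnd_simp.
Qed.

Lemma ac_onB (R : realType) (a b : R) (f g : R -> R) :
  ac_on a b f -> ac_on a b g -> ac_on a b (f \- g).
Proof.
move=> acf acg e e0; have e20 : 0 < e / 2 by lra.
have [d1 d10 fd] := acf _ e20; have [d2 d20 gd] := acg _ e20.
exists (Num.min d1 d2); first by rewrite lt_min d10.
move=> s ins ps; rewrite lt_min => /andP[sd1 sd2].
have := fd s ins ps sd1; have := gd s ins ps sd2 => gs fs.
apply: (@le_lt_trans _ _ (\sum_(p <- s) (`|f p.2 - f p.1| + `|g p.2 - g p.1|))).
  apply: ler_sum => p _; rewrite (_ : _ - _ = (f p.2 - f p.1) - (g p.2 - g p.1)) ?ler_normB//=.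
  by lra.
by rewrite big_split/=; lra.
Qed.

(** A function of bounded variation is the difference of two nondecreasing
functions, its variation V and V - f, which here are absolutely continuous too. *)
Lemma ac_on_density (R : realType) (a b : R) (f : R -> R) : a <= b -> ac_on a b f ->
  exists phi : R -> R, lebesgue_measure.-integrable setT (EFin \o phi) /\
  forall x, a <= x <= b -> f x = f a + \int[lebesgue_measure]_(t in `]a, x]) phi t.
Proof.
move=> ab acf; pose V x := fine (total_variation a x f).
have acV : ac_on a b V by exact: ac_on_variation_function.
pose V1 := V \o clamp a b; pose V2 := (V \- f) \o clamp a b.
have cl x y : x <= y -> [/\ a <= clamp a b x, clamp a b x <= clamp a b y & clamp a b y <= b].
  move=> xy; rewrite le_clamp//.
  by have /andP[-> _] := clamp_itv x ab; have /andP[_ ->] := clamp_itv y ab.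
have nd1 : {homo V1 : x y / x <= y}.
  move=> x y /cl[ax xy yb]; rewrite -subr_ge0 (le_trans (normr_ge0 (f (clamp a b y) - f (clamp a b x))))//.
  exact: (variation_function_ge ab acf).
have nd2 : {homo V2 : x y / x <= y}.
  move=> x y /cl[ax xy yb]; have := variation_function_ge ab acf ax xy yb.
  by rewrite /V2/= -!/(V _); move: (ler_norm (f (clamp a b y) - f (clamp a b x))); lra.
have [p1 [ip1 p1E]] := @nondecreasing_ac_density _ a b _ nd1 (ac_on_line ab acV).
have [p2 [ip2 p2E]] := @nondecreasing_ac_density _ a b _ nd2 (ac_on_line ab (ac_onB acV acf)).
exists (p1 \- p2); split.
  by rewrite (_ : _ \o _ = (EFin \o p1) \- (EFin \o p2))%E//; exact: integrableB.
move=> x axb; rewrite RintegralB//; last 2 first.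
- by apply: integrableS ip1 => //; exact: measurable_itv.
- by apply: integrableS ip2 => //; exact: measurable_itv.
have := p1E x axb; have := p2E x axb.
rewrite /V1 /V2 /= !clamp_id ?axb ?lexx//.
by lra.
Qed.

Lemma ac_on_derive (R : realType) (a b : R) (f phi : R -> R) :
  lebesgue_measure.-integrable setT (EFin \o phi) ->
  (forall x, a <= x <= b -> f x = f a + \int[lebesgue_measure]_(t in `]a, x]) phi t) ->
  {ae (@lebesgue_measure R), forall x, x \in `]a, b[ ->
     derivable f x 1 /\ derive1 f x = phi x}.
Proof.
move=> iphi fE.
have := @FTC1 R phi (BRight a).
have iS y : lebesgue_measure.-integrable [set` Interval (BRight a) (BRight y)] (EFin \o phi).
  by apply: integrableS iphi => //; exact: measurable_itv.
move=> /(_ iS (open_integrable_locally openT iphi)).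
apply: filterS; first exact: (ae_filter_ringOfSetsType lebesgue_measure).
move=> x /= Fx; rewrite in_itv/= => /andP[ax xb].
have [dF F'] := Fx ax.
have nearE : {near x, f =1 (fun y => f a + \int[lebesgue_measure]_(t in `]a, y]) phi t)}.
  have xab : x \in `]a, b[ by rewrite in_itv/= ax.
  near=> y; apply: fE; have : y \in `]a, b[ by near: y; exact: near_in_itvoo.
  by rewrite in_itv/= => /andP[/ltW -> /ltW ->].
have dF2 : is_derive x 1 (fun y => f a + \int[lebesgue_measure]_(t in `]a, y]) phi t) (phi x).
  rewrite -F' derive1E -[X in is_derive _ _ _ X]add0r.
  by apply: is_deriveD; apply: DeriveDef.
split; last by rewrite derive1E (near_eq_derive _ nearE) derive_val.
by apply: (near_eq_derivable _ (@ex_derive _ _ _ _ _ _ _ dF2)); apply: filterS nearE => y ->.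
Unshelve. all: by end_near. Qed.

(** * Measurability of the derivative *)

(** Continuity reduces the existence of the derivative to a Cauchy condition on
rational increments, which involves countably many conditions only. *)
Lemma measurable_cvg_diff_quot (R : realType) (f : R -> R) : continuous f ->
  measurable ([set x | cvg ((fun h : R => h^-1 * (f (h + x) - f x)) @ 0^')] : set R).
Proof.
move=> cf; pose q (h x : R) := h^-1 * (f (h + x) - f x).
pose A (k n : nat) (r : rat) : set R := [set x |
  0 < `|ratr r : R| < n.+1%:R^-1 -> `|q (ratr r) x - q (n.+2%:R^-1) x| <= k.+1%:R^-1].
have mq h : measurable_fun setT (q h).
  apply: continuous_measurable_fun => x; apply: cvgM; first exact: cvg_cst.
  apply: cvgB; last exact: cf.
  apply: (@cvg_comp _ _ _ (fun y => h + y) f _ (nbhs (h + x))); last exact: cf.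
  by apply: cvgD; [exact: cvg_cst|exact: cvg_id].
have mA k n r : measurable (A k n r).
  rewrite /A; case: (boolP (0 < `|ratr r : R| < n.+1%:R^-1)) => hr; last first.
    by rewrite (_ : mkset _ = setT)//; apply/seteqP; split.
  rewrite (_ : mkset _ = (fun x => `|q (ratr r) x - q (n.+2%:R^-1) x|) @^-1`
     [set` `]-oo, (k.+1%:R^-1 : R)]]).
    rewrite -[_ @^-1` _]setTI.
    have : measurable_fun setT (fun x => `|q (ratr r) x - q (n.+2%:R^-1) x|).
      by apply: measurableT_comp => //; apply: measurable_funB; exact: mq.
    by apply => //; exact: measurable_itv.
  apply/seteqP; split => x /=; first by move=> /(_ isT); rewrite in_itv.
  by rewrite in_itv/=.
rewrite (_ : mkset _ = \bigcap_k \bigcup_n \bigcap_r A k n r).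
  apply: bigcapT_measurable => k; apply: bigcup_measurable => n _.
  rewrite -[X in measurable X]setCK setC_bigcap; apply: measurableC.
  by apply: bigcupT_measurable_rat => r; exact: measurableC.
have n1gt0 n : 0 < n.+1%:R^-1 :> R by rewrite invr_gt0.
apply/seteqP; split => x /=.
- move=> /cvg_ex[l ql] k _; have e0 : 0 < k.+1%:R^-1 / 2 :> R by rewrite divr_gt0.
  have /cvgrPdist_le /(_ _ e0) [d /= d0 dq] := ql.
  have [n nd] : exists n : nat, n.+1%:R^-1 < d.
    by have [n] := ltr_add_invr d0; rewrite add0r; exists n.
  exists n => // r _ /andP[r0 rn].
  have h1 : `|l - q (ratr r) x| <= k.+1%:R^-1 / 2.
    apply: dq; rewrite /ball_/= ?sub0r ?normrN ?(lt_trans rn)//.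
    by rewrite -normr_gt0.
  have h2 : `|l - q (n.+2%:R^-1) x| <= k.+1%:R^-1 / 2.
    apply: dq; rewrite /ball_/= ?sub0r ?normrN ?gtr0_norm// ?gt_eqF//.
    by rewrite (le_lt_trans _ nd)// lef_pV2 ?posrE// ler_nat.
  rewrite (_ : _ - _ = (l - q (n.+2%:R^-1) x) - (l - q (ratr r) x)); last by lra.
  by rewrite (le_trans (ler_normB _ _))// (splitr k.+1%:R^-1) lerD.
- move=> qC; apply/cauchy_cvgP/cauchy_exP => e e0.
  have [k ke] : exists k : nat, k.+1%:R^-1 < e.
    by have [n] := ltr_add_invr e0; rewrite add0r; exists n.
  have [n _ qn] := qC k I; exists (q n.+2%:R^-1 x).
  exists n.+1%:R^-1 => //= h; rewrite /ball_/= sub0r normrN => hn h0.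
  rewrite /ball/= distrC (le_lt_trans _ ke)// leNgt; apply/negP => gap.
  pose G h := `|q h x - q n.+2%:R^-1 x|.
  have cG : {for h, continuous G}.
    apply: cvg_norm; apply: cvgB; last exact: cvg_cst.
    apply: cvgM; first exact: cvgV.
    apply: cvgB; last exact: cvg_cst.
    apply: (@cvg_comp _ _ _ (fun y => y + x) f _ (nbhs (h + x))); last exact: cf.
    by apply: cvgD; [exact: cvg_id|exact: cvg_cst].
  have : \forall y \near h, [/\ k.+1%:R^-1 < G y, `|y| < n.+1%:R^-1 & 0 < `|y|].
    near=> y; split.
    - by near: y; apply: (cvgr_gt _ cG).
    - by near: y; apply: (cvgr_lt _ (@cvg_norm _ _ _ _ _ _ _ cvg_id)).
    - by near: y; apply: (cvgr_gt _ (@cvg_norm _ _ _ _ _ _ _ cvg_id)); rewrite normr_gt0.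
  case=> d /= d0 dG; have : h - d < h + d by lra.
  move=> /rat_in_itvoo[r]; rewrite in_itv/= => /andP[r1 r2].
  have [|G1 G2 G3] := dG (ratr r).
    by rewrite /ball_/= ltr_norml; lra.
  have := qn r I; rewrite /A/= G2 G3 => /(_ isT).
  by rewrite leNgt => /negP; apply.
Unshelve. all: by end_near. Qed.

(** On the measurable set where the difference quotients converge, the derivative
is their limit along 1 / (n + 1). *)
Lemma measurable_derive1 (R : realType) (f : R -> R) : continuous f ->
  measurable_fun setT (derive1 f : R -> R).
Proof.
move=> cf; pose q (h x : R) := h^-1 * (f (h + x) - f x).
pose D := [set x | cvg ((q ^~ x) @ 0^')].
have mD : measurable (D : set R) by exact: measurable_cvg_diff_quot.
pose h (n : nat) x := if x \in D then q n.+1%:R^-1 x else (point : R).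
apply: (@measurable_fun_cvg _ _ _ setT h) => [n|x _].
  apply: measurable_fun_ifT; last exact: measurable_cst.
    apply: (measurable_fun_bool true) => //.
    by rewrite setTI preimage_mem_true.
  apply: continuous_measurable_fun => x; apply: cvgM; first exact: cvg_cst.
  apply: cvgB; last exact: cf.
  apply: (@cvg_comp _ _ _ (fun y => _ + y) f _ (nbhs (n.+1%:R^-1 + x))); last exact: cf.
  by apply: cvgD; [exact: cvg_cst|exact: cvg_id].
rewrite /h /derive1; have [xD|xD] := pselect (D x); last first.
  rewrite memNset//.
  (* a divergent limit is the default point, hence the same value off D *)
  have -> : lim ((fun h : R => h^-1 *: (f (h + x) - f x)) @ 0^') = point by exact: dvgP.
  exact: cvg_cst.
rewrite mem_set//.
have /cvgr_dnbhsP := xD; apply; split; first by move=> n; rewrite invr_eq0 pnatr_eq0.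
exact: cvg_harmonic.
Qed.

(** * Convolution of integrable functions *)

Section reflection.
Context {R : realType}.
Local Notation mu := (@lebesgue_measure R).
Implicit Types (c : R).

Lemma lebesgue_measure_reflect c (A : set R) : measurable A ->
  pushforward mu (fun t : measurableTypeR R => c - t : measurableTypeR R) A = mu A.
Proof.
have mphi : measurable_fun setT (fun t : measurableTypeR R => c - t : measurableTypeR R).
  by apply: measurable_funB.
move=> mA; apply/esym; apply: (@lebesgue_measure_unique R
  (pushforward mu (fun t : measurableTypeR R => c - t : measurableTypeR R))) => // _ [[a b]] _ <-.
rewrite [RHS](_ : _ = mu `[c - b, c - a[%classic); last congr (mu _).
  by rewrite !lebesgue_measure_itv/= !lte_fin ltrD2l ltrN2; case: ifP => // _;
     rewrite -!EFinB; congr EFin; lra.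
by apply/seteqP; split => x /=; rewrite !in_itv/= => /andP[h1 h2]; apply/andP; split; lra.
Qed.

Local Open Scope ereal_scope.

Lemma ge0_integral_reflect c (f : R -> \bar R) : measurable_fun setT f ->
  (forall x, 0 <= f x) -> \int[mu]_t f (c - t)%R = \int[mu]_t f t.
Proof.
move=> mf f0; have mphi : measurable_fun setT (fun t : measurableTypeR R => c - t : measurableTypeR R)%R.
  by apply: measurable_funB.
transitivity (\int[pushforward mu (fun t : measurableTypeR R => c - t : measurableTypeR R)%R]_t f t).
  by rewrite ge0_integral_pushforward.
by apply: eq_measure_integral => // A mA _; exact: lebesgue_measure_reflect.
Qed.

Lemma integrable_reflect c (f : R -> \bar R) : mu.-integrable setT f ->
  mu.-integrable setT (fun t => f (c - t)%R).
Proof.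
move=> /integrableP[mf foo]; apply/integrableP; split.
  by apply: measurableT_comp => //; apply: measurable_funB.
rewrite (ge0_integral_reflect c (f := fun t => `|f t|))//.
exact: measurableT_comp.
Qed.

Lemma integral_reflect c (f : R -> \bar R) : mu.-integrable setT f ->
  \int[mu]_t f (c - t)%R = \int[mu]_t f t.
Proof.
move=> intf; have mphi : measurable_fun setT (fun t : measurableTypeR R => c - t : measurableTypeR R)%R.
  by apply: measurable_funB.
transitivity (\int[pushforward mu (fun t : measurableTypeR R => c - t : measurableTypeR R)%R]_t f t).
  rewrite integral_pushforward//; first exact: measurable_int intf.
  exact: integrable_reflect.
by apply: eq_measure_integral => // A mA _; exact: lebesgue_measure_reflect.
Qed.

Lemma ge0_integral_shift c (f : R -> \bar R) : measurable_fun setT f ->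
  (forall x, 0 <= f x) -> \int[mu]_t f (t - c)%R = \int[mu]_t f t.
Proof.
move=> mf f0; rewrite -(ge0_integral_reflect 0 mf f0).
rewrite -(ge0_integral_reflect c (f := fun t => f (0 - t)%R))//.
  by apply: eq_integral => t _; congr (f _); ring.
by apply: measurableT_comp => //; apply: measurable_funB.
Qed.

Lemma integral_shift c (f : R -> \bar R) : mu.-integrable setT f ->
  \int[mu]_t f (t - c)%R = \int[mu]_t f t.
Proof.
move=> intf; rewrite -(integral_reflect 0 intf).
rewrite -(integral_reflect c (integrable_reflect 0 intf)).
by apply: eq_integral => t _; congr (f _); ring.
Qed.

End reflection.

Section convolution.
Context {R : realType}.
Local Notation mu := (@lebesgue_measure R).
Local Notation T := (measurableTypeR R).
Variables K psi : R -> R.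
Hypothesis iK : mu.-integrable setT (EFin \o K).
Hypothesis ipsi : mu.-integrable setT (EFin \o psi).

Definition convolution (s : R) : R := \int[mu]_t (K (s - t) * psi t).

Let mK : measurable_fun setT (K : T -> R).
Proof. by apply/measurable_EFinP; exact: measurable_int iK. Qed.

Let mpsi : measurable_fun setT (psi : T -> R).
Proof. by apply/measurable_EFinP; exact: measurable_int ipsi. Qed.

Let L (p : T * T) : \bar R := (K (p.1 - p.2) * psi p.2)%:E.

Let mL : measurable_fun setT L.
Proof.
apply/measurable_EFinP; apply: measurable_funM.
  apply: (measurableT_comp mK); apply: measurable_funB.
    exact: measurable_fst.
  exact: measurable_snd.
by apply: (measurableT_comp mpsi); exact: measurable_snd.
Qed.

Let iL : (mu \x mu)%E.-integrable setT L.
Proof.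
apply: (@integrable21ltyP _ _ T T R mu mu L mL).2.
have /integrableP[_ psioo] := ipsi; have /integrableP[mEK Koo] := iK.
have inner t : (\int[mu]_s `|L (s, t)| = `|psi t|%:E * \int[mu]_x `|K x|%:E)%E.
  under eq_integral => s _ do rewrite /L/= normrM EFinM muleC.
  rewrite ge0_integralZl//; last first.
    apply/measurable_EFinP; apply: measurableT_comp => //; apply: (measurableT_comp mK).
    by apply: measurable_funB.
  rewrite (@ge0_integral_shift _ t (fun u => `|K u|%:E))//.
  by apply/measurable_EFinP; exact: measurableT_comp.
under eq_integral => t _ do rewrite inner muleC.
rewrite ge0_integralZl//.
- have [r rE] : exists r : R, (\int[mu]_x `|K x|%:E = r%:E)%E.
    by exists (fine (\int[mu]_x `|K x|%:E)%E); rewrite fineK// ge0_fin_numE// integral_ge0.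
  by rewrite rE; apply: lte_mul_pinfty => //; rewrite -rE integral_ge0.
- by apply/measurable_EFinP; exact: measurableT_comp.
- by apply: integral_ge0.
Qed.

Lemma convolution_ae :
  {ae mu, forall s, mu.-integrable setT (fun t => (K (s - t) * psi t)%:E)}.
Proof. exact: ae_integrable1 iL. Qed.

Lemma integrable_convolution : mu.-integrable setT (EFin \o convolution).
Proof.
have iF := integrable_fubini_F iL.
apply: (le_integrable _ _ _ iF) => //; last first.
  move=> s _; rewrite /convolution /Rintegral/= -abse_EFin.
  by rewrite /fubini_F; case: (integral _ _ _) => //=; rewrite ?normr0 ?leey.
apply/measurable_EFinP; apply: measurableT_comp => //.
exact: measurable_int iF.
Qed.

Hypothesis K0 : forall u : R, u <= 0 -> K u = 0.
Hypothesis psi0 : forall u : R, u <= 0 -> psi u = 0.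

Lemma convolution_itv s : convolution s = \int[mu]_(t in `]0, s[) (K (s - t) * psi t).
Proof.
rewrite [RHS]Rintegral_mkcond; apply: eq_Rintegral => t _; rewrite patchE.
case: ifPn => // /negP st.
have [t0|t0] := leP t 0; first by rewrite psi0 ?mulr0.
rewrite K0 ?mul0r// subr_le0 leNgt; apply/negP => ts; apply: st; apply: mem_set => /=.
by rewrite in_itv/= t0.
Qed.

Lemma integrable_convolution_itv : {ae mu, forall s,
  mu.-integrable `]0, s[ (fun t => (K (s - t) * psi t)%:E)}.
Proof.
have := convolution_ae; apply: filterS; first exact: (ae_filter_ringOfSetsType mu).
by move=> s; apply: integrableS => //; exact: measurable_itv.
Qed.

Let ind (x : R) (s : T) : R := \1_(`]-oo, x] : set T) s.

Let mind x : measurable_fun setT (ind x).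
Proof. by apply: measurable_indic; exact: measurable_itv. Qed.

Let indE (x s : R) : ind x s = (s <= x)%R%:R.
Proof. by rewrite /ind indicE mem_setE in_itv/=. Qed.

Let ind01 (x s : R) : `|ind x s| <= 1.
Proof. by rewrite indE; case: (s <= x); rewrite ?normr1 ?normr0. Qed.

Let iLx x : (mu \x mu)%E.-integrable setT (fun p : T * T => L p * (ind x p.1)%:E)%E.
Proof.
apply: le_integrable iL => //.
  apply/measurable_EFinP; apply: measurable_funM; first exact/measurable_EFinP.
  by apply: (measurableT_comp (mind x)); exact: measurable_fst.
move=> p _; rewrite /L -EFinM !abse_EFin lee_fin normrM.
by rewrite -[leRHS]mulr1 ler_wpM2l.
Qed.

Let iKpsi : (mu \x mu)%E.-integrable setT (fun p : T * T => (K p.1 * psi p.2)%:E).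
Proof.
have m : measurable_fun setT (fun p : T * T => (K p.1 * psi p.2)%:E).
  apply/measurable_EFinP; apply: measurable_funM.
    by apply: (measurableT_comp mK); exact: measurable_fst.
  by apply: (measurableT_comp mpsi); exact: measurable_snd.
apply: (@integrable21ltyP _ _ T T R mu mu _ m).2; have := (@integrable21ltyP _ _ T T R mu mu L mL).1 iL.
rewrite (_ : (fun y => _) = (fun y => \int[mu]_x `|(K x * psi y)%:E|)%E)//.
apply/funext => t.
rewrite -(@ge0_integral_shift _ t (fun u => `|(K u * psi t)%:E|%E))//.
apply/measurable_EFinP; apply: measurableT_comp => //.
by apply: measurable_funM.
Qed.

Let H (x : R) (p : T * T) : R := K p.1 * psi p.2 * ind x (p.1 + p.2).

Let iH x : (mu \x mu)%E.-integrable setT (EFin \o H x).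
Proof.
apply: le_integrable iKpsi => //.
  apply/measurable_EFinP; apply: measurable_funM.
    by apply/measurable_EFinP; exact: measurable_int iKpsi.
  by apply: (measurableT_comp (mind x)); apply: measurable_funD;
     [exact: measurable_fst|exact: measurable_snd].
move=> p _; rewrite /H/= lee_fin normrM.
by rewrite -[leRHS]mulr1 ler_wpM2l.
Qed.

(** Fubini, followed by the translation s = u + t in the inner integral. *)
Let swap x : (\int[mu]_s \int[mu]_t (L (s, t) * (ind x s)%:E) =
              \int[mu]_u \int[mu]_v (H x (u, v))%:E)%E.
Proof.
rewrite (Fubini (iLx x)) (Fubini (iH x)); apply: eq_integral => t _.
rewrite -(@integral_shift _ t (fun u => (H x (u, t))%:E)).
  by apply: eq_integral => s _; rewrite /L /H/= subrK.
have iZ : mu.-integrable setT (fun u : T => (psi t)%:E * (K u)%:E)%E by exact: integrableZl.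
apply: (le_integrable _ _ _ iZ) => //.
- apply/measurable_EFinP; apply: measurable_funM.
    by apply: measurable_funM => /=; [exact: mK|exact: measurable_cst].
  apply: (measurableT_comp (mind x)) => /=.
  by apply: measurable_funD; [exact: measurable_id|exact: measurable_cst].
- move=> u _; rewrite /H/= lee_fin normrM [K u * _]mulrC normrM.
  by rewrite -[leRHS]mulr1 ler_wpM2l.
Qed.

Let integral_convolution x :
  \int[mu]_(s in `]0, x]) convolution s = fine (\int[mu]_u \int[mu]_v (H x (u, v))%:E).
Proof.
rewrite -swap Rintegral_mkcond /Rintegral; congr fine.
have iFx := integrable_fubini_F (iLx x).
apply: ae_eq_integral => //.
- apply/measurable_EFinP; apply/(measurable_restrictT _ _).1; first exact: measurable_itv.
  by apply: measurable_funTS; apply/measurable_EFinP; exact: measurable_int integrable_convolution.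
- exact: measurable_int iFx.
have := convolution_ae; apply: filterS; first exact: (ae_filter_ringOfSetsType mu).
move=> s is_ _; rewrite patchE.
transitivity ((\int[mu]_t L (s, t)) * (ind x s)%:E)%E; last first.
  rewrite -integralZr//.
rewrite indE; case: ifPn => [/set_mem /=|/negP sx].
  rewrite in_itv/= => /andP[s0 ->]; rewrite mule1 /convolution /Rintegral fineK//.
  exact: integrable_fin_num.
have [s0|s0] := leP s 0.
  rewrite integral0_eq ?mul0e// => t _; rewrite /L/=.
  have [t0|t0] := leP t 0; first by rewrite psi0 ?mulr0.
  by rewrite K0 ?mul0r//; lra.
case: (leP s x) => sx'; last by rewrite mule0.
by exfalso; apply: sx; apply: mem_set; rewrite /= in_itv/= s0.
Qed.

Let Psi (t : R) : R := \int[mu]_(v in `]0, t]) psi v.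

Let inner x (u : T) : (\int[mu]_v (H x (u, v))%:E = (K u * Psi (x - u))%:E)%E.
Proof.
have ipsi_x : mu.-integrable `]0, x - u] (EFin \o psi).
  by apply: integrableS ipsi => //; exact: measurable_itv.
rewrite EFinM /Psi /Rintegral fineK; last exact: integrable_fin_num.
rewrite -integralZl//; rewrite [RHS]integral_mkcond; apply: eq_integral => v _.
rewrite patchE /H/= indE; case: ifPn => [/set_mem /=|/negP sx].
  by rewrite in_itv/= lerBrDl => /andP[_ ->]; rewrite mulr1.
have [v0|v0] := leP v 0; first by rewrite psi0// mulr0 mul0r.
case: (leP (u + v) x) => uvx; last by rewrite mulr0.
by exfalso; apply: sx; apply: mem_set; rewrite /= in_itv/= v0 lerBrDl.
Qed.

Let iG x : mu.-integrable setT (fun u : T => (K u * Psi (x - u))%:E).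
Proof.
by have := integrable_fubini_F (iH x); congr (is_true (_ .-integrable _ _));
   apply/funext => u; exact: inner.
Qed.

(** Apart from the terms in c, both sides are integrals of K u * psi v over the
triangle u, v > 0, u + v <= x. *)
Lemma integral_conv_primitive (c x : R) :
  \int[mu]_(t in `]0, x[) (K (x - t) * (c + \int[mu]_(v in `]0, t]) psi v)) =
  c * \int[mu]_(u in `]0, x[) K u + \int[mu]_(s in `]0, x]) convolution s.
Proof.
rewrite integral_convolution; under eq_integral do rewrite inner.
rewrite -/(Rintegral mu setT (fun u : T => K u * Psi (x - u))).
have iKx : mu.-integrable setT (EFin \o (K \_ `]0, x[)).
  rewrite -restrict_EFin; apply/integrable_restrict => //; rewrite setTI.
  by apply: integrableS iK => //; exact: measurable_itv.
have icK : mu.-integrable setT (fun u : T => (c * (K \_ `]0, x[) u)%:E).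
  exact: (integrableZl measurableT c iKx).
rewrite [X in c * X]Rintegral_mkcond.
rewrite -(@RintegralZl _ _ _ mu setT (K \_ `]0, x[) c measurableT iKx).
rewrite -(RintegralD measurableT icK (iG x)).
rewrite Rintegral_mkcond /Rintegral; congr fine.
rewrite -[RHS](integral_reflect x); last first.
  exact: (integrableD measurableT icK (iG x)).
apply: eq_integral => t _; congr EFin; rewrite !patchE.
rewrite (_ : x - (x - t) = t); last by ring.
case: ifPn => [/set_mem/=|/negP tx].
  rewrite in_itv/= => /andP[t0 tx]; rewrite mem_set; last by rewrite /= in_itv/=; apply/andP; split; lra.
  by rewrite -/(Psi t) mulrDr [c * _]mulrC.
rewrite memNset ?mulr0 ?add0r; last first.
  rewrite /= in_itv/= => /andP[h1 h2]; apply: tx; apply: mem_set; rewrite /= in_itv/=.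
  by apply/andP; split; lra.
have [t0|t0] := leP t 0.
  by rewrite /Psi set_itv_ge ?Rintegral_set0 ?mulr0// -leNgt bnd_simp.
rewrite K0 ?mul0r// subr_le0 leNgt; apply/negP => tlx; apply: tx; apply: mem_set.
by rewrite /= in_itv/= t0.
Qed.

End convolution.

(** * Improper integrals *)

(** Dominated convergence for integrals over varying sets: the sets only need to
converge pointwise. *)
Lemma Rintegral_cvg_set (R : realType) (f : R -> R) (D A : set R) (An : nat -> set R) :
  measurable D -> measurable A -> (forall n, measurable (An n)) ->
  (@lebesgue_measure R).-integrable D (EFin \o f) ->
  (forall t, D t -> \forall n \near \oo, (t \in An n) = (t \in A)) ->
  \int[lebesgue_measure]_(t in D `&` An n) f t @[n --> \oo] -->
    \int[lebesgue_measure]_(t in D `&` A) f t.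
Proof.
move=> mD mA mAn intf cvA.
have mf : measurable_fun D f by apply/measurable_EFinP; exact: measurable_int intf.
have mpatch B : measurable B -> measurable_fun D (f \_ B).
  move=> mB; apply: (measurable_restrict f mB mD).1.
  by apply: measurable_funS mf => //; exact: subIsetl.
have [||||| _ _ h] := @dominated_convergence _ (measurableTypeR R) R lebesgue_measure D mD
    (fun n => EFin \o (f \_ (An n))) (EFin \o (f \_ A)) (abse \o (EFin \o f)).
- by move=> n; apply/measurable_EFinP; exact: mpatch.
- by apply/measurable_EFinP; exact: mpatch.
- apply: aeW => t Dt; apply: cvg_near_cst; near=> n.
  by rewrite /= !patchE (_ : (t \in An n) = (t \in A))//; near: n; exact: cvA.
- exact: integrable_abse.
- apply: aeW => t n Dt; rewrite /= patchE lee_fin; case: ifPn => // _.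
  by rewrite normr0.
have RE B : measurable B -> (\int[lebesgue_measure]_(x in D) (EFin \o f \_ B) x)%E =
    (\int[lebesgue_measure]_(t in D `&` B) f t)%:E.
  move=> mB; rewrite -restrict_EFin -integral_mkcondr /Rintegral fineK//.
  have mDB : measurable (D `&` B) by exact: measurableI.
  by apply: integrable_fin_num => //; apply: integrableS intf.
move: h; rewrite RE// => /fine_cvgP[_]; apply: cvg_trans; apply: near_eq_cvg.
by apply: nearW => n /=; rewrite -[X in fine X]/(\int[lebesgue_measure]_(x in D) (EFin \o f \_ (An n)) x)%E RE.
Unshelve. all: by end_near. Qed.

Section improper.
Context {R : realType}.
Local Notation mu := (@lebesgue_measure R).
Variables F f : R -> R.
Hypothesis dF : forall t : R, 0 < t -> is_derive t 1 F (f t).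
Hypothesis cf : forall t : R, 0 < t -> {for t, continuous f}.

Lemma FTC2_pos (a b : R) : 0 < a -> a < b ->
  (\int[mu]_(t in `[a, b]) (f t)%:E = (F b - F a)%:E)%E.
Proof.
move=> a0 ab; rewrite EFinB; apply: continuous_FTC2 => //.
- apply: continuous_in_subspaceT => t /set_mem/=; rewrite in_itv/= => /andP[at_ _].
  by apply: cf; exact: lt_le_trans at_.
- have cF (t : R) : 0 < t -> F x @[x --> t] --> F t.
    by move=> t0; apply: differentiable_continuous; apply/derivable1_diffP; have [] := dF t0.
  split.
  + by move=> t; rewrite in_itv/= => /andP[at_ _]; have [] := dF (lt_trans a0 at_).
  + by apply: cvg_at_right_filter; exact: cF.
  + by apply: cvg_at_left_filter; apply: cF; exact: lt_trans ab.
- by move=> t; rewrite in_itv/= => /andP[at_ _]; rewrite derive1E; have [_ ->] := dF (lt_trans a0 at_).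
Qed.

Lemma measurable_pos : measurable_fun (`]0, +oo[%classic : set R) f.
Proof.
apply: open_continuous_measurable_fun; first exact: interval_open.
by move=> t /set_mem/=; rewrite in_itv/= andbT => /cf.
Qed.

(** Compact segments that exhaust the half-line. *)
Let J (n : nat) : set R := `[n.+2%:R^-1, n.+2%:R].

Let Jlt n : n.+2%:R^-1 < n.+2%:R :> R.
Proof.
apply: (@lt_trans _ _ 1); last by rewrite ltr1n.
by rewrite invf_lt1 ?ltr1n.
Qed.

Let JU : \bigcup_n J n = `]0, +oo[%classic.
Proof.
apply/seteqP; split => [t [n _]|t] /=; rewrite /J/= !in_itv/=.
  by move=> /andP[h _]; rewrite andbT; apply: lt_le_trans h; rewrite invr_gt0.
rewrite andbT => t0; exists (maxn (Num.bound t) (Num.bound t^-1)) => //=.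
set N := maxn _ _; rewrite in_itv/=; apply/andP; split.
- rewrite -[t]invrK lef_pV2 ?posrE ?invr_gt0//.
  rewrite (le_trans (ltW (archi_boundP (ltW _))))// ?invr_gt0// ler_nat.
  by rewrite (leq_trans (leq_maxr (Num.bound t) _))// -/N leqW.
- rewrite (le_trans (ltW (archi_boundP (ltW _))))// ler_nat.
  by rewrite (leq_trans (leq_maxl _ (Num.bound t^-1)))// -/N leqW.
Qed.

Let Jpos n : J n `<=` `]0, +oo[.
Proof. by rewrite -JU => t Jt; exists n. Qed.

Let Jnd : nondecreasing_seq J.
Proof.
move=> n p np; apply/subsetPset => t; rewrite /J/= !in_itv/= => /andP[h1 h2].
apply/andP; split.
  by apply: le_trans h1; rewrite lef_pV2 ?posrE// ler_nat !ltnS.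
by apply: (le_trans h2); rewrite ler_nat !ltnS.
Qed.

(** The integrals over compact segments are differences of values of the bounded
primitive F, so monotone convergence bounds the integral over the half-line. *)
Lemma improper_ge0_integrable (M : R) : (forall t, 0 < t -> 0 <= f t) ->
  (forall t, 0 < t -> `|F t| <= M) -> mu.-integrable `]0, +oo[ (EFin \o f).
Proof.
move=> f0 FM; apply/integrableP; split; first by apply/measurable_EFinP; exact: measurable_pos.
rewrite (@eq_integral _ _ _ mu _ (EFin \o f)); last first.
  by move=> t /set_mem/=; rewrite in_itv/= andbT => t0; rewrite ger0_norm// f0.
have fJ n : (\int[mu]_(x in J n) (EFin \o f) x <= (M + M)%:E)%E.
  rewrite FTC2_pos ?invr_gt0// lee_fin.
  rewrite (le_trans (ler_norm _))// (le_trans (ler_normB _ _))// lerD// FM ?invr_gt0//.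
apply: (@le_lt_trans _ _ (M + M)%:E); last by rewrite ltry.
have mfJ n : measurable_fun (J n) (EFin \o f).
  apply/measurable_EFinP; apply: measurable_funS measurable_pos; last exact: Jpos.
  exact: measurable_itv.
have mJ n : measurable (J n : set R) by exact: measurable_itv.
have f0J n x : J n x -> (0 <= (EFin \o f) x)%E.
  by move=> /Jpos/=; rewrite in_itv/= andbT lee_fin; exact: f0.
have cv := @ge0_nondecreasing_set_cvg_integral _ (measurableTypeR R) R J (EFin \o f) mu Jnd mJ mfJ f0J.
rewrite -JU -(cvg_lim _ cv)//; apply: lime_le; last exact: nearW.
by apply/cvg_ex; eexists; exact: cv.
Qed.

Lemma improper_FTC2 (A B : R) : mu.-integrable `]0, +oo[ (EFin \o f) ->
  F t @[t --> 0^'+] --> A -> F t @[t --> +oo] --> B ->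
  \int[mu]_(t in `]0, +oo[) f t = B - A.
Proof.
move=> intf FA FB.
have mJ n : measurable (J n : set R) by exact: measurable_itv.
have JT (t : R) : `]0, +oo[%classic t ->
    \forall n \near \oo, (t \in J n) = (t \in [set: R]).
  move=> tpos; have [n _ Jt] : (\bigcup_n J n) t by rewrite JU.
  exists n => // p /= np; rewrite in_setT; apply: mem_set.
  by have /subsetPset := Jnd np; apply.
have h := Rintegral_cvg_set (measurable_itv _) measurableT mJ intf JT.
have cv : F n.+2%:R - F n.+2%:R^-1 @[n --> \oo] --> B - A.
  apply: cvgB.
    have /cvg_pinftyP/(_ (fun n => n.+2%:R)) := FB; apply.
    apply/cvgryPge => a; near=> n; rewrite (@le_trans _ _ n%:R)// ?ler_nat ?leqW//.
    by near: n; exact: nbhs_infty_ger.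
  have /cvg_at_rightP/(_ (fun n => n.+2%:R^-1)) := FA; apply; split => //.
  by have := @cvg_harmonic R; rewrite -cvg_shiftS.
have hE : (fun n => \int[mu]_(t in `]0, +oo[%classic `&` J n) f t) =
    (fun n => F n.+2%:R - F n.+2%:R^-1).
  by apply/funext => n; rewrite setIidr ?/Rintegral ?FTC2_pos ?invr_gt0//; exact: Jpos.
move: h; rewrite hE setIT => h.
by have := cvg_lim (@Rhausdorff R) h; rewrite (cvg_lim (@Rhausdorff R) cv)//= => <-.
Unshelve. all: by end_near. Qed.

End improper.

Section substitution.
Context {R : realType}.
Local Notation mu := (@lebesgue_measure R).
Variable f : R -> R.
Hypothesis cf : forall t : R, 0 < t -> {for t, continuous f}.
Hypothesis intf : mu.-integrable `]0, +oo[ (EFin \o f).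

(** The substitution formula is the improper fundamental theorem for F \o phi. *)
Let F (u : R) := \int[mu]_(t in `]0, u]) f t.

Let dF (u : R) : 0 < u -> is_derive u 1 F (f u).
Proof.
move=> u0; have uu : u < u + 1 by rewrite ltrDl.
have intu : mu.-integrable [set` Interval (BRight 0) (BRight (u + 1))] (EFin \o f).
  apply: integrableS intf => //.
  by move=> t /=; rewrite !in_itv/= andbT => /andP[].
have [d <-] := continuous_FTC1 uu intu u0 (cf u0).
by rewrite derive1E; exact: DeriveDef.
Qed.

Let FE u : F u = \int[mu]_(t in `]0, +oo[%classic `&` [set` `]-oo, u]]) f t.
Proof.
by rewrite /F; congr (Rintegral _ _ _); apply/seteqP; split => t /=;
   rewrite !in_itv/= andbT => /andP.
Qed.

Let F_0 : F t @[t --> 0^'+] --> 0.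
Proof.
apply/cvg_at_rightP => u [u0 cu].
rewrite -(Rintegral_set0 mu f) -(setI0 `]0, +oo[%classic).
under eq_fun do rewrite FE.
apply: Rintegral_cvg_set => //.
move=> t /=; rewrite in_itv/= andbT => t0; near=> n.
rewrite in_set0; apply/negbTE/negP => /set_mem/=; rewrite in_itv/= leNgt => /negP; apply.
by near: n; apply: (cvgr_lt _ cu).
Unshelve. all: by end_near. Qed.

Let F_y : F t @[t --> +oo] --> \int[mu]_(t in `]0, +oo[) f t.
Proof.
apply/cvg_pinftyP => u cu; rewrite -[X in Rintegral _ X](setIT `]0, +oo[%classic).
under eq_fun do rewrite FE.
apply: Rintegral_cvg_set => //.
move=> t /=; rewrite in_itv/= andbT => t0; near=> n.
rewrite in_setT; apply: mem_set; rewrite /= in_itv/=.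
by near: n; move/cvgryPge : cu; apply.
Unshelve. all: by end_near. Qed.

Variables phi psi : R -> R.
Hypothesis dphi : forall t : R, 0 < t -> is_derive t 1 phi (psi t).
Hypothesis phi_gt0 : forall t : R, 0 < t -> 0 < phi t.
Hypothesis cpsi : forall t : R, 0 < t -> {for t, continuous psi}.

Let g t := f (phi t) * psi t.

Let dFphi (t : R) : 0 < t -> is_derive t 1 (F \o phi) (g t).
Proof.
move=> t0; have d1 := dF (phi_gt0 t0); have d2 := dphi t0.
by rewrite /g -[f _ * _]/(f (phi t) *: psi t); exact: is_derive1_comp.
Qed.

Let cg (t : R) : 0 < t -> {for t, continuous g}.
Proof.
move=> t0; apply: cvgM; last exact: cpsi.
apply: continuous_comp; last by apply: cf; exact: phi_gt0.
by apply: differentiable_continuous; apply/derivable1_diffP; have [] := dphi t0.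
Qed.

Lemma substitution_ge0_integrable :
  (forall t, 0 < t -> 0 <= f t) -> (forall t, 0 < t -> 0 <= psi t) ->
  mu.-integrable `]0, +oo[ (EFin \o g).
Proof.
move=> f0 psi0.
apply: (@improper_ge0_integrable _ (F \o phi) g dFphi cg (\int[mu]_(t in `]0, +oo[) f t)).
  by move=> t t0; rewrite mulr_ge0 ?f0 ?psi0 ?phi_gt0.
move=> t t0 /=; rewrite ger0_norm.
  rewrite /F /Rintegral fine_le//.
  - apply: integrable_fin_num; first exact: measurable_itv.
    apply: integrableS intf; [exact: measurable_itv|exact: measurable_itv|].
    by move=> s /=; rewrite !in_itv/= andbT => /andP[].
  - by apply: integrable_fin_num => //; exact: measurable_itv.
  apply: ge0_subset_integral; [exact: measurable_itv|exact: measurable_itv| | |].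
  - exact: measurable_int intf.
  - by move=> s /=; rewrite in_itv/= andbT lee_fin; exact: f0.
  - by move=> s /=; rewrite !in_itv/= andbT => /andP[].
by apply: Rintegral_ge0 => s /=; rewrite in_itv/= => /andP[/f0].
Qed.

Lemma substitution_integral : phi t @[t --> 0^'+] --> 0 -> phi t @[t --> +oo] --> +oo ->
  mu.-integrable `]0, +oo[ (EFin \o g) ->
  \int[mu]_(t in `]0, +oo[) g t = \int[mu]_(t in `]0, +oo[) f t.
Proof.
move=> phi0 phiy ig; rewrite -[RHS]subr0.
apply: (@improper_FTC2 _ (F \o phi) g dFphi cg _ _ ig).
- apply/cvg_at_rightP => u [u0 cu]; have /cvg_at_rightP := F_0; apply.
  split; first by move=> n; exact: phi_gt0.
  by have /cvg_at_rightP := phi0; apply.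
- by apply: cvg_comp F_y.
Qed.

End substitution.

(** * Complex powers of a positive real *)

Section complex_components.
Context {R : realType}.
Implicit Types (x t : R) (z w : R[i]).

Lemma complex_eqP z w : Re z = Re w -> Im z = Im w -> z = w.
Proof. by case: z => a b; case: w => c d /= -> ->. Qed.

Lemma ReM z w : Re (z * w) = Re z * Re w - Im z * Im w.
Proof. by case: z => a b; case: w. Qed.

Lemma ImM z w : Im (z * w) = Re z * Im w + Im z * Re w.
Proof. by case: z => a b; case: w. Qed.

Lemma ReD z w : Re (z + w) = Re z + Re w.
Proof. by case: z => a b; case: w. Qed.

Lemma ImD z w : Im (z + w) = Im z + Im w.
Proof. by case: z => a b; case: w. Qed.

Lemma ReN z : Re (- z) = - Re z.
Proof. by case: z. Qed.

Lemma ImN z : Im (- z) = - Im z.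
Proof. by case: z. Qed.

Lemma Re1 : Re (1 : R[i]) = 1. Proof. by []. Qed.

Lemma Im1 : Im (1 : R[i]) = 0. Proof. by []. Qed.

Lemma natrC n : n%:R = (n%:R : R)%:C :> R[i].
Proof. by rewrite rmorph_nat. Qed.

Definition ReImE := (ReD, ImD, ReN, ImN, ReM, ImM, Re1, Im1).

Lemma invC x : (x%:C)^-1 = (x^-1)%:C :> R[i].
Proof. by rewrite fmorphV. Qed.

Lemma Re_divC z x : Re (z / x%:C) = Re z / x.
Proof. by rewrite invC ReM/= mulr0 subr0. Qed.

Lemma Im_divC z x : Im (z / x%:C) = Im z / x.
Proof. by rewrite invC ImM/= mulr0 add0r. Qed.

Lemma normcE z : normc z = Num.sqrt (Re z ^+ 2 + Im z ^+ 2).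
Proof. by case: z. Qed.

Lemma normc_ge0 z : 0 <= normc z.
Proof. by rewrite normcE sqrtr_ge0. Qed.

Lemma normcC x : normc x%:C = `|x|.
Proof. by rewrite normcE/= expr0n/= addr0 sqrtr_sqr. Qed.

Lemma normc_Re z : `|Re z| <= normc z.
Proof. by rewrite normcE -sqrtr_sqr ler_wsqrtr// lerDl sqr_ge0. Qed.

Lemma normc_Im z : `|Im z| <= normc z.
Proof. by rewrite normcE -sqrtr_sqr ler_wsqrtr// lerDr sqr_ge0. Qed.

Lemma normc_le z : normc z <= `|Re z| + `|Im z|.
Proof.
rewrite {1}(complexE z) (le_trans (le_normcD _ _))// ComplexField.Normc.normcM !normcC.
by rewrite lerD2l normcE/= expr0n/= add0r expr1n sqrtr1 mul1r.
Qed.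

Lemma normcX z n : normc (z ^+ n) = normc z ^+ n.
Proof.
elim: n => [|n IH]; first by rewrite !expr0 (normcC 1) normr1.
by rewrite !exprS ComplexField.Normc.normcM IH.
Qed.

Lemma normc_prod n (F : nat -> R[i]) :
  normc (\prod_(j < n) F j) = \prod_(j < n) normc (F j).
Proof.
elim: n => [|n IH]; first by rewrite !big_ord0 (normcC 1) normr1.
by rewrite !big_ord_recr/= ComplexField.Normc.normcM IH.
Qed.

Lemma normc_eq0 z : (normc z == 0) = (z == 0).
Proof.
apply/eqP/eqP => [/ComplexField.Normc.eq0_normc//|->].
by rewrite (normcC 0) normr0.
Qed.

End complex_components.

Section cpowR.
Context {R : realType}.
Implicit Types (x t : R) (z w : R[i]).

Lemma cpowRD t z w : cpowR t (z + w) = cpowR t z * cpowR t w.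
Proof.
apply: complex_eqP; rewrite /cpowR !ReImE/= !mulrDl expRD ?cosD ?sinD; ring.
Qed.

Lemma cpowR0 t : cpowR t 0 = 1.
Proof. by apply: complex_eqP; rewrite /cpowR/= !mul0r expR0 ?cos0 ?sin0 ?mulr1 ?mulr0. Qed.

Lemma cpowRC t x : 0 < t -> cpowR t x%:C = (t `^ x)%:C.
Proof.
move=> t0; apply: complex_eqP; rewrite /cpowR/= mul0r ?cos0 ?sin0 ?mulr1 ?mulr0//.
by rewrite /powR gt_eqF.
Qed.

Lemma cpowR1 t : 0 < t -> cpowR t 1 = t%:C.
Proof. by move=> t0; rewrite (cpowRC 1 t0) powRr1// ltW. Qed.

Lemma normc_cpowR t z : 0 < t -> normc (cpowR t z) = t `^ Re z.
Proof.
move=> t0; rewrite normcE/cpowR/= !exprMn -mulrDr cos2Dsin2 mulr1 sqrtr_sqr.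
by rewrite /powR gt_eqF// ger0_norm ?expR_ge0.
Qed.

Lemma cpowR_neq0 t z : 0 < t -> cpowR t z != 0.
Proof. by move=> t0; rewrite -normc_eq0 normc_cpowR// gt_eqF// powR_gt0. Qed.

Lemma cpowRB t z w : 0 < t -> cpowR t (z - w) = cpowR t z / cpowR t w.
Proof.
move=> t0; apply: (mulIf (cpowR_neq0 w t0)).
by rewrite -cpowRD subrK divfK// cpowR_neq0.
Qed.

Lemma cpowRX t z n : cpowR t z ^+ n = cpowR t (n%:R * z).
Proof.
elim: n => [|n IH]; first by rewrite expr0 mul0r cpowR0.
by rewrite exprS IH -cpowRD -natr1 mulrDl mul1r addrC.
Qed.

Lemma cpowR_powR t k z : 0 < t -> cpowR (t `^ k) z = cpowR t (k%:C * z).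
Proof.
move=> t0; have h a : k * a * ln t = a * (k * ln t) by ring.
by rewrite /cpowR ln_powR !ReImE/= !mul0r addr0 subr0 !h.
Qed.

Lemma cpowRM s t z : 0 < s -> 0 < t -> cpowR (s * t) z = cpowR s z * cpowR t z.
Proof.
move=> s0 t0; apply: complex_eqP;
  rewrite /cpowR !ReImE/= lnM ?posrE// !mulrDr expRD ?cosD ?sinD; ring.
Qed.

End cpowR.

Section complex_derivative.
Context {R : realType}.
Implicit Types (t : R) (g h : R -> R[i]) (d z : R[i]).

Definition is_cderive g t d :=
  is_derive t (1 : R) (fun s => Re (g s)) (Re d) /\
  is_derive t (1 : R) (fun s => Im (g s)) (Im d).

Lemma is_cderiveM g h t d e : is_cderive g t d -> is_cderive h t e ->
  is_cderive (fun s => g s * h s) t (d * h t + g t * e).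
Proof.
move=> [g1 g2] [h1 h2]; split.
  under eq_fun do rewrite ReM.
  have := is_deriveB (is_deriveM g1 h1) (is_deriveM g2 h2).
  move=> H; apply: (is_derive_eq H); rewrite !ReImE /GRing.scale/=; ring.
under eq_fun do rewrite ImM.
have := is_deriveD (is_deriveM g1 h2) (is_deriveM g2 h1).
move=> H; apply: (is_derive_eq H); rewrite !ReImE /GRing.scale/=; ring.
Qed.

Lemma is_cderive_cst z t : is_cderive (fun=> z) t 0.
Proof. by split; apply: is_derive_cst. Qed.

Lemma is_cderiveZ g t d z : is_cderive g t d -> is_cderive (fun s => z * g s) t (z * d).
Proof.
move=> gd; have := is_cderiveM (is_cderive_cst z t) gd.
by rewrite mul0r add0r.
Qed.

Lemma is_cderive_real (f : R -> R) t (d : R) : is_derive t (1 : R) f d ->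
  is_cderive (fun s => (f s)%:C) t d%:C.
Proof. by move=> fd; split => //; exact: is_derive_cst. Qed.

Lemma is_cderive_continuous g t d : is_cderive g t d ->
  {for t, continuous (fun s => Re (g s))} /\ {for t, continuous (fun s => Im (g s))}.
Proof.
by move=> [[d1 _] [d2 _]]; split; apply: differentiable_continuous; exact/derivable1_diffP.
Qed.

Lemma is_cderive_cpowR t z : 0 < t ->
  is_cderive (cpowR ^~ z) t (z * cpowR t (z - 1)).
Proof.
move=> t0; have lnt := is_derive1_ln t0.
have dl (a : R) : is_derive t (1 : R) (fun s => a * ln s) (a / t) by exact: is_deriveZ.
have de : is_derive t (1 : R) (fun s => expR (Re z * ln s)) (expR (Re z * ln t) * (Re z / t)).
  exact: (@is_derive1_comp _ expR).
have dc : is_derive t (1 : R) (fun s => cos (Im z * ln s)) (- sin (Im z * ln t) * (Im z / t)).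
  exact: (@is_derive1_comp _ cos).
have ds : is_derive t (1 : R) (fun s => sin (Im z * ln s)) (cos (Im z * ln t) * (Im z / t)).
  exact: (@is_derive1_comp _ sin).
have E : cpowR t (z - 1) = cpowR t z * (t^-1)%:C.
  by rewrite cpowRB// cpowR1// invC.
by split; [apply: (is_derive_eq (is_deriveM de dc))|apply: (is_derive_eq (is_deriveM de ds))];
  rewrite E !ReImE /cpowR /GRing.scale/=; ring.
Qed.

End complex_derivative.

(** * The Gamma integral and its functional equation *)

Section gamma.
Context {R : realType}.
Local Notation mu := (@lebesgue_measure R).
Local Notation pos := (`]0, +oo[%classic : set R).
Implicit Types (x t k : R) (z w : R[i]).

Definition gamma_kernel z t : R[i] := (expR (- t))%:C * cpowR t (z - 1).

Definition rgamma_fun x t := expR (- t) * t `^ (x - 1).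

Definition rgamma x := \int[mu]_(t in pos) rgamma_fun x t.

Let posP t : pos t -> 0 < t.
Proof. by rewrite /= in_itv/= andbT. Qed.

Let mpos : measurable (pos : set (measurableTypeR R)).
Proof. exact: measurable_itv. Qed.

(** Concavity: the logarithm lies below its tangent at p. *)
Lemma ln_le_affine (p t : R) : 0 < p -> 0 < t -> p * ln t <= t - p + p * ln p.
Proof.
move=> p0 t0; have := @le_ln1Dx R (t / p - 1).
rewrite [1 + _]addrC subrK => lnle; have {}lnle := lnle ltac:(by rewrite ltrBrDl subrr divr_gt0).
move: lnle.
rewrite ln_div ?posrE// => h.
have -> : t - p = p * (t / p - 1) by rewrite mulrBr mulr1 mulrC divfK// gt_eqF.
by rewrite -mulrDr ler_wpM2l ?(ltW p0)//; lra.
Qed.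

Lemma is_derive_powR (a t : R) : 0 < t -> is_derive t (1 : R) (@powR R ^~ a) (a * t `^ (a - 1)).
Proof.
move=> t0; have [h _] := is_cderive_cpowR a%:C t0.
have -> : a * t `^ (a - 1) = Re (a%:C * cpowR t (a%:C - 1)).
  have E : a%:C - 1 = (a - 1)%:C :> R[i] by rewrite rmorphB.
  by rewrite E cpowRC// ReM/= mul0r subr0.
have nearE : {near t, (fun s => Re (cpowR s a%:C)) =1 @powR R ^~ a}.
  near=> s; rewrite cpowRC//; near: s; exact: (cvgr_gt t cvg_id).
apply: DeriveDef; first by apply: (near_eq_derivable nearE); have [] := h.
by have [_ <-] := h; apply/esym/near_eq_derive.
Unshelve. all: by end_near. Qed.

Lemma continuous_powR_pos (a t : R) : 0 < t -> {for t, continuous (@powR R ^~ a)}.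
Proof.
move=> /(is_derive_powR a) [d _].
by apply: differentiable_continuous; apply/derivable1_diffP.
Qed.

Lemma continuous_rgamma_fun x t : 0 < t -> {for t, continuous (rgamma_fun x)}.
Proof.
move=> t0; apply: cvgM; last exact: continuous_powR_pos.
by apply: continuous_comp; [exact: continuousN|exact: continuous_expR].
Qed.

Lemma rgamma_fun_ge0 x t : 0 <= rgamma_fun x t.
Proof. by rewrite mulr_ge0 ?expR_ge0 ?powR_ge0. Qed.

(** The comparison function is the derivative of the bounded function
(t / (1 + t)) ^ x. *)
Lemma rgamma_fun_integrable x : 0 < x -> mu.-integrable pos (EFin \o rgamma_fun x).
Proof.
move=> x0; pose F t := expR (x * (ln t - ln (1 + t))).
pose f t := F t * (x * (t^-1 - (1 + t)^-1)).
have dF t : 0 < t -> is_derive t (1 : R) F (f t).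
  move=> t0; have d1 := is_derive1_ln t0.
  have t10 : 0 < 1 + t by lra.
  have d2 : is_derive t (1 : R) (fun s => ln (1 + s)) ((1 + t)^-1).
    have d3 : is_derive t (1 : R) (fun s => 1 + s) 1.
      by rewrite -[X in is_derive _ _ _ X]add0r; apply: is_deriveD.
    have := @is_derive1_comp _ (@ln R) (fun s => 1 + s) t _ _ (is_derive1_ln t10) d3.
    by rewrite mulr1.
  have d4 := is_deriveZ x (is_deriveB d1 d2).
  exact: (@is_derive1_comp _ expR _ t _ _ (is_derive_expR _) d4).
have cf t : 0 < t -> {for t, continuous f}.
  move=> t0; apply: cvgM.
    by have [d _] := dF t t0; apply: differentiable_continuous; apply/derivable1_diffP.
  apply: cvgM; first exact: cvg_cst.
  apply: cvgB; first by apply: cvgV; [rewrite gt_eqF|exact: cvg_id].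
  apply: cvgV; first by rewrite gt_eqF//; lra.
  by apply: cvgD; [exact: cvg_cst|exact: cvg_id].
have fE t : 0 < t -> f t = x * expR ((x - 1) * ln t - (x + 1) * ln (1 + t)).
  move=> t0; have t10 : 0 < 1 + t by lra.
  rewrite /f /F mulrCA; congr (x * _).
  have -> : t^-1 - (1 + t)^-1 = expR (- ln t - ln (1 + t)).
    rewrite expRD !expRN !lnK ?posrE//; field.
    by rewrite !gt_eqF.
  by rewrite -expRD; congr expR; ring.
have intf : mu.-integrable pos (EFin \o f).
  apply: (improper_ge0_integrable dF cf (M := 1)).
    by move=> t t0; rewrite fE// mulr_ge0 ?expR_ge0// ltW.
  move=> t t0; rewrite ger0_norm ?expR_ge0// -expR0 ler_expR.
  have : ln t <= ln (1 + t) by rewrite ler_ln ?posrE; lra.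
  by move=> h; rewrite pmulr_rle0//; lra.
pose c := expR (1 - (x + 1) + (x + 1) * ln (x + 1)) / x.
have intcf := integrableZl mpos c intf.
apply: (le_integrable _ _ _ intcf) => //.
  by apply/measurable_EFinP; apply: measurable_pos => t; exact: continuous_rgamma_fun.
move=> t /posP t0; rewrite /= lee_fin ger0_norm ?rgamma_fun_ge0//.
rewrite ger0_norm; last by rewrite fE// !mulr_ge0 ?expR_ge0 ?invr_ge0// ltW.
rewrite fE// /c mulrA divfK ?gt_eqF// -expRD /rgamma_fun /powR gt_eqF// -expRD ler_expR.
by have := @ln_le_affine (x + 1) (1 + t); rewrite !(ltr_wpDl _ _)//; lra.
Qed.

Lemma normc_gamma_kernel z t : 0 < t -> normc (gamma_kernel z t) = rgamma_fun (Re z) t.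
Proof.
move=> t0; rewrite ComplexField.Normc.normcM normcC normc_cpowR// ger0_norm ?expR_ge0//.
by rewrite ReD ReN Re1.
Qed.

(** Integrated over the half-line, this is the functional equation of Gamma. *)
Lemma is_cderive_exp_cpowR z t : 0 < t ->
  is_cderive (fun s => (expR (- s))%:C * cpowR s z) t (z * gamma_kernel z t - gamma_kernel (z + 1) t).
Proof.
move=> t0; have de : is_derive t (1 : R) (fun s => expR (- s)) (- expR (- t)).
  have := @is_derive1_comp _ expR (fun s => - s) t _ _ (is_derive_expR _) (is_deriveN (is_derive_id t 1)).
  by rewrite mulrN1.
have := is_cderiveM (is_cderive_real de) (is_cderive_cpowR z t0).
by congr (is_cderive _ _ _); rewrite /gamma_kernel addrK rmorphN/=; ring.
Qed.

Lemma continuous_gamma_kernel z t : 0 < t ->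
  {for t, continuous (fun s => Re (gamma_kernel z s))} /\ {for t, continuous (fun s => Im (gamma_kernel z s))}.
Proof. by move=> t0; apply: is_cderive_continuous; exact: is_cderive_exp_cpowR. Qed.

Lemma cintegrable_gamma_kernel z : 0 < Re z -> cintegrable pos (gamma_kernel z).
Proof.
move=> z0; have int := rgamma_fun_integrable z0.
split; apply: (le_integrable _ _ _ int) => //.
- by apply/measurable_EFinP; apply: measurable_pos => t /(continuous_gamma_kernel z)[].
- move=> t /posP t0; rewrite !abse_EFin lee_fin [leRHS]ger0_norm ?rgamma_fun_ge0//.
  by rewrite -normc_gamma_kernel//; exact: normc_Re.
- by apply/measurable_EFinP; apply: measurable_pos => t /(continuous_gamma_kernel z)[].
- move=> t /posP t0; rewrite !abse_EFin lee_fin [leRHS]ger0_norm ?rgamma_fun_ge0//.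
  by rewrite -normc_gamma_kernel//; exact: normc_Im.
Qed.

End gamma.

Section complex_integral.
Context {R : realType}.
Local Notation mu := (@lebesgue_measure R).
Local Notation pos := (`]0, +oo[%classic : set R).
Implicit Types (g h G : R -> R[i]) (D : set (measurableTypeR R)) (z A B : R[i]).

Lemma eq_cintegral D g h : (forall t, D t -> g t = h t) ->
  cintegral D g = cintegral D h.
Proof.
by move=> gh; apply: complex_eqP => /=; apply: eq_Rintegral => t /set_mem/gh ->.
Qed.

Lemma cintegrableB D g h : measurable D -> cintegrable D g -> cintegrable D h ->
  cintegrable D (fun t => g t - h t).
Proof.
move=> mD [g1 g2] [h1 h2]; split.
  have := integrableB mD g1 h1; apply: eq_integrable => // t _.
  by rewrite /= ReD ReN.
have := integrableB mD g2 h2; apply: eq_integrable => // t _.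
by rewrite /= ImD ImN.
Qed.

Lemma cintegralB D g h : measurable D -> cintegrable D g -> cintegrable D h ->
  cintegral D (fun t => g t - h t) = cintegral D g - cintegral D h.
Proof.
move=> mD [g1 g2] [h1 h2]; apply: complex_eqP; rewrite !(ReD, ImD, ReN, ImN)/= -RintegralB//;
  by apply: eq_Rintegral => t _; rewrite !(ReD, ImD, ReN, ImN).
Qed.

Lemma cintegrableZ D g z : measurable D -> cintegrable D g ->
  cintegrable D (fun t => z * g t).
Proof.
move=> mD [g1 g2]; split.
  have := integrableB mD (integrableZl mD (Re z) g1) (integrableZl mD (Im z) g2).
  by apply: eq_integrable => // t _; rewrite /= ReM.
have := integrableD mD (integrableZl mD (Re z) g2) (integrableZl mD (Im z) g1).
by apply: eq_integrable => // t _; rewrite /= ImM.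
Qed.

Lemma cintegralZ D g z : measurable D -> cintegrable D g ->
  cintegral D (fun t => z * g t) = z * cintegral D g.
Proof.
move=> mD [g1 g2].
have iZ (a : R) (f : R -> R) : mu.-integrable D (EFin \o f) ->
    mu.-integrable D (EFin \o (fun t => a * f t)) by exact: integrableZl.
apply: complex_eqP; rewrite !(ReM, ImM)/=.
  rewrite -!RintegralZl// -RintegralB//; [|exact: iZ..].
  by apply: eq_Rintegral => t _; rewrite ReM.
rewrite -!RintegralZl// -RintegralD//; [|exact: iZ..].
by apply: eq_Rintegral => t _; rewrite ImM.
Qed.

End complex_integral.

Section gamma_recursion.
Context {R : realType}.
Local Notation mu := (@lebesgue_measure R).
Local Notation pos := (`]0, +oo[%classic : set R).
Implicit Types (x t k : R) (z w : R[i]).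

Let mpos : measurable (pos : set (measurableTypeR R)).
Proof. exact: measurable_itv. Qed.

(** Integration by parts; the boundary terms vanish at 0 because 0 < Re z and at
infinity because of the exponential. *)
Lemma Gamma_int_recursion z : 0 < Re z -> Gamma_int (z + 1) = z * Gamma_int z.
Proof.
move=> z0; pose G t := (expR (- t))%:C * cpowR t z.
pose g t := z * gamma_kernel z t - gamma_kernel (z + 1) t.
have z10 : 0 < Re (z + 1) by rewrite ReD Re1; lra.
have i1 := cintegrable_gamma_kernel z0; have i2 := cintegrable_gamma_kernel z10.
have ig : cintegrable pos g by apply: cintegrableB => //; exact: cintegrableZ.
have dG t : 0 < t -> is_cderive G t (g t) by exact: is_cderive_exp_cpowR.
have cg t : 0 < t -> {for t, continuous (fun s => Re (g s))} /\ {for t, continuous (fun s => Im (g s))}.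
  move=> t0; have [a1 a2] := continuous_gamma_kernel z t0.
  have [b1 b2] := continuous_gamma_kernel (z + 1) t0; split.
    rewrite (_ : (fun s => _) = (fun s => Re z * Re (gamma_kernel z s) -
      Im z * Im (gamma_kernel z s) - Re (gamma_kernel (z + 1) s))); last first.
      by apply/funext => s; rewrite /g !(ReD, ReN) ReM.
    by apply: cvgB => //; apply: cvgB; apply: cvgM => //; exact: cvg_cst.
  rewrite (_ : (fun s => _) = (fun s => Re z * Im (gamma_kernel z s) +
      Im z * Re (gamma_kernel z s) - Im (gamma_kernel (z + 1) s))); last first.
    by apply/funext => s; rewrite /g !(ImD, ImN) ImM.
  by apply: cvgB => //; apply: cvgD; apply: cvgM => //; exact: cvg_cst.
have nG t : 0 < t -> normc (G t) = expR (- t) * t `^ (Re z).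
  by move=> t0; rewrite ComplexField.Normc.normcM normcC normc_cpowR// ger0_norm// expR_ge0.
have nG0 : normc (G t) @[t --> 0^'+] --> 0.
  have := powR_cvg0 z0; move=> /cvgrPdist_le h; apply/cvgrPdist_le => e e0.
  near=> t; have t0 : 0 < t by near: t; exact: nbhs_right_gt.
  rewrite sub0r normrN nG// ger0_norm ?mulr_ge0 ?expR_ge0 ?powR_ge0//.
  apply: (@le_trans _ _ (t `^ Re z)).
    by rewrite ler_piMl ?powR_ge0// -expR0 ler_expR; lra.
  have : `|0 - t `^ Re z| <= e by near: t; exact: h.
  by rewrite sub0r normrN ger0_norm// powR_ge0.
have nGy : normc (G t) @[t --> +oo] --> 0.
  apply/cvgrPdist_le => e e0; pose p := Re z + 1.
  pose c := expR (- p + p * ln p).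
  near=> t; have t0 : 0 < t by near: t; exact: nbhs_pinfty_gt.
  rewrite sub0r normrN nG// ger0_norm ?mulr_ge0 ?expR_ge0 ?powR_ge0//.
  apply: (@le_trans _ _ (c / t)).
    rewrite ler_pdivlMr// /powR gt_eqF// -[X in _ * X](lnK (x := t)) ?posrE//.
    rewrite -!expRD ler_expR; have p0 : 0 < p by rewrite /p; lra.
    by have := ln_le_affine p0 t0; rewrite {1}/p; lra.
  have ct : c / e <= t by near: t; apply: nbhs_pinfty_ge; rewrite num_real.
  by rewrite ler_pdivrMr// mulrC -ler_pdivrMr.
have squeeze (F : set_system R) (FF : Filter F) (h : R -> R) : (forall t, `|h t| <= normc (G t)) ->
    normc (G t) @[t --> F] --> 0 -> h t @[t --> F] --> 0.
  move=> hG cG; apply/cvgrPdist_le => e e0; move/cvgrPdist_le : cG => /(_ e e0).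
  apply: filterS => t; rewrite !sub0r !normrN => /(le_trans _); apply.
  by rewrite (le_trans (hG t))// ger0_norm// normc_ge0.
have [h1 h2] : \int[mu]_(t in pos) Re (g t) = 0 - 0 /\ \int[mu]_(t in pos) Im (g t) = 0 - 0.
  split.
    apply: (@improper_FTC2 _ (fun t => Re (G t)) (fun t => Re (g t))).
    - by move=> t /dG[].
    - by move=> t /cg[].
    - by have [] := ig.
    - by apply: squeeze nG0 => t; exact: normc_Re.
    - by apply: squeeze nGy => t; exact: normc_Re.
  apply: (@improper_FTC2 _ (fun t => Im (G t)) (fun t => Im (g t))).
  - by move=> t /dG[].
  - by move=> t /cg[].
  - by have [] := ig.
  - by apply: squeeze nG0 => t; exact: normc_Im.
  - by apply: squeeze nGy => t; exact: normc_Im.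
have : cintegral pos g = 0 by apply: complex_eqP; rewrite /= ?h1 ?h2 subrr.
rewrite cintegralB//; last exact: cintegrableZ.
rewrite cintegralZ// => /eqP; rewrite subr_eq0 => /eqP ->.
by [].
Unshelve. all: by end_near. Qed.

Let kpow k t := t `^ k / k.

(** Substitution u = t ^ k / k in the integral. *)
Lemma kGamma_int_eq k z : 0 < k -> 0 < Re z ->
  kGamma_int k z = cpowR k (z / k%:C - 1) * Gamma_int (z / k%:C).
Proof.
move=> k0 z0; set w := z / k%:C.
have w0 : 0 < Re w by rewrite Re_divC divr_gt0.
pose psi t := t `^ (k - 1).
have dk t : 0 < t -> is_derive t (1 : R) (kpow k) (psi t).
  move=> t0; have := is_deriveZ k^-1 (is_derive_powR k t0).
  rewrite /GRing.scale/= mulrA mulVf ?gt_eqF// mul1r.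
  by congr (is_derive _ _ _ _); apply/funext => s; rewrite /kpow mulrC.
have kpow0 t : 0 < t -> 0 < kpow k t by move=> t0; rewrite divr_gt0// powR_gt0.
have cpsi t : 0 < t -> {for t, continuous psi} by exact: continuous_powR_pos.
have psi0 t : 0 < t -> 0 <= psi t by rewrite powR_ge0.
pose h t := gamma_kernel w (kpow k t) * (psi t)%:C.
have hE t : pos t -> (expR (- (t `^ k / k)))%:C * cpowR t (z - 1) = cpowR k (w - 1) * h t.
  rewrite /= in_itv/= andbT => t0; rewrite /h /gamma_kernel -mulrA [RHS]mulrCA; congr (_ * _).
  rewrite mulrA /kpow cpowRM ?powR_gt0 ?invr_gt0// cpowR_powR//.
  have -> : cpowR k (w - 1) * (cpowR t (k%:C * (w - 1)) * cpowR k^-1 (w - 1)) =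
      cpowR (k * k^-1) (w - 1) * cpowR t (k%:C * (w - 1)).
    by rewrite cpowRM ?invr_gt0//; ring.
  rewrite divff ?gt_eqF// /psi -cpowRC//.
  have -> : cpowR 1 (w - 1) = 1 :> R[i].
    by apply: complex_eqP; rewrite /cpowR/= ln1 !mulr0 expR0 ?cos0 ?sin0 ?mulr1 ?mulr0.
  rewrite mul1r -cpowRD; congr cpowR; rewrite rmorphB/= mulrBr /w mulrC divfK ?mulr1; first by ring.
  by rewrite -normc_eq0 normcC normr_eq0 gt_eqF.
have dabs := substitution_ge0_integrable (fun t => @continuous_rgamma_fun R (Re w) t)
  (rgamma_fun_integrable w0) dk kpow0 cpsi (fun t _ => rgamma_fun_ge0 (Re w) t) psi0.
have [iR iI] := cintegrable_gamma_kernel w0.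
have mh (P : R[i] -> R) : (forall t, 0 < t -> {for t, continuous (fun s => P (gamma_kernel w s))}) ->
    measurable_fun pos (fun t => P (gamma_kernel w (kpow k t)) * psi t).
  move=> cP; apply: measurable_pos => t t0; apply: cvgM; last exact: cpsi.
  apply: (@continuous_comp _ _ _ (kpow k) (fun s => P (gamma_kernel w s))).
    by have [d _] := dk t t0; apply: differentiable_continuous; apply/derivable1_diffP.
  by apply: cP; exact: kpow0.
have ih (P : R[i] -> R) : (forall t, 0 < t -> {for t, continuous (fun s => P (gamma_kernel w s))}) ->
    (forall y, `|P y| <= normc y) ->
    mu.-integrable pos (EFin \o (fun t => P (gamma_kernel w (kpow k t)) * psi t)).
  move=> cP Pn; apply: (le_integrable mpos _ _ dabs).
    by apply/measurable_EFinP; exact: mh.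
  move=> t; rewrite /= in_itv/= andbT => t0; rewrite lee_fin !normrM ler_wpM2r//.
  apply: (le_trans (Pn _)); rewrite normc_gamma_kernel; last exact: kpow0.
  by rewrite -normrM ler_norm.
have kpow_0 : kpow k t @[t --> 0^'+] --> 0.
  rewrite -[X in _ --> X](mul0r k^-1).
  by apply: cvgM; [exact: powR_cvg0|exact: cvg_cst].
have kpow_y : kpow k t @[t --> +oo] --> +oo.
  apply/cvgryPge => a; near=> t; have t1 : 0 < t by near: t; exact: nbhs_pinfty_gt.
  rewrite ler_pdivlMr// /powR gt_eqF//.
  have : a * k <= 1 + k * ln t.
    have tb : expR ((a * k - 1) / k) <= t by near: t; apply: nbhs_pinfty_ge; rewrite num_real.
    have : ln (expR ((a * k - 1) / k)) <= ln t by rewrite ler_ln ?posrE ?expR_gt0.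
    by rewrite expRK ler_pdivrMr// lerBlDl [ln t * k]mulrC.
  by move=> /le_trans; apply; exact: expR_ge1Dx.
have cR t : 0 < t -> {for t, continuous (fun s => Re (gamma_kernel w s))}.
  by move=> /(continuous_gamma_kernel w)[].
have cI t : 0 < t -> {for t, continuous (fun s => Im (gamma_kernel w s))}.
  by move=> /(continuous_gamma_kernel w)[].
have ihR := ih _ cR (@normc_Re R); have ihI := ih _ cI (@normc_Im R).
rewrite /kGamma_int (eq_cintegral hE) cintegralZ//; last first.
  split; [move: ihR|move: ihI]; apply: eq_integrable => // t _; congr EFin.
    by rewrite /h ReM/= mulr0 subr0.
  by rewrite /h ImM/= mulr0 add0r.
congr (_ * _); apply: complex_eqP => /=.
  rewrite -(substitution_integral cR iR dk kpow0 cpsi kpow_0 kpow_y ihR).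
  by apply: eq_Rintegral => t _; rewrite /h ReM/= mulr0 subr0.
rewrite -(substitution_integral cI iI dk kpow0 cpsi kpow_0 kpow_y ihI).
by apply: eq_Rintegral => t _; rewrite /h ImM/= mulr0 add0r.
Unshelve. all: by end_near. Qed.

End gamma_recursion.

Section gamma_function.
Context {R : realType}.
Local Notation pos := (`]0, +oo[%classic : set R).
Implicit Types (x y t k : R) (z w s : R[i]).

Lemma Gamma_pos w : 0 < Re w -> Gamma w = Gamma_int w.
Proof. by move=> w0; rewrite /Gamma /Gamma_shift w0 big_ord0 divr1 addr0. Qed.

(** For Re w <= 0 the shift of w exceeds that of w + 1 by one, so that the two
products differ by the factor w only. *)
Lemma Gamma_inv_recursion w : (Gamma w)^-1 = w / Gamma (w + 1).
Proof.
have [w0|w0] := ltP 0 (Re w).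
  have wn0 : w != 0 by apply/eqP => wE; rewrite wE ltxx in w0.
  rewrite !Gamma_pos//; last by rewrite ReD Re1; lra.
  by rewrite Gamma_int_recursion// invfM mulrA divff// mul1r.
have -> : Gamma w = Gamma_int (w + (Gamma_shift (w + 1)).+1%:R) /
    \prod_(j < (Gamma_shift (w + 1)).+1) (w + j%:R).
  suff sE : Gamma_shift w = (Gamma_shift (w + 1)).+1 by rewrite {1}/Gamma sE.
  rewrite /Gamma_shift ltNge w0/=; congr S; rewrite ReD Re1.
  case: ltP => w1; first by apply/truncn0Pn; rewrite -ltNge; lra.
  have -> : - Re w = - (Re w + 1) + 1 by lra.
  have h0 : 0 <= - (Re w + 1) by lra.
  apply: truncn_def; have /andP[h1 h2] := truncn_itv h0.
  by rewrite -[in leLHS]natr1 -[in ltRHS]natr1 lerD2r ltrD2r h1 h2.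
rewrite {1}/Gamma invf_div [in RHS]invf_div big_ord_recl addr0 mulrA.
congr (_ * _ / _).
  by apply: eq_bigr => j _; rewrite lift0 -natr1 addrA [w + _ + _]addrAC.
by rewrite -addrA -natr1 [1 + _]addrC.
Qed.

Lemma kGamma_eq k z : 0 < k ->
  kGamma k z = cpowR k (z / k%:C - 1) * Gamma (z / k%:C).
Proof.
move=> k0; rewrite /kGamma; case: ifPn => // z0.
by rewrite kGamma_int_eq// Gamma_pos// Re_divC divr_gt0.
Qed.

(** No pole is excluded: 1 / kGamma, set to 0 at the poles, is entire. *)
Lemma kGamma_inv_recursion k s : 0 < k ->
  (kGamma k (s - k%:C))^-1 = (s - k%:C) / kGamma k s.
Proof.
move=> k0; have kn0 : k%:C != 0 :> R[i] by rewrite -normc_eq0 normcC normr_eq0 gt_eqF.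
rewrite !kGamma_eq//; set w := s / k%:C.
have -> : (s - k%:C) / k%:C = w - 1 by rewrite mulrBl divff.
rewrite invfM Gamma_inv_recursion subrK.
have -> : cpowR k (w - 1) = cpowR k (w - 1 - 1) * k%:C.
  by rewrite -(cpowR1 k0) -cpowRD subrK.
have -> : s - k%:C = (w - 1) * k%:C by rewrite mulrBl mul1r /w divfK.
move: (cpowR _ _) (Gamma w) => c G; rewrite !invfM.
rewrite [RHS](_ : _ = (k%:C * k%:C^-1) * (c^-1 * ((w - 1) * G^-1))); last by ring.
by rewrite divff// mul1r.
Qed.

Lemma rgammaE x : 0 < x -> Gamma_int x%:C = (rgamma x)%:C.
Proof.
move=> x0; have E t : pos t -> (expR (- t))%:C * cpowR t (x%:C - 1) = (rgamma_fun x t)%:C :> R[i].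
  rewrite /= in_itv/= andbT => t0; have -> : x%:C - 1 = (x - 1)%:C :> R[i] by rewrite rmorphB.
  by rewrite cpowRC// /rgamma_fun rmorphM.
rewrite /Gamma_int (eq_cintegral E) /cintegral/=; apply: complex_eqP => //=.
by rewrite /Rintegral integral0.
Qed.

Lemma rgamma_recursion x : 0 < x -> rgamma (x + 1) = x * rgamma x.
Proof.
move=> x0; apply: complexI; rewrite rmorphM/= -!rgammaE//; last by lra.
by rewrite -Gamma_int_recursion//= rmorphD.
Qed.

(** The part of the integral over a unit segment at M already grows like
M ^ x, for every M. *)
Lemma rgamma_lower M x : 0 < M -> 1 <= x -> M `^ (x - 1) * expR (- (M + 1)) <= rgamma x.
Proof.
move=> M0 x1; have x0 : 0 < x by lra.
have int := rgamma_fun_integrable x0.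
have fin : (\int[lebesgue_measure]_(t in pos) (rgamma_fun x t)%:E)%E \is a fin_num.
  by apply: integrable_fin_num int; exact: measurable_itv.
have MM : M < M + 1 by lra.
rewrite -lee_fin /rgamma /Rintegral fineK//.
have sub : `[M, M + 1]%classic `<=` pos.
  by move=> t; rewrite /= !in_itv/= andbT => /andP[+ _]; exact: lt_le_trans.
have mMM : measurable (`[M, M + 1]%classic : set (measurableTypeR R)) by exact: measurable_itv.
apply: (@le_trans _ _ (\int[lebesgue_measure]_(t in [set` `[M, (M + 1)%R]]) (rgamma_fun x t)%:E)%E); last first.
  apply: ge0_subset_integral => //.
  - exact: measurable_int int.
  - by move=> t _; rewrite lee_fin rgamma_fun_ge0.
have -> : (M `^ (x - 1) * expR (- (M + 1)))%:E =
    (\int[lebesgue_measure]_(t in [set` `[M, (M + 1)%R]]) (M `^ (x - 1) * expR (- (M + 1)))%:E)%E.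
  have muE : lebesgue_measure [set` `[M, (M + 1)%R]] = 1%:E.
    by rewrite lebesgue_measure_itv/= lte_fin MM -EFinB [M + 1]addrC addrK.
  by rewrite integral_cst// [X in (_ * X)%E]muE mule1.
apply: ge0_le_integral => //.
- by move=> t _; rewrite lee_fin mulr_ge0 ?powR_ge0 ?expR_ge0.
- have mf : measurable_fun (pos : set (measurableTypeR R)) (EFin \o rgamma_fun x) by exact: measurable_int int.
  by apply: measurable_funS mf.
- move=> t; rewrite /= in_itv/= => /andP[Mt tM]; rewrite lee_fin mulrC.
  apply: ler_pM; rewrite ?expR_ge0 ?powR_ge0//; first by rewrite ler_expR; lra.
  by apply: ge0_ler_powR; rewrite ?nnegrE; lra.
Qed.

Lemma rgamma_gt0 x : 1 <= x -> 0 < rgamma x.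
Proof.
move=> x1; apply: lt_le_trans (rgamma_lower ltr01 x1).
by rewrite mulr_gt0 ?powR_gt0 ?expR_gt0.
Qed.

Lemma sin_le_norm x : `|sin x| <= `|x|.
Proof.
wlog : x / 0 <= x => [wl|x0].
  have [/wl//|x0] := leP 0 x; rewrite -(normrN (sin x)) -(normrN x) -sinN.
  by apply: wl; lra.
have [->|xn0] := eqVneq x 0; first by rewrite sin0.
have xgt0 : 0 < x by rewrite lt_def xn0.
have [|c _] := @MVT R (@sin R) (@cos R) 0 x xgt0 (fun x _ => is_derive_sin x).
  by apply: continuous_subspaceT => t; exact: continuous_sin.
rewrite sin0 !subr0 => ->; rewrite normrM ler_piMl// ler_norml.
by rewrite cos_geN1 cos_le1.
Qed.

Lemma cos_ge x : 1 - x ^+ 2 / 2 <= cos x.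
Proof.
have -> : cos x = 1 - 2 * sin (x / 2) ^+ 2.
  have -> : cos x = cos (x / 2 + x / 2) by congr cos; lra.
  by rewrite cosD -!expr2 -[cos _ ^+ 2](addrK (sin (x / 2) ^+ 2)) cos2Dsin2; lra.
suff : sin (x / 2) ^+ 2 <= (x / 2) ^+ 2 by rewrite expr_div_n; lra.
by rewrite -real_normK ?num_real// -[leRHS]real_normK ?num_real// lerXn2r// ?nnegrE// sin_le_norm.
Qed.

(** With a = ln t, the right-hand side is 4 (2 sinh (a / 2)) ^ 2. *)
Lemma sqr_ln_le t : 0 < t -> ln t ^+ 2 <= 4 * (t + t^-1 - 2).
Proof.
move=> t0; rewrite -[t in leRHS]lnK ?posrE//; move: (ln t) => a {t0}.
have -> : expR a + (expR a)^-1 - 2 = (expR (a / 2) - expR (- (a / 2))) ^+ 2.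
  have E1 : expR a = expR (a / 2) ^+ 2 by rewrite expr2 -expRD; congr expR; lra.
  have E2 : (expR a)^-1 = expR (- (a / 2)) ^+ 2.
    by rewrite -expRN expr2 -expRD; congr expR; lra.
  have E3 : expR (a / 2) * expR (- (a / 2)) = 1 by rewrite -expRD subrr expR0.
  by rewrite E2 E1 sqrrB E3; ring.
wlog : a / 0 <= a => [wl|a0].
  have [/wl//|a0] := leP 0 a.
  have -> : (expR (a / 2) - expR (- (a / 2))) ^+ 2 =
            (expR (- a / 2) - expR (- (- a / 2))) ^+ 2 by rewrite mulNr opprK; ring.
  by rewrite -(sqrrN a); apply: wl; lra.
have h1 : 1 + a / 2 <= expR (a / 2) by exact: expR_ge1Dx.
have h2 : expR (- (a / 2)) <= 1 by rewrite -[leRHS]expR0 ler_expR; lra.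
have h3 : (a / 2) ^+ 2 <= (expR (a / 2) - expR (- (a / 2))) ^+ 2.
  by rewrite -subr_ge0 subr_sqr mulr_ge0//; lra.
by rewrite expr_div_n in h3; lra.
Qed.

End gamma_function.

(** * Growth of the k-Gamma function *)

Section gamma_lower_bound.
Context {R : realType}.
Local Notation mu := (@lebesgue_measure R).
Local Notation pos := (`]0, +oo[%classic : set R).
Implicit Types (x y t k : R) (z w s : R[i]).

Let mpos : measurable (pos : set (measurableTypeR R)).
Proof. exact: measurable_itv. Qed.

(** For large x the mass of exp (- t) t ^ (x - 1) concentrates around t = x, so
that after multiplication by x ^ (- i y) the factor t ^ (i y) hardly turns. The
bounds on cos and on the square of ln turn this into three real Gamma integrals. *)
Lemma Gamma_int_lower_large x y : 1 < x -> 4 * y ^+ 2 <= x - 1 ->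
  rgamma x / 2 <= normc (Gamma_int (x +i* y)).
Proof.
move=> x1 yx; have x0 : 0 < x by lra.
pose z := x +i* y; pose c := cpowR x (0 +i* (- y)).
have nc : normc c = 1 by rewrite normc_cpowR//= powRr0.
have ik := cintegrable_gamma_kernel (z := z) x0.
have -> : normc (Gamma_int z) = normc (cintegral pos (fun t => c * gamma_kernel z t)).
  by rewrite cintegralZ// ComplexField.Normc.normcM nc mul1r.
have [ick _] := cintegrableZ c mpos ik.
apply: le_trans (ler_norm _) (le_trans _ (normc_Re _)) => //=.
rewrite ger0_norm; last first.
  by rewrite divr_ge0// ltW// rgamma_gt0// ltW.
apply: le_trans (ler_norm _).
pose a := 1 + 4 * y ^+ 2; pose b := 2 * y ^+ 2 / x; pose d := 2 * y ^+ 2 * x.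
pose L t := a * rgamma_fun x t - b * rgamma_fun (x + 1) t - d * rgamma_fun (x - 1) t.
have i1 := rgamma_fun_integrable x0.
have x10 : 0 < x + 1 by lra.
have xm0 : 0 < x - 1 by lra.
have i2 := rgamma_fun_integrable x10.
have i3 := rgamma_fun_integrable xm0.
have iZ (r : R) f : mu.-integrable pos (EFin \o f) ->
    mu.-integrable pos (EFin \o (fun t => r * f t)) by exact: integrableZl.
have iB f g : mu.-integrable pos (EFin \o f) -> mu.-integrable pos (EFin \o g) ->
    mu.-integrable pos (EFin \o (fun t => f t - g t)) by exact: integrableB.
have iL : mu.-integrable pos (EFin \o L).
  by apply: (iB _ _ (iB _ _ _ _) _); exact: iZ.
apply: (@le_trans _ _ (\int[mu]_(t in pos) L t)).
  rewrite /L RintegralB//; [|by apply: iB; exact: iZ|exact: iZ].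
  rewrite RintegralB//; [|exact: iZ|exact: iZ].
  rewrite !RintegralZl// -!/(rgamma _) rgamma_recursion//.
  have xE : rgamma x = (x - 1) * rgamma (x - 1) by rewrite -rgamma_recursion// subrK.
  have g0 : 0 <= rgamma (x - 1).
    have : 0 < rgamma x by rewrite rgamma_gt0// ltW.
    by rewrite xE pmulr_rgt0// => /ltW.
  have -> : b * (x * rgamma x) = 2 * y ^+ 2 * rgamma x.
    by rewrite mulrA /b divfK// gt_eqF.
  rewrite xE /a /d; move: (rgamma _) g0 yx => g g0 yx.
  by have := mulr_ge0 g0 (_ : 0 <= x - 1 - 4 * y ^+ 2); nra.
have cL t : pos t -> L t <= Re (c * gamma_kernel z t).
  move=> tp; have t0 : 0 < t by move: tp; rewrite /= in_itv/= andbT.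
  have -> : Re (c * gamma_kernel z t) = rgamma_fun x t * cos (y * ln t - y * ln x).
    rewrite /c /gamma_kernel /cpowR /rgamma_fun /z !ReImE/= !(mul0r, mulr0, subr0, oppr0, addr0) expR0 !mul1r.
    rewrite mulNr cosN sinN cosB /powR gt_eqF//; ring.
  have -> : L t = rgamma_fun x t * (1 - 2 * y ^+ 2 * (t / x + (t / x)^-1 - 2)).
    have tx : t `^ x = t `^ (x - 1) * t.
      by rewrite -[t in X in _ = _ * X]powRr1 ?ltW// -powRD ?subrK// gt_eqF ?implybT.
    have tx2 : t `^ (x - 1) = t `^ (x - 1 - 1) * t.
      by rewrite -[t in X in _ = _ * X]powRr1 ?ltW// -powRD ?subrK// gt_eqF ?implybT.
    rewrite /L /rgamma_fun addrK tx tx2 /a /b /d; field.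
    by rewrite !gt_eqF.
  rewrite ler_wpM2l ?rgamma_fun_ge0//; apply: le_trans (cos_ge _).
  rewrite -mulrBr exprMn -ln_div ?posrE//.
  have := sqr_ln_le (divr_gt0 t0 x0); have := sqr_ge0 y.
  move: (ln _ ^+ 2) (t / x + _ - 2) (y ^+ 2) => p q r r0 pq.
  by have := ler_wpM2l r0 pq; lra.
rewrite /Rintegral fine_le//.
- by apply: integrable_fin_num iL.
- by apply: integrable_fin_num ick.
- apply: le_integral => //.
  by move=> t tp; rewrite lee_fin; apply: cL; exact: set_mem.
Qed.

(** One step of the induction below; nz is the modulus of x + i y. *)
Let ratio_step (x Gn r gn nz G E1 E2 E3 : R) : 0 < x -> 0 <= gn -> 0 <= G -> 0 <= E1 ->
  nz <= x * E2 -> E1 * E2 = E3 ->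
  Gn * (x * r) <= gn * (nz * G) * E1 -> Gn * r <= gn * G * E3.
Proof.
move=> x0 g0 G0 E10 zle <- h; rewrite -(ler_pM2l x0) mulrCA (le_trans h)//.
rewrite [leRHS](_ : _ = gn * (x * E2 * G) * E1); last by ring.
by rewrite ler_wpM2r// ler_wpM2l// ler_wpM2r.
Qed.

(** By the functional equation, one step multiplies the ratio of |Gamma (x + i y)|
to Gamma x by |x + i y| / x <= exp (y ^ 2 / 2 (1 / (x - 1) - 1 / x)); these
exponents telescope. *)
Lemma Gamma_int_ratio (n : nat) x y : 1 < x ->
  normc (Gamma_int ((x + n%:R) +i* y)) * rgamma x <=
  rgamma (x + n%:R) * normc (Gamma_int (x +i* y)) *
    expR (y ^+ 2 / 2 * ((x - 1)^-1 - (x + n%:R - 1)^-1)).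
Proof.
elim: n x => [|n IH] x x1.
  by rewrite addr0 subrr mulr0 expR0 mulr1 mulrC.
have x0 : 0 < x by lra.
have x11 : 1 < x + 1 by lra.
have nE : x + 1 + n%:R = x + n.+1%:R by rewrite -addrA -(natr1 n) [1 + _]addrC.
have := IH (x + 1) x11.
rewrite nE rgamma_recursion//.
have -> : (x + 1) +i* y = (x +i* y) + 1 by apply: complex_eqP; rewrite ReImE/= ?addr0.
rewrite Gamma_int_recursion// ComplexField.Normc.normcM addrK.
apply: (@ratio_step x _ _ _ _ _ _ (expR (y ^+ 2 / 2 * ((x - 1)^-1 - x^-1))) _ x0 _
  (normc_ge0 _) (expR_ge0 _)).
- by apply/ltW/rgamma_gt0; rewrite ler_wpDr//; lra.
- rewrite -[leRHS]ger0_norm; last by rewrite mulr_ge0 ?expR_ge0 ?ltW.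
  rewrite normcE -sqrtr_sqr ler_wsqrtr//= exprMn -expRM_natl mulrA.
  have -> : (2%:R : R) * (y ^+ 2 / 2) = y ^+ 2 by lra.
  apply: (@le_trans _ _ (x ^+ 2 * (1 + y ^+ 2 * ((x - 1)^-1 - x^-1)))); last first.
    by rewrite ler_wpM2l ?sqr_ge0// expR_ge1Dx.
  rewrite mulrDr mulr1 lerD2l mulrCA -[leLHS]mulr1 ler_wpM2l ?sqr_ge0//.
  have -> : x ^+ 2 * ((x - 1)^-1 - x^-1) = x / (x - 1).
    by field; rewrite !gt_eqF//; lra.
  by rewrite ler_pdivlMr; lra.
- by rewrite -expRD; congr expR; ring.
Qed.

(** The estimate for large abscissae, carried back from x + n to x. *)
Lemma Gamma_int_lower x y : 1 < x ->
  rgamma x / 2 * expR (- (y ^+ 2 / 2 / (x - 1))) <= normc (Gamma_int (x +i* y)).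
Proof.
move=> x1; pose n := Num.bound (4 * y ^+ 2).
have nb : 4 * y ^+ 2 < n%:R by apply: archi_boundP; rewrite mulr_ge0 ?sqr_ge0.
have n0 : 0 <= n%:R :> R by [].
have xn1 : 1 < x + n%:R by lra.
have large : rgamma (x + n%:R) / 2 <= normc (Gamma_int ((x + n%:R) +i* y)).
  by apply: Gamma_int_lower_large => //; lra.
have g0 : 0 < rgamma (x + n%:R) by rewrite rgamma_gt0// ltW.
have r0 : 0 < rgamma x by rewrite rgamma_gt0// ltW.
have := le_trans (ler_wpM2r (ltW r0) large) (@Gamma_int_ratio n x y x1).
move: (rgamma (x + n%:R)) (rgamma x) (normc _) g0 r0 {large} => g r G g0 r0.
have -> : g / 2 * r = g * (r / 2) by ring.
rewrite -mulrA ler_pM2l// => h.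
have G0 : 0 <= G.
  have r20 : 0 <= r / 2 by lra.
  by have := le_trans r20 h; rewrite pmulr_lge0 ?expR_gt0.
rewrite expRN ler_pdivrMr ?expR_gt0//; apply: (le_trans h).
rewrite ler_wpM2l// ler_expR ler_wpM2l//; first by have := sqr_ge0 y; lra.
by rewrite lerBlDl lerDr invr_ge0; lra.
Qed.

(** Super-exponential growth of kGamma along an arithmetic progression, which
makes the k-Mittag-Leffler series converge everywhere. *)
Lemma kGamma_inv_bound k (alpha s : R[i]) (A : R) : 0 < k -> 0 < Re alpha -> 1 <= A ->
  exists2 c : R, 0 <= c &
    forall n : nat, normc (kGamma k (alpha * n%:R + s))^-1 <= c / A ^+ n.
Proof.
move=> k0 a0 A1; have A0 : 0 < A by lra.
pose delta := Re alpha / (2 * k); have delta0 : 0 < delta by rewrite divr_gt0// mulr_gt0.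
pose B := `|Im alpha| + `|Im s|; have B0 : 0 <= B by rewrite addr_ge0.
pose D := (B / k) ^+ 2 / 2 / delta.
have D0 : 0 <= D by rewrite divr_ge0 ?(ltW delta0)// divr_ge0// sqr_ge0.
(* M makes (k M) ^ (delta n) outweigh both A ^ n and the factor exp (D n) lost to
   the imaginary part *)
pose M := expR ((ln A + D) / delta) / k; have M0 : 0 < M by rewrite divr_gt0 ?expR_gt0.
pose N := (Num.bound (2 * (`|k| + `|Re s|) / Re alpha)).+1.
pose u n := normc (kGamma k (alpha * n%:R + s))^-1.
pose c1 := 2 * expR (M + 1).
have large n : (N <= n)%N -> u n <= c1 / A ^+ n.
  move=> Nn; have n1 : 1 <= n%:R :> R by rewrite ler1n (leq_trans _ Nn).
  have nN : 2 * (`|k| + `|Re s|) / Re alpha <= n%:R.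
    apply: (@le_trans _ _ (Num.bound (2 * (`|k| + `|Re s|) / Re alpha))%:R).
      by apply/ltW/archi_boundP; rewrite !mulr_ge0 ?invr_ge0 ?addr_ge0// ltW.
    by rewrite ler_nat (leq_trans _ Nn).
  pose x := (Re alpha * n%:R + Re s) / k; pose y := (Im alpha * n%:R + Im s) / k.
  have wE : (alpha * n%:R + s) / k%:C = x +i* y.
    apply: complex_eqP; rewrite ?Re_divC ?Im_divC natrC !ReImE/=;
      by rewrite mulr0 ?subr0 ?add0r.
  have xd : delta * n%:R <= x - 1.
    have kn0 : k != 0 by rewrite gt_eqF.
    have -> : x - 1 = (Re alpha * n%:R + Re s - k) / k by rewrite /x; field.
    have -> : delta * n%:R = Re alpha * n%:R / 2 / k by rewrite /delta; field.
    rewrite ler_pM2r ?invr_gt0//.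
    move: nN; rewrite ler_pdivrMr// => nN.
    have := ler_norm k; have := ler_norm (- Re s); rewrite normrN; lra.
  have xd0 : 0 < delta * n%:R by rewrite mulr_gt0//; lra.
  have x1 : 1 < x by lra.
  have yB : y ^+ 2 <= (B / k * n%:R) ^+ 2.
    rewrite -[leLHS]real_normK ?num_real// -[leRHS]real_normK ?num_real//.
    rewrite lerXn2r ?nnegrE// [leRHS]ger0_norm; last by rewrite !mulr_ge0 ?invr_ge0// ltW.
    rewrite /y normrM normfV (gtr0_norm k0) mulrAC ler_pM2r ?invr_gt0//.
    rewrite (le_trans (ler_normD _ _))// normrM (ger0_norm (_ : 0 <= n%:R))// /B mulrDl lerD2l.
    by rewrite -[leLHS]mulr1 ler_wpM2l.
  have yD : y ^+ 2 / 2 / (x - 1) <= D * n%:R.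
    rewrite ler_pdivrMr; last by lra.
    apply: (@le_trans _ _ (D * n%:R * (delta * n%:R))); last first.
      by rewrite ler_wpM2l// mulr_ge0//; lra.
    have -> : D * n%:R * (delta * n%:R) = (B / k * n%:R) ^+ 2 / 2.
      by rewrite /D exprMn; field; rewrite gt_eqF// gt_eqF.
    by rewrite ler_wpM2r.
  rewrite /u ComplexField.Normc.normcV kGamma_eq// wE ComplexField.Normc.normcM.
  rewrite Gamma_pos; last by rewrite /=; lra.
  have nk : normc (cpowR k ((x +i* y) - 1)) = k `^ (x - 1) by rewrite normc_cpowR// ReD ReN Re1.
  rewrite nk; set G := normc (Gamma_int _).
  have GL : expR (- (M + 1)) / 2 * expR ((x - 1) * ln M - D * n%:R) <= G.
    apply: le_trans (Gamma_int_lower y x1).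
    have := @rgamma_lower _ M x M0 (ltW x1); rewrite {1}/powR gt_eqF// => rl.
    rewrite expRD mulrA ler_pM ?mulr_ge0 ?expR_ge0 ?invr_ge0//.
      by rewrite mulrAC ler_pM2r// mulrC.
    by rewrite ler_expR lerN2.
  have lnkM : ln k + ln M = (ln A + D) / delta.
    by rewrite -lnM ?posrE// /M mulrC divfK ?gt_eqF// expRK.
  have lnA0 : 0 <= ln A by rewrite ln_ge0.
  have An : A ^+ n = expR (n%:R * ln A) by rewrite expRM_natl lnK.
  have key : expR (- (M + 1)) / 2 * A ^+ n <= k `^ (x - 1) * G.
    apply: le_trans (ler_wpM2l (powR_ge0 _ _) GL).
    rewrite mulrCA ler_wpM2l ?mulr_ge0 ?expR_ge0// An /powR gt_eqF// -expRD ler_expR.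
    have -> : (x - 1) * ln k + ((x - 1) * ln M - D * n%:R) =
       (x - 1) * (ln k + ln M) - D * n%:R by ring.
    rewrite lnkM; have : delta * n%:R * ((ln A + D) / delta) <= (x - 1) * ((ln A + D) / delta).
      by rewrite ler_wpM2r// divr_ge0 ?addr_ge0// ltW.
    have -> : delta * n%:R * ((ln A + D) / delta) = n%:R * (ln A + D).
      by field; rewrite gt_eqF.
    by lra.
  have pos1 : 0 < expR (- (M + 1)) / 2 * A ^+ n by rewrite mulr_gt0 ?divr_gt0 ?expR_gt0 ?exprn_gt0.
  apply: (@le_trans _ _ (expR (- (M + 1)) / 2 * A ^+ n)^-1).
    by rewrite lef_pV2 ?posrE//; exact: lt_le_trans key.
  by rewrite invfM invf_div expRN invrK.
(* the finitely many n below N are absorbed by the constant *)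
exists (c1 + \sum_(i < N) u i * A ^+ i).
  rewrite addr_ge0 ?mulr_ge0 ?expR_ge0// sumr_ge0// => i _.
  by rewrite mulr_ge0 ?normc_ge0 ?exprn_ge0// ltW.
move=> n; have An0 : 0 < A ^+ n by rewrite exprn_gt0.
have s0 (P : pred 'I_N) : 0 <= \sum_(i < N | P i) u i * A ^+ i.
  by rewrite sumr_ge0// => i _; rewrite mulr_ge0 ?normc_ge0 ?exprn_ge0// ltW.
rewrite -/(u n); have [nN|Nn] := ltnP n N; last first.
  by rewrite (le_trans (large n Nn))// ler_pM2r ?invr_gt0// lerDl s0.
rewrite ler_pdivlMr// (bigD1 (Ordinal nN))//= addrCA lerDl addr_ge0 ?s0//.
by rewrite mulr_ge0// expR_ge0.
Qed.

End gamma_lower_bound.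

(** * Termwise differentiation of series *)

Section termwise_derivative.
Context {R : realType}.
Implicit Types (a b u v : R).

Lemma MVT_between a b (f df : R -> R) u v :
  (forall x : R, a < x < b -> is_derive x (1 : R) f (df x)) -> a < u < b -> a < v < b ->
  exists c, [/\ a < c < b, `|c - u| <= `|v - u| & f v - f u = df c * (v - u)].
Proof.
move=> dfx; have cont (p q : R) : a < p -> q < b -> {within `[p, q], continuous f}.
  move=> ap qb; apply: continuous_in_subspaceT => x /set_mem/=; rewrite in_itv/= => /andP[px xq].
  apply: differentiable_continuous; apply/derivable1_diffP.
  by have [] := dfx x (_ : a < x < b) => //; rewrite (lt_le_trans ap)//= (le_lt_trans xq).
have dpq (p q : R) : a < p -> q < b -> forall x : R, x \in `]p, q[ -> is_derive x (1 : R) f (df x).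
  move=> ap qb x; rewrite in_itv/= => /andP[px xq]; apply: dfx.
  by rewrite (lt_trans ap)//= (lt_trans xq).
move=> /andP[au ub] /andP[av vb]; have [uv|vu] := leP u v.
  have [c + E] := MVT_segment uv (dpq _ _ au vb) (cont _ _ au vb).
  rewrite in_itv/= => /andP[uc cv]; exists c; split => //.
    by rewrite (lt_le_trans au)//= (le_lt_trans cv).
  by rewrite !ger0_norm; lra.
have [c + E] := MVT_segment (ltW vu) (dpq _ _ av ub) (cont _ _ av ub).
rewrite in_itv/= => /andP[vc cu]; exists c; split => //.
- by rewrite (lt_le_trans av)//= (le_lt_trans cu).
- by rewrite !ler0_norm; lra.
- by rewrite -opprB E; ring.
Qed.

Lemma taylor1_le a b (g h k : R -> R) (M : R) u v :
  (forall x : R, a < x < b -> is_derive x (1 : R) g (h x)) ->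
  (forall x : R, a < x < b -> is_derive x (1 : R) h (k x)) ->
  (forall x, a < x < b -> `|k x| <= M) -> a < u < b -> a < v < b ->
  `|g v - g u - h u * (v - u)| <= M * (v - u) ^+ 2.
Proof.
move=> dg dh kM uab vab.
have [c [cab cu ->]] := MVT_between dg uab vab.
have [e [eab _ E]] := MVT_between dh uab cab.
rewrite -mulrBl E !normrM expr2 -[(v - u) * (v - u)]ger0_norm; last by rewrite -expr2 sqr_ge0.
rewrite normrM mulrA ler_wpM2r//; apply: ler_pM => //.
exact: kM.
Qed.

Lemma cvg_series_dominated (x M : nat -> R) : cvgn (series M) ->
  (forall n, `|x n| <= M n) -> cvgn (series x) /\ `|limn (series x)| <= limn (series M).
Proof.
move=> cM xM; have cn : cvgn [normed series x].
  by apply: (series_le_cvg (fun n => normr_ge0 (x n)) (fun n => le_trans (normr_ge0 _) (xM n)) xM cM).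
split; first exact: normed_cvg.
by apply: le_trans (lim_series_norm cn) _; exact: lim_series_le.
Qed.

Lemma lim_seriesM (f : nat -> R) c : cvgn (series f) ->
  limn (series (fun n => c * f n)) = c * limn (series f).
Proof. exact: lim_seriesZ. Qed.

(** A bound on the second derivatives makes the first-order remainders uniformly
quadratic, so that they can be summed. *)
Lemma is_derive_series a b (g h k : nat -> R -> R) (M : nat -> R) u :
  (forall n (x : R), a < x < b -> is_derive x (1 : R) (g n) (h n x)) ->
  (forall n (x : R), a < x < b -> is_derive x (1 : R) (h n) (k n x)) ->
  (forall n x, a < x < b -> [/\ `|g n x| <= M n, `|h n x| <= M n & `|k n x| <= M n]) ->
  cvgn (series M) -> a < u < b ->
  is_derive u (1 : R) (fun x => limn (series (fun n => g n x))) (limn (series (fun n => h n u))).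
Proof.
move=> dg dh B cM uab; pose S x := limn (series (fun n => g n x)); pose H := limn (series (fun n => h n u)).
have cg x : a < x < b -> cvgn (series (fun n => g n x)).
  by move=> xab; apply: (cvg_series_dominated cM _).1 => n; have [] := B n x xab.
have ch : cvgn (series (fun n => h n u)).
  by apply: (cvg_series_dominated cM _).1 => n; have [] := B n u uab.
pose L := limn (series M).
have rem v : a < v < b -> `|S v - S u - H * (v - u)| <= L * (v - u) ^+ 2.
  move=> vab; have cD := is_cvg_seriesB (cg v vab) (cg u uab).
  have cZ := is_cvg_seriesZ (k := v - u) ch; have cMZ := is_cvg_seriesZ (k := (v - u) ^+ 2) cM.
  have <- : limn (series (fun n => g n v - g n u - (v - u) * h n u)) =
      S v - S u - H * (v - u).
    have /= E := lim_seriesB cD cZ; rewrite [LHS]E (lim_seriesM _ ch).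
    by have /= -> := lim_seriesB (cg v vab) (cg u uab); rewrite mulrC.
  rewrite mulrC -(lim_seriesM _ cM).
  apply: (cvg_series_dominated cMZ _).2 => n.
  have := taylor1_le (dg n) (dh n) (fun x xab => let: And3 _ _ p := B n x xab in p) uab vab.
  by rewrite [leRHS]mulrC [h n u * _]mulrC.
have der : (fun t : R => t^-1 *: (S (t *: 1 + u) - S u)) @ 0^' --> H.
  have d0 : 0 < Num.min (u - a) (b - u) by rewrite lt_min !subr_gt0.
  have L0 : 0 < `|L| + 1 by rewrite ltr_wpDl.
  apply/cvgrPdist_le => e e0; near=> t.
  have t0 : t != 0 by near: t; exact: nbhs_dnbhs_neq.
  have tab : a < t + u < b.
    have : `|t| < Num.min (u - a) (b - u) by near: t; exact: dnbhs0_lt.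
    by rewrite lt_min !ltr_norml => /andP[/andP[h1 h2] /andP[h3 h4]]; apply/andP; split; lra.
  have te : `|t| <= e / (`|L| + 1) by near: t; apply: dnbhs0_le; rewrite divr_gt0.
  rewrite /GRing.scale/= mulr1.
  have -> : H - t^-1 * (S (t + u) - S u) = - (t^-1 * (S (t + u) - S u - H * t)).
    by field.
  have := rem _ tab; rewrite addrK => r.
  rewrite normrN normrM normfV ler_pdivrMl ?normr_gt0//; apply: (le_trans r).
  rewrite -[leLHS]mulr1 -[t ^+ 2]real_normK ?num_real// mulr1 mulrC expr2 -mulrA ler_wpM2l//.
  apply: (@le_trans _ _ (`|t| * (`|L| + 1))).
    by rewrite ler_wpM2l// (le_trans (ler_norm _))// lerDl.
  by rewrite -ler_pdivlMr.
by apply: DeriveDef; [apply/cvg_ex; exists H|exact: cvg_lim].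
Unshelve. all: by end_near. Qed.

End termwise_derivative.

(** * The kernel as a series of powers *)

Section complex_series.
Context {R : realType}.

Lemma Re_realM x (z : R[i]) : Re (x%:C * z) = x * Re z.
Proof. by rewrite ReM/= mul0r subr0. Qed.

Lemma Im_realM x (z : R[i]) : Im (x%:C * z) = x * Im z.
Proof. by rewrite ImM/= mul0r addr0. Qed.

Lemma normc_normr (z : R[i]) : `|z| = (normc z)%:C.
Proof. by case: z. Qed.

Lemma cvg_complex (x : nat -> R[i]) (a b : R) :
  (fun n => Re (x n)) @ \oo --> a -> (fun n => Im (x n)) @ \oo --> b ->
  (x : nat -> R[i]^o) @ \oo --> (a +i* b : R[i]^o).
Proof.
move=> xa xb; apply/cvgrPdist_le => e e0.
have ee : e = (Re e)%:C by apply/esym/RRe_real/gtr0_real.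
have e2 : 0 < Re e / 2 by rewrite divr_gt0//; move: e0; rewrite ee ltcR.
move/cvgrPdist_le: xa => /(_ _ e2) na; move/cvgrPdist_le: xb => /(_ _ e2) nb.
near=> n; rewrite normc_normr ee lecR (le_trans (normc_le _))// !ReImE/= [leRHS]splitr lerD//.
- by near: n; exact: na.
- by near: n; exact: nb.
Unshelve. all: by end_near. Qed.

End complex_series.

Section kernel_series.
Context {R : realType} (k : R) (alpha omega g : R[i]).
Hypotheses (k0 : 0 < k) (alpha0 : 0 < Re alpha).
Implicit Types (s : R[i]) (n : nat) (u b l x p : R).

Definition kcoef n : R[i] := kPochhammer k g n * omega ^+ n / n`!%:R.

Definition kterm s n u : R[i] :=
  kcoef n * (kGamma k (alpha * n%:R + s))^-1 *
  cpowR u ((alpha * n%:R + s) / k%:C - 1).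

(** The function u ^ (s / k - 1) E (omega u ^ (alpha / k)), as shown below; its
two components are summed separately, as real series. *)
Definition kker s u : R[i] :=
  limn (series (fun n => Re (kterm s n u))) +i* limn (series (fun n => Im (kterm s n u))).

Lemma is_cderive_kterm s n u : 0 < u ->
  is_cderive (kterm s n) u ((k^-1)%:C * kterm (s - k%:C) n u).
Proof.
move=> u0; rewrite /kterm; set c := kcoef n; set z := alpha * n%:R + s.
have -> : alpha * n%:R + (s - k%:C) = z - k%:C by rewrite addrA.
rewrite (kGamma_inv_recursion z k0).
have kC0 : k%:C != 0 :> R[i] by rewrite eq_complex/= gt_eqF.
have := is_cderiveZ (c * (kGamma k z)^-1) (is_cderive_cpowR (z / k%:C - 1) u0).
have -> : (z - k%:C) / k%:C - 1 = z / k%:C - 1 - 1 by rewrite mulrBl divff.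
congr is_cderive; rewrite -invC.
have -> : z / k%:C - 1 = (z - k%:C) / k%:C by rewrite mulrBl divff.
by move: (kGamma k z)^-1 (cpowR u _) => y w; ring.
Qed.

Lemma normc_kcoef n : normc (kcoef n) <= ((normc g + k) * normc omega) ^+ n.
Proof.
rewrite /kcoef !ComplexField.Normc.normcM normcX exprMn.
have f0 : (0 : R) < n`!%:R by rewrite ltr0n fact_gt0.
have -> : normc (n`!%:R^-1) = n`!%:R^-1 :> R.
  by rewrite natrC invC normcC gtr0_norm// invr_gt0.
rewrite ler_pdivrMr// [leRHS]mulrAC ler_wpM2r ?exprn_ge0 ?normc_ge0// /kPochhammer (normc_prod n (fun j => g + j%:R * k%:C)).
elim: n {f0} => [|n IH]; first by rewrite big_ord0 expr0 mulr1.
rewrite big_ord_recr/= exprSr factS natrM [n.+1%:R * _]mulrC mulrACA.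
apply: ler_pM => //; [by apply: prodr_ge0 => i _; exact: normc_ge0|exact: normc_ge0|].
rewrite (le_trans (le_normcD _ _))// ComplexField.Normc.normcM natrC !normcC.
rewrite (ger0_norm (ltW k0)) ger0_norm// -natr1 mulrDr mulr1 [_ * n%:R]mulrDl.
move: (normc_ge0 g) (mulr_ge0 (normc_ge0 g) (ler0n R n)) k0; move: (normc g) (n%:R : R) => a c; lra.
Qed.

(** The growth of kGamma beats every geometric rate, in particular the one of the
coefficients and of the powers of u on a bounded interval. *)
Lemma normc_kterm s b : 0 < b -> exists2 C, 0 <= C &
  forall n u, 0 < u <= b -> normc (kterm s n u) <= C * u `^ (Re s / k - 1) * (2^-1) ^+ n.
Proof.
move=> b0; pose G0 := (normc g + k) * normc omega; pose B := b `^ (Re alpha / k).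
have G00 : 0 <= G0 by rewrite mulr_ge0// ?normc_ge0// addr_ge0 ?normc_ge0// ltW.
have B0 : 0 <= B by exact: powR_ge0.
pose A := 1 + 2 * (G0 * B); have A1 : 1 <= A by rewrite lerDl mulr_ge0 ?(mulr_ge0 G00 B0).
have A0 : 0 < A by exact: lt_le_trans A1.
have [c c0 cA] := kGamma_inv_bound s k0 alpha0 A1.
exists c => // n u /andP[u0 ub]; rewrite /kterm 2!ComplexField.Normc.normcM normc_cpowR//.
have -> : Re ((alpha * n%:R + s) / k%:C - 1) = (Re s / k - 1) + Re alpha / k * n%:R.
  by rewrite ReD Re_divC natrC ReD ReM/= mulr0 subr0 mulrDl; ring.
rewrite powRD; last by rewrite (gt_eqF u0) implybT.
rewrite powRrM powR_mulrn ?powR_ge0//.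
have uB : u `^ (Re alpha / k) ^+ n <= B ^+ n.
  apply: lerXn2r; rewrite ?nnegrE ?powR_ge0//.
  by rewrite ge0_ler_powR ?nnegrE ?divr_ge0// ltW.
have : normc (kcoef n) * normc (kGamma k (alpha * n%:R + s))^-1 *
      (u `^ (Re s / k - 1) * u `^ (Re alpha / k) ^+ n) <=
    G0 ^+ n * (c / A ^+ n) * (u `^ (Re s / k - 1) * B ^+ n).
  apply: ler_pM.
  - by apply: mulr_ge0; exact: normc_ge0.
  - by apply: mulr_ge0; [|apply: exprn_ge0]; exact: powR_ge0.
  - by apply: ler_pM; [exact: normc_ge0|exact: normc_ge0|exact: normc_kcoef|exact: cA].
  - by apply: ler_wpM2l uB; exact: powR_ge0.
move=> /le_trans; apply.
have -> : G0 ^+ n * (c / A ^+ n) * (u `^ (Re s / k - 1) * B ^+ n) =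
    c * u `^ (Re s / k - 1) * (G0 * B / A) ^+ n.
  by rewrite !exprMn exprVn; move: (_ `^ _) (A ^+ n)^-1 => y w; ring.
rewrite ler_wpM2l ?mulr_ge0 ?powR_ge0// lerXn2r ?nnegrE ?(divr_ge0 (mulr_ge0 G00 B0) (ltW A0))//.
by rewrite ler_pdivrMr// /A; lra.
Qed.

Lemma powR_between l b p x : 0 < l -> l <= x <= b -> x `^ p <= l `^ p + b `^ p.
Proof.
move=> l0 /andP[lx xb]; have x0 := lt_le_trans l0 lx; have b0 := lt_le_trans x0 xb.
have [p0|p0] := leP 0 p.
  rewrite (le_trans (@ge0_ler_powR _ p p0 x b _ _ xb)) ?nnegrE ?(ltW x0) ?(ltW b0)//.
  by rewrite lerDr powR_ge0.
apply: (@le_trans _ _ (l `^ p)); last by rewrite lerDl powR_ge0.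
rewrite -[p]opprK !(powRN _ (- p)) lef_pV2 ?posrE ?powR_gt0//.
by rewrite ge0_ler_powR ?nnegrE ?oppr_ge0 ?(ltW l0) ?(ltW x0) ?(ltW p0).
Qed.

Lemma cvg_geometric_half (C : R) : cvgn (series (fun n => C * (2^-1) ^+ n)) /\
  limn (series (fun n => C * (2^-1) ^+ n)) = 2 * C.
Proof.
have h : `|2^-1 : R| < 1 by rewrite gtr0_norm ?invr_gt0// invf_lt1// ltr1n.
have c := cvg_geometric_series (a := C) h; split; first exact: (cvgP _ c).
by rewrite (cvg_lim _ c)//; field.
Qed.

Lemma kterm_cvg s u : 0 < u -> cvgn (series (fun n => Re (kterm s n u))) /\
  cvgn (series (fun n => Im (kterm s n u))).
Proof.
move=> u0; have [C C0 B] := normc_kterm s u0.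
have [c _] := cvg_geometric_half (C * u `^ (Re s / k - 1)).
by split; apply: (cvg_series_dominated c _).1 => n;
  rewrite (le_trans _ (B n u _)) ?normc_Re ?normc_Im// u0/=.
Qed.

Lemma kker_bound s b : 0 < b -> exists2 C, 0 <= C & forall u, 0 < u <= b ->
  `|Re (kker s u)| <= C * u `^ (Re s / k - 1) /\ `|Im (kker s u)| <= C * u `^ (Re s / k - 1).
Proof.
move=> b0; have [C C0 B] := normc_kterm s b0.
exists (2 * C) => [|u ub]; first by rewrite mulr_ge0.
have [c L] := cvg_geometric_half (C * u `^ (Re s / k - 1)).
by rewrite -mulrA -L; split; apply: (cvg_series_dominated c _).2 => n;
  rewrite (le_trans _ (B n u ub)) ?normc_Re ?normc_Im.
Qed.

(** The functional equation of 1 / kGamma makes each term of the series for s - k,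
divided by k, the derivative of the corresponding term for s. *)
Lemma is_cderive_kker s u : 0 < u ->
  is_cderive (kker s) u ((k^-1)%:C * kker (s - k%:C) u).
Proof.
move=> u0; pose l := u / 2; pose b := u + 1.
have l0 : 0 < l by rewrite divr_gt0.
have b0 : 0 < b by rewrite addr_gt0.
have lub : l < u < b by rewrite /l /b; apply/andP; split; lra.
pose P s' := l `^ (Re s' / k - 1) + b `^ (Re s' / k - 1).
have bound s' : exists2 C, 0 <= C & forall n x, l < x < b -> normc (kterm s' n x) <= C * (2^-1) ^+ n.
  have [C C0 B] := normc_kterm s' b0; exists (C * P s').
    by rewrite mulr_ge0// addr_ge0// powR_ge0.
  move=> n x /andP[lx xb]; rewrite (le_trans (B n x _)) ?(lt_trans l0 lx) ?(ltW xb)//.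
  by rewrite ler_wpM2r ?exprn_ge0// ler_wpM2l// powR_between// !ltW.
have [C0 C00 B0] := bound s; have [C1 C10 B1] := bound (s - k%:C).
have [C2 C20 B2] := bound (s - k%:C - k%:C).
pose k1 := k^-1; have k10 : 0 <= k1 by rewrite invr_ge0 ltW.
pose M n := (C0 + k1 * C1 + k1 * (k1 * C2)) * (2^-1 : R) ^+ n.
have cM : cvgn (series M) by exact: (cvg_geometric_half _).1.
have le0 n x : l < x < b -> normc (kterm s n x) <= M n.
  move=> xlb; rewrite (le_trans (B0 n x xlb))// ler_wpM2r ?exprn_ge0// -addrA lerDl.
  by rewrite addr_ge0// ?mulr_ge0.
have le1 n x : l < x < b -> normc (k1%:C * kterm (s - k%:C) n x) <= M n.
  move=> xlb; rewrite ComplexField.Normc.normcM normcC ger0_norm//.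
  rewrite (le_trans (ler_wpM2l k10 (B1 n x xlb)))// mulrA ler_wpM2r ?exprn_ge0//.
  by rewrite addrAC lerDr addr_ge0// ?mulr_ge0.
have le2 n x : l < x < b -> normc (k1%:C * (k1%:C * kterm (s - k%:C - k%:C) n x)) <= M n.
  move=> xlb; rewrite 2!(ComplexField.Normc.normcM k1%:C) normcC ger0_norm//.
  rewrite (le_trans (ler_wpM2l k10 (ler_wpM2l k10 (B2 n x xlb))))// (mulrA k1 C2) (mulrA k1 (k1 * C2)) ler_wpM2r ?exprn_ge0//.
  by rewrite lerDr addr_ge0// ?mulr_ge0.
have d0 n x : l < x < b -> is_cderive (kterm s n) x (k1%:C * kterm (s - k%:C) n x).
  by move=> /andP[lx _]; apply: is_cderive_kterm; exact: lt_trans lx.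
have d1 n x : l < x < b -> is_cderive (fun y => k1%:C * kterm (s - k%:C) n y) x
    (k1%:C * (k1%:C * kterm (s - k%:C - k%:C) n x)).
  by move=> /andP[lx _]; apply: is_cderiveZ; apply: is_cderive_kterm; exact: lt_trans lx.
have [cr ci] := kterm_cvg (s - k%:C) u0.
split.
  have -> : Re (k1%:C * kker (s - k%:C) u) =
      limn (series (fun n => Re (k1%:C * kterm (s - k%:C) n u))).
    rewrite Re_realM -(lim_seriesM _ cr); congr (limn (series _)).
    by apply/funext => n; rewrite Re_realM.
  apply: (is_derive_series (fun n x xlb => (d0 n x xlb).1) (fun n x xlb => (d1 n x xlb).1) _ cM lub).
  by move=> n x xlb; split; apply: le_trans (normc_Re _) _; auto.
have -> : Im (k1%:C * kker (s - k%:C) u) =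
    limn (series (fun n => Im (k1%:C * kterm (s - k%:C) n u))).
  rewrite Im_realM -(lim_seriesM _ ci); congr (limn (series _)).
  by apply/funext => n; rewrite Im_realM.
apply: (is_derive_series (fun n x xlb => (d0 n x xlb).2) (fun n x xlb => (d1 n x xlb).2) _ cM lub).
by move=> n x xlb; split; apply: le_trans (normc_Im _) _; auto.
Qed.

Lemma kMittagLeffler_kker s u : 0 < u ->
  cpowR u (s / k%:C - 1) * kMittagLeffler k alpha s g (omega * cpowR u (alpha / k%:C)) =
  kker s u.
Proof.
move=> u0; set w := cpowR u _; have w0 : w != 0 by exact: cpowR_neq0.
have [cr ci] := kterm_cvg s u0.
have c : (series (fun n => kterm s n u) : nat -> R[i]^o) @ \oo --> (kker s u : R[i]^o).
  apply: cvg_complex.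
    have -> // : (fun n => Re (series (fun n0 => kterm s n0 u) n)) = series (fun n => Re (kterm s n u)).
    by apply/funext => n; rewrite /series/= raddf_sum.
  have -> // : (fun n => Im (series (fun n0 => kterm s n0 u) n)) = series (fun n => Im (kterm s n u)).
  by apply/funext => n; rewrite /series/= raddf_sum.
have E : (series (fun n => kPochhammer k g n / kGamma k (alpha * n%:R + s) *
    ((omega * cpowR u (alpha / k%:C)) ^+ n / n`!%:R)) : nat -> R[i]^o) =
    (fun n => w^-1 * series (fun n => kterm s n u) n).
  apply/funext => N; rewrite /series/= mulr_sumr; apply: eq_bigr => n _.
  apply: (mulfI w0); rewrite mulVKf//.
  rewrite exprMn cpowRX /kterm /kcoef.
  have -> : (alpha * n%:R + s) / k%:C - 1 = (s / k%:C - 1) + n%:R * (alpha / k%:C).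
    by rewrite mulrDl; ring.
  rewrite cpowRD -/w.
  by move: (kGamma k _)^-1 (cpowR u _) (n`!%:R^-1) (kPochhammer _ _ _) (omega ^+ _) => *; ring.
rewrite /kMittagLeffler E.
have -> : lim ((fun n => w^-1 * series (fun n => kterm s n u) n : R[i]^o) @ \oo) = w^-1 * kker s u.
  apply: (cvg_lim (@norm_hausdorff R[i] R[i]^o)).
  exact: (@cvgZl_tmp R[i] R[i]^o _ _ _ w^-1 _ _ c).
by rewrite mulVKf.
Qed.

End kernel_series.

(** * Successive derivatives on a segment *)

Section derivatives_in_segment.
Context {R : realType}.
Implicit Types (a b x y : R) (F : R -> R).

Lemma derivable_in_ball a b F x : derivable_in `[a, b] F x ->
  forall e, 0 < e -> exists2 d, 0 < d & forall y, y \in `[a, b] -> y != x -> `|y - x| < d ->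
    `|derive_in `[a, b] F x - quot_in F x y| <= e.
Proof.
move=> dF e e0; have /(_ (within_filter _ _)) := (cvgrPdist_le _ _).1 dF e e0.
rewrite /dnbhs/within/= => -[d d0 dq]; exists d => // y yab yx yd.
by apply: dq => //; rewrite /ball_/= distrC.
Qed.

Lemma derivable_in_continuous a b F x : derivable_in `[a, b] F x ->
  F @ within `[a, b] (nbhs x) --> F x.
Proof.
move=> dF; have [d d0 dq] := derivable_in_ball dF ltr01.
pose l := derive_in `[a, b] F x.
have l0 : 0 < `|l| + 1 by rewrite ltr_wpDl.
apply/cvgrPdist_le => e e0; change (\forall y \near nbhs x, y \in `[a, b] -> `|F x - F y| <= e).
near=> y => yab.
have [->|yx] := eqVneq y x; first by rewrite subrr normr0 ltW.
have yd : `|y - x| < d by rewrite distrC; near: y; apply: cvgr_dist_lt d0; exact: cvg_id.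
have ye : `|y - x| <= e / (`|l| + 1).
  by rewrite distrC; near: y; apply: cvgr_dist_le; [exact: cvg_id|rewrite divr_gt0].
have q1 := dq y yab yx yd.
have ql : `|quot_in F x y| <= `|l| + 1.
  have -> : quot_in F x y = l - (l - quot_in F x y) by ring.
  by rewrite (le_trans (ler_normB _ _))// lerD2l.
have -> : F x - F y = - (quot_in F x y * (y - x)).
  by rewrite /quot_in divfK ?subr_eq0//; ring.
rewrite normrN normrM (le_trans (ler_wpM2r (normr_ge0 _) ql))//.
by rewrite mulrC -ler_pdivlMr.
Unshelve. all: by end_near. Qed.

Lemma derivable_in_is_derive a b F x : a < x < b -> derivable_in `[a, b] F x ->
  is_derive x (1 : R) F (derive_in `[a, b] F x).
Proof.
move=> axb dF; set l := derive_in `[a, b] F x.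
have der : (fun t : R => t^-1 *: (F (t *: 1 + x) - F x)) @ 0^' --> l.
  have d0 : 0 < Num.min (x - a) (b - x) by rewrite lt_min !subr_gt0.
  apply/cvgrPdist_le => e e0; have [d d1 dq] := derivable_in_ball dF e0; near=> t.
  have t0 : t != 0 by near: t; exact: nbhs_dnbhs_neq.
  have td : `|t| < d by near: t; exact: dnbhs0_lt.
  have : `|t| < Num.min (x - a) (b - x) by near: t; exact: dnbhs0_lt.
  rewrite lt_min !ltr_norml => /andP[/andP[h1 h2] /andP[h3 h4]].
  have := dq (t + x); rewrite in_itv/= addrK td /quot_in addrK /GRing.scale/= mulr1 mulrC; apply => //.
    by apply/andP; split; lra.
  by rewrite -subr_eq0 addrK.
by apply: DeriveDef; [apply/cvg_ex; exists l|exact: cvg_lim].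
Unshelve. all: by end_near. Qed.

Lemma continuous_clamp a b F : a <= b ->
  (forall x, x \in `[a, b] -> F @ within `[a, b] (nbhs x) --> F x) ->
  continuous (F \o clamp a b).
Proof.
move=> ab cF x; apply: (@cvg_comp _ _ _ (clamp a b) F _ (within `[a, b] (nbhs (clamp a b x)))).
  move=> A; rewrite /within/= => -[d d0 dA]; exists d => // y /= xy.
  apply: dA; last by rewrite /= in_itv/= clamp_itv.
  rewrite /= (le_lt_trans _ xy)//.
  have [h|/ltW h] := leP x y.
    by rewrite !ler0_norm ?subr_le0 ?le_clamp// !opprB clampB_le.
  by rewrite !ger0_norm ?subr_ge0 ?le_clamp// clampB_le.
by apply: cF; rewrite in_itv/= clamp_itv.
Qed.

End derivatives_in_segment.

Section AC_derivatives.
Context {R : realType} (b : R) (n : nat) (f : R -> R).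
Local Notation mu := (@lebesgue_measure R).
Hypotheses (b0 : 0 < b) (hf : ACn n.+1 0 b f).
Implicit Types (i : nat) (x t : R).

(** Extension by constants turns continuity on the segment into continuity on the
line, which the measurability of the derivative asks for. *)
Definition AC_deriv i : R -> R := deriven_in i `[0, b] f \o clamp 0 b.

(** The derivatives are cut off outside the open interval, so that they can be
convolved on the whole line. *)
Definition AC_density i t : R := if t \in `]0, b[ then derive1n i f t else 0.

Lemma continuous_AC_deriv i : (i <= n)%N -> continuous (AC_deriv i).
Proof.
rewrite leq_eqVlt => /predU1P[->|lt_in].
  exact/ac_line_continuous/ac_on_line/abs_continuous_ac_on/hf.2/ltW.
apply: continuous_clamp; first exact: ltW.
by move=> x xb; apply: derivable_in_continuous; exact: hf.1.
Qed.

Lemma AC_deriv_itv i t : 0 <= t <= b -> AC_deriv i t = deriven_in i `[0, b] f t.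
Proof. by move=> tb; rewrite /AC_deriv/= clamp_id. Qed.

Lemma near_AC_deriv i x : 0 < x < b -> {near x, AC_deriv i =1 deriven_in i `[0, b] f}.
Proof.
move=> x0b; have xin : x \in `]0, b[ by rewrite in_itv.
near=> y; have : y \in `]0, b[ by near: y; exact: near_in_itvoo.
by rewrite in_itv/= => /andP[y0 yb]; rewrite AC_deriv_itv// !ltW.
Unshelve. all: by end_near. Qed.

Lemma is_derive_AC_deriv i x : (i < n)%N -> 0 < x < b ->
  is_derive x (1 : R) (AC_deriv i) (AC_deriv i.+1 x).
Proof.
move=> lt_in x0b; have /andP[x0 xb] := x0b.
rewrite (AC_deriv_itv i.+1) ?ltW//.
have dF := derivable_in_is_derive x0b (hf.1 i x lt_in _).
have {}dF : is_derive x (1 : R) (deriven_in i `[0, b] f) (deriven_in i.+1 `[0, b] f x).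
  by apply: dF; rewrite in_itv/= !ltW.
have nE := near_AC_deriv i x0b.
apply: DeriveDef; last by rewrite (near_eq_derive _ nE) derive_val.
by apply: (near_eq_derivable _ (@ex_derive _ _ _ _ _ _ _ dF)); apply: filterS nE => y ->.
Qed.

Lemma derive1n_AC_deriv i x : (i <= n)%N -> 0 < x < b -> derive1n i f x = AC_deriv i x.
Proof.
elim: i x => [|i IH] x lt_in x0b; first by rewrite AC_deriv_itv// !ltW//; case/andP: x0b.
rewrite derive1nS derive1E.
have nE : {near x, derive1n i f =1 AC_deriv i}.
  have xin : x \in `]0, b[ by rewrite in_itv.
  near=> y; apply: IH; first exact: ltnW.
  by have : y \in `]0, b[ by near: y; exact: near_in_itvoo.
rewrite (near_eq_derive _ nE).
by have [_ ->] := is_derive_AC_deriv lt_in x0b.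
Unshelve. all: by end_near. Qed.

Lemma AC_densityE i t : (i <= n)%N -> 0 < t < b -> AC_density i t = AC_deriv i t.
Proof. by move=> lin t0b; rewrite /AC_density in_itv/= t0b derive1n_AC_deriv. Qed.

Lemma AC_density_out i t : t <= 0 \/ b <= t -> AC_density i t = 0.
Proof.
rewrite /AC_density; case: ifPn => //; rewrite in_itv/= => /andP[t0 tb].
by case; lra.
Qed.

Lemma AC_density_restrict (F : R -> R) i : (forall t, 0 < t < b -> derive1n i f t = F t) ->
  AC_density i = F \_ `]0, b[.
Proof.
move=> FE; apply/funext => t; rewrite patchE /AC_density mem_setE.
by case: ifPn => // tb; apply: FE; rewrite in_itv in tb.
Qed.

Lemma integrable_AC_density_lt i : (i <= n)%N -> mu.-integrable setT (EFin \o AC_density i).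
Proof.
move=> lin; rewrite (AC_density_restrict (F := AC_deriv i)); last first.
  by move=> t; exact: derive1n_AC_deriv.
rewrite -restrict_EFin; apply/integrable_restrict => //; rewrite setTI.
have iF : mu.-integrable `[0, b] (EFin \o AC_deriv i).
  apply: continuous_compact_integrable; first exact: segment_compact.
  by apply: continuous_subspaceT; exact: continuous_AC_deriv.
by apply: integrableS iF => //; exact: subset_itv_oo_cc.
Qed.

Lemma AC_density_primitive_lt i t : (i < n)%N -> 0 < t < b ->
  AC_density i t = AC_deriv i 0 + \int[mu]_(v in `]0, t]) AC_density i.+1 v.
Proof.
move=> lt_in t0b; have /andP[t0 tb] := t0b; rewrite AC_densityE 1?ltnW//.
have c := @continuous_AC_deriv i (ltnW lt_in); have c1 := @continuous_AC_deriv i.+1 lt_in.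
have dn x : x \in `]0, t[ -> 0 < x < b.
  by rewrite in_itv/= => /andP[-> xt]; rewrite (lt_trans xt).
have LR : derivable_oo_LRcontinuous (AC_deriv i) 0 t.
  split; [|apply: cvg_at_right_filter; exact: c|apply: cvg_at_left_filter; exact: c].
  by move=> x /dn /(is_derive_AC_deriv lt_in)[].
have F' : {in `]0, t[, derive1 (AC_deriv i) =1 AC_deriv i.+1}.
  by move=> x /dn /(is_derive_AC_deriv lt_in)[_]; rewrite derive1E.
have := continuous_FTC2 t0 (continuous_subspaceT c1) LR F'.
rewrite -EFinB => /(congr1 fine)/=.
rewrite -/(Rintegral mu `[0, t] (AC_deriv i.+1)) => E.
rewrite (_ : \int[mu]_(v in `]0, t]) _ = \int[mu]_(v in `[0, t]) AC_deriv i.+1 v).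
  by rewrite E; ring.
have ic : mu.-integrable `]0, t] (EFin \o AC_deriv i.+1).
  have iF : mu.-integrable `[0, t] (EFin \o AC_deriv i.+1).
    apply: continuous_compact_integrable; first exact: segment_compact.
    exact: continuous_subspaceT.
  by apply: integrableS iF => //; exact: subset_itv_oc_cc.
rewrite -(Rintegral_itv_obnd_cbnd ic).
apply: eq_Rintegral => x /set_mem/=; rewrite in_itv/= => /andP[x0 xt].
by rewrite AC_densityE// x0 (le_lt_trans xt).
Qed.

(** The last derivative exists almost everywhere only: absolute continuity provides
a density, and the pointwise derivative is a measurable version of it. *)
Lemma AC_density_last : mu.-integrable setT (EFin \o AC_density n.+1) /\
  forall t, 0 < t < b ->
    AC_density n t = AC_deriv n 0 + \int[mu]_(v in `]0, t]) AC_density n.+1 v.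
Proof.
have [phi [iphi phiE]] := ac_on_density (ltW b0) (abs_continuous_ac_on hf.2).
have cn := @continuous_AC_deriv n (leqnn n).
have AE x : 0 <= x <= b -> AC_deriv n x = AC_deriv n 0 + \int[mu]_(t in `]0, x]) phi t.
  by move=> xb; rewrite !AC_deriv_itv ?lexx ?(ltW b0)// phiE.
have aeE := ac_on_derive iphi AE.
have dE : AC_density n.+1 = derive1 (AC_deriv n) \_ `]0, b[.
  apply: AC_density_restrict => t t0b; rewrite derive1nS !derive1E; apply: near_eq_derive.
  have tin : t \in `]0, b[ by rewrite in_itv.
  near=> y; apply: derive1n_AC_deriv => //.
  by have : y \in `]0, b[ by near: y; exact: near_in_itvoo.
have md : measurable_fun setT (AC_density n.+1).
  rewrite dE; apply/(measurable_restrictT _ _).1 => //.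
  by apply: measurable_funTS; exact: measurable_derive1.
have ip : mu.-integrable setT (EFin \o (phi \_ `]0, b[)).
  rewrite -restrict_EFin; apply/integrable_restrict => //; rewrite setTI.
  exact: integrableS iphi.
have ae2 : {ae mu, forall x, AC_density n.+1 x = (phi \_ `]0, b[) x}.
  move: aeE; apply: filterS; first exact: (ae_filter_ringOfSetsType mu).
  by move=> x; rewrite dE !patchE mem_setE; case: ifPn => // xb [].
have iA : mu.-integrable setT (EFin \o AC_density n.+1).
  have [mp poo] := integrableP _ _ _ ip.
  apply/integrableP; split; first exact/measurable_EFinP.
  rewrite (_ : integral _ _ _ = \int[mu]_x `|(EFin \o phi \_ `]0%R, b[) x|)%E//.
  apply: ae_eq_integral => //.
  - by apply: measurableT_comp => //; exact/measurable_EFinP.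
  - exact: measurableT_comp.
  move: ae2; apply: filterS; first exact: (ae_filter_ringOfSetsType mu).
  by move=> x /= ->.
split => // t t0b; have /andP[t0 tb] := t0b.
rewrite AC_densityE// AE ?(ltW t0) ?(ltW tb)//; congr (_ + _).
rewrite /Rintegral; congr fine; apply: ae_eq_integral => //.
- by apply: measurable_funTS; exact: measurable_int iphi.
- by apply: measurable_funTS; exact/measurable_EFinP.
move: ae2; apply: filterS; first exact: (ae_filter_ringOfSetsType mu).
move=> x /= -> ; rewrite in_itv/= => /andP[x0 xt]; rewrite patchE mem_set//=.
by rewrite in_itv/= x0 (le_lt_trans xt).
Unshelve. all: by end_near. Qed.

Lemma integrable_AC_density i : (i <= n.+1)%N -> mu.-integrable setT (EFin \o AC_density i).
Proof.
rewrite leq_eqVlt => /predU1P[->|]; first exact: AC_density_last.1.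
exact: integrable_AC_density_lt.
Qed.

Lemma AC_density_primitive i t : (i <= n)%N -> 0 < t < b ->
  AC_density i t = AC_deriv i 0 + \int[mu]_(v in `]0, t]) AC_density i.+1 v.
Proof.
rewrite leq_eqVlt => /predU1P[->|]; first exact: AC_density_last.2.
exact: AC_density_primitive_lt.
Qed.

Lemma lim_derive1n_AC i : (i <= n)%N ->
  lim (derive1n i f s @[s --> 0^'+]) = AC_deriv i 0.
Proof.
move=> lin; apply: (cvg_lim (@Rhausdorff R)).
have : AC_deriv i @ 0^'+ --> AC_deriv i 0.
  by apply: cvg_at_right_filter; exact: continuous_AC_deriv.
apply: cvg_trans; apply: near_eq_cvg; near=> s.
rewrite derive1n_AC_deriv//; apply/andP; split => //.
Unshelve. all: by end_near. Qed.

End AC_derivatives.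

(** * Derivatives of a convolution *)

Section primitive.
Context {R : realType}.
Local Notation mu := (@lebesgue_measure R).
Implicit Types (g : R -> R) (x : R).

Definition primitive g x : R := \int[mu]_(t in `]0, x]) g t.

Lemma continuous_primitive g x : mu.-integrable setT (EFin \o g) -> 0 < x ->
  {for x, continuous (primitive g)}.
Proof.
move=> ig x0.
have gE : primitive g = fun y => parameterized_integral mu 0 y g.
  apply/funext => y; rewrite /primitive /parameterized_integral Rintegral_itv_obnd_cbnd//.
  by apply: integrableS ig => //; exact: measurable_itv.
have x1 : 0 < x + 1 by rewrite addr_gt0.
have ig1 : mu.-integrable `[0, x + 1] (EFin \o g).
  by apply: integrableS ig => //; exact: measurable_itv.
have /(continuous_within_itvP _ x1)[+ _ _] := parameterized_integral_continuous (ltW x1) ig1.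
by rewrite gE; apply; rewrite in_itv/= x0 ltrDl ltr01.
Qed.

Lemma is_derive_primitive g x : mu.-integrable setT (EFin \o g) -> 0 < x ->
  {for x, continuous g} -> is_derive x (1 : R) (primitive g) (g x).
Proof.
move=> ig x0 cg.
have ig1 : mu.-integrable [set` Interval (BRight 0) (BRight (x + 1))] (EFin \o g).
  by apply: integrableS ig => //; exact: measurable_itv.
have x1 : x < x + 1 by rewrite ltrDl.
have [d e] := continuous_FTC1 x1 ig1 (x0 : (BRight 0 < BRight x)%O) cg.
by apply: DeriveDef; rewrite -?derive1E.
Qed.

Lemma ae_is_derive_primitive g : mu.-integrable setT (EFin \o g) ->
  {ae mu, forall x, 0 < x -> is_derive x (1 : R) (primitive g) (g x)}.
Proof.
move=> ig; have iS y : mu.-integrable [set` Interval (BRight 0) (BRight y)] (EFin \o g).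
  by apply: integrableS ig => //; exact: measurable_itv.
have := FTC1 iS (open_integrable_locally openT ig).
apply: filterS; first exact: (ae_filter_ringOfSetsType mu).
move=> x /= H x0; have [d e] := H x0.
by apply: DeriveDef; rewrite -?derive1E.
Qed.

End primitive.

Section derivatives_of_convolution.
Context {R : realType} (b : R) (n : nat).
Local Notation mu := (@lebesgue_measure R).
Variables (K psi : nat -> R -> R) (c : nat -> R).
Hypothesis dK : forall p (u : R), 0 < u -> is_derive u (1 : R) (K p) (K p.+1 u).
Hypothesis iK : mu.-integrable `]0, b[ (EFin \o K 0%N).
Hypothesis ipsi : forall i, (i <= n.+1)%N -> mu.-integrable setT (EFin \o psi i).
Hypothesis psi_out : forall i (t : R), t <= 0 \/ b <= t -> psi i t = 0.
Hypothesis psiE : forall i (t : R), (i <= n)%N -> 0 < t < b ->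
  psi i t = c i + primitive (psi i.+1) t.

Implicit Types (i p : nat) (x s t : R).

Let Kb : R -> R := K 0%N \_ `]0, b[.

Let KbE u : 0 < u < b -> Kb u = K 0%N u.
Proof. by move=> ub; rewrite /Kb patchE mem_set// /= in_itv. Qed.

Let Kb0 u : u <= 0 -> Kb u = 0.
Proof. by move=> u0; rewrite /Kb patchE memNset//= in_itv/=; apply/negP; rewrite ltNge u0. Qed.

Let psi0 i u : u <= 0 -> psi i u = 0.
Proof. by move=> u0; apply: psi_out; left. Qed.

Let iKb : mu.-integrable setT (EFin \o Kb).
Proof. by rewrite -restrict_EFin; apply/integrable_restrict => //; rewrite setTI. Qed.

Definition conv i s : R := \int[mu]_(t in `]0, s[) (K 0%N (s - t) * psi i t).

Let convE i s : 0 < s < b -> conv i s = convolution Kb (psi i) s.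
Proof.
move=> /andP[s0 sb]; rewrite convolution_itv//; last exact: psi0.
apply: eq_Rintegral => t /set_mem/=; rewrite in_itv/= => /andP[t0 ts].
by rewrite KbE//; apply/andP; split; lra.
Qed.

(** Since psi i is c i plus a primitive of psi i.+1, its convolution with the kernel
splits in two; differentiating in x gives c i * K 0 x plus the next convolution. *)
Let conv_primitive i x : (i <= n)%N -> 0 < x < b ->
  conv i x = c i * primitive Kb x + primitive (convolution Kb (psi i.+1)) x.
Proof.
move=> lin x0b; have /andP[x0 xb] := x0b.
have := integral_conv_primitive iKb (ipsi (lin : (i.+1 <= n.+1)%N)) Kb0 (@psi0 i.+1) (c i) x.
rewrite (Rintegral_itv_bndo_bndc (f := Kb)); last first.
  by apply: integrableS iKb => //; exact: measurable_itv.
rewrite -/(primitive _ _) -/(primitive _ _) => <-.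
apply: eq_Rintegral => t /set_mem/=; rewrite in_itv/= => /andP[t0 tx].
rewrite KbE; last by apply/andP; split; lra.
by rewrite psiE// t0 (lt_trans tx).
Qed.

Let iconv i : (i <= n.+1)%N -> mu.-integrable setT (EFin \o convolution Kb (psi i)).
Proof. by move=> lin; apply: integrable_convolution => //; exact: ipsi. Qed.

Let near_itv x (P : R -> Prop) : 0 < x < b -> (forall y, 0 < y < b -> P y) -> \forall y \near x, P y.
Proof.
move=> xb PE; have xin : x \in `]0, b[ by rewrite in_itv.
near=> y; apply: PE.
by have : y \in `]0, b[ by near: y; exact: near_in_itvoo.
Unshelve. all: by end_near. Qed.

Let near_continuous (g h : R -> R) x : {near x, g =1 h} -> {for x, continuous h} ->
  {for x, continuous g}.
Proof.
move=> gh ch; rewrite /prop_for/continuous_at (nbhs_singleton gh).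
by apply: cvg_trans ch; apply: near_eq_cvg; apply: filterS gh => y ->.
Qed.

Let near_is_derive (g h : R -> R) x d : {near x, g =1 h} -> is_derive x (1 : R) h d ->
  is_derive x (1 : R) g d.
Proof.
move=> gh dh; apply: DeriveDef; last by rewrite (near_eq_derive _ gh) derive_val.
by apply: (near_eq_derivable _ (@ex_derive _ _ _ _ _ _ _ dh)); apply: filterS gh => y ->.
Qed.

Let continuous_K p x : 0 < x -> {for x, continuous (K p)}.
Proof.
move=> x0; apply: differentiable_continuous; apply/derivable1_diffP.
exact: (@ex_derive _ _ _ _ _ _ _ (dK p x0)).
Qed.

Let continuous_Kb x : 0 < x < b -> {for x, continuous Kb}.
Proof.
move=> xb; apply: (near_continuous (h := K 0%N)).
  by apply: near_itv => // y; exact: KbE.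
by apply: continuous_K; case/andP: xb.
Qed.

Let continuous_conv i x : (i <= n)%N -> 0 < x < b -> {for x, continuous (conv i)}.
Proof.
move=> lin xb; apply: near_continuous.
  by apply: near_itv xb _ => y; exact: conv_primitive.
have /andP[x0 _] := xb.
apply: cvgD; last exact: (continuous_primitive (iconv (lin : (i.+1 <= n.+1)%N)) x0).
by apply: cvgMr; exact: (continuous_primitive iKb x0).
Qed.

Let is_derive_conv i x d : (i <= n)%N -> 0 < x < b ->
  is_derive x (1 : R) (primitive (convolution Kb (psi i.+1))) d ->
  is_derive x (1 : R) (conv i) (c i * K 0%N x + d).
Proof.
move=> lin xb dx; apply: near_is_derive.
  by apply: near_itv xb _ => y; exact: conv_primitive.
have /andP[x0 _] := xb.
apply: is_deriveD; rewrite -KbE//.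
by apply: is_deriveZ; apply: is_derive_primitive => //; exact: continuous_Kb.
Qed.

(** The i-th derivative of the convolution: every differentiation adds a boundary
term c p * K 0 and turns each previous K q into K q.+1. *)
Definition conv_expansion i s : R := conv i s + \sum_(p < i) c p * K (i.-1 - p) s.

Let is_derive_expansion i x d : (i <= n)%N -> 0 < x < b ->
  is_derive x (1 : R) (primitive (convolution Kb (psi i.+1))) d ->
  is_derive x (1 : R) (conv_expansion i) (d + \sum_(p < i.+1) c p * K (i - p) x).
Proof.
move=> lin xb dx; have /andP[x0 _] := xb; have := is_derive_conv lin xb dx.
rewrite big_ord_recr/= subnn => dc.
have -> : conv_expansion i = conv i + \sum_(p < i) (fun s => c p * K (i.-1 - p) s).
  by apply/funext => s; rewrite /conv_expansion fct_sumE.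
have dsum : is_derive x (1 : R) (\sum_(p < i) (fun s => c p * K (i.-1 - p) s))
    (\sum_(p < i) c p * K (i - p) x).
  apply: is_derive_sum => p; apply: is_deriveZ.
  have -> : (i - p)%N = (i.-1 - p).+1 by case: i p {lin dx dc} => [[]//|i p]; rewrite subSn// -ltnS.
  exact: dK.
by apply: (is_derive_eq (is_deriveD dc dsum)); ring.
Qed.

Let is_derive_expansion_lt i x : (i < n)%N -> 0 < x < b ->
  is_derive x (1 : R) (conv_expansion i) (conv_expansion i.+1 x).
Proof.
move=> lin xb; apply: is_derive_expansion; [exact: ltnW|by []|].
rewrite convE//; apply: is_derive_primitive; [exact: iconv (ltnW _)|by case/andP: xb|].
apply: near_continuous; last exact: (continuous_conv lin xb).
by apply: near_itv => // y yb; rewrite convE.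
Qed.

Lemma derive1n_conv i x : (i <= n)%N -> 0 < x < b ->
  derive1n i (conv 0%N) x = conv_expansion i x.
Proof.
elim: i x => [|i IH] x lin xb; first by rewrite /conv_expansion big_ord0 addr0.
rewrite derive1nS derive1E (near_eq_derive _ (_ : {near x, _ =1 conv_expansion i})).
  by have [_ ->] := is_derive_expansion_lt lin xb.
by apply: near_itv => // y; apply: IH; exact: ltnW.
Qed.

Lemma derivable_derive1n_conv i x : (i < n)%N -> 0 < x < b ->
  derivable (derive1n i (conv 0%N)) x 1.
Proof.
move=> lin xb; have h : {near x, derive1n i (conv 0%N) =1 conv_expansion i}.
  by apply: near_itv => // y; apply: derive1n_conv; exact: ltnW.
exact: (@ex_derive _ _ _ _ _ _ _ (near_is_derive h (is_derive_expansion_lt lin xb))).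
Qed.

(** The last step differentiates a primitive of an integrable function, hence holds
almost everywhere, by the Lebesgue differentiation theorem. *)
Lemma ae_derive1n_conv : {ae mu, forall x, 0 < x < b ->
  derivable (derive1n n (conv 0%N)) x 1 /\
  derive1n n.+1 (conv 0%N) x = conv n.+1 x + \sum_(p < n.+1) c p * K (n - p) x}.
Proof.
have := ae_is_derive_primitive (iconv (leqnn n.+1)).
apply: filterS; first exact: (ae_filter_ringOfSetsType mu).
move=> x dx xb; have /andP[x0 _] := xb.
have dE := is_derive_expansion (leqnn n) xb (dx x0).
have h : {near x, derive1n n (conv 0%N) =1 conv_expansion n}.
  by apply: near_itv => // y; exact: derive1n_conv.
have d := near_is_derive h dE.
split; first exact: (@ex_derive _ _ _ _ _ _ _ d).
by rewrite derive1nS derive1E convE//; case: d.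
Qed.

(** The function psi 0 is bounded, being a primitive of an integrable function. *)
Lemma integrable_conv s : 0 < s < b ->
  mu.-integrable `]0, s[ (fun t => (K 0%N (s - t) * psi 0%N t)%:E).
Proof.
move=> /andP[s0 sb]; pose M := `|c 0%N| + \int[mu]_t `|psi 1%N t|.
have i1 : mu.-integrable setT (EFin \o psi 1%N) by exact: ipsi.
have bnd t : t \in `]0, s[ -> `|psi 0%N t| <= M.
  rewrite in_itv/= => /andP[t0 ts]; rewrite psiE//; last by rewrite t0 (lt_trans ts).
  rewrite (le_trans (ler_normD _ _))// lerD2l.
  have it : mu.-integrable `]0, t] (EFin \o psi 1%N).
    by apply: integrableS i1 => //; exact: measurable_itv.
  rewrite (le_trans (le_normr_Rintegral _ it))//.
  have [_ i1oo] := integrableP _ _ _ i1.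
  rewrite /Rintegral fine_le//.
  - exact: integrable_fin_num (integrable_norm it).
  - exact: integrable_fin_num (integrable_norm i1).
  - apply: ge0_subset_integral => //; apply/measurable_EFinP.
    by apply: measurableT_comp => //; apply/measurable_EFinP; exact: measurable_int i1.
have iKr : mu.-integrable `]0, s[ (fun t => M%:E * (Kb (s - t))%:E)%E.
  apply: integrableZl => //.
  by apply: integrableS (integrable_reflect s iKb) => //; exact: measurable_itv.
have h : mu.-integrable `]0, s[ (fun t => (Kb (s - t) * psi 0%N t)%:E).
  apply: (le_integrable _ _ _ iKr) => //.
    apply/measurable_EFinP; apply: measurable_funM; apply: measurable_funTS.
      by apply/measurable_EFinP; exact: measurable_int (integrable_reflect s iKb).
    by apply/measurable_EFinP; exact: measurable_int (ipsi (leq0n n.+1)).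
  move=> t ts; rewrite -EFinM !abse_EFin lee_fin !normrM mulrC ler_wpM2r//.
  by rewrite (le_trans (bnd t ts))// ler_norm.
apply: eq_integrable h => // t /set_mem/=; rewrite in_itv/= => /andP[t0 ts].
by rewrite KbE//; apply/andP; split; lra.
Qed.

Lemma ae_integrable_conv : {ae mu, forall s, 0 < s < b ->
  mu.-integrable `]0, s[ (fun t => (K 0%N (s - t) * psi n.+1 t)%:E)}.
Proof.
have := integrable_convolution_itv iKb (ipsi (leqnn n.+1)).
apply: filterS; first exact: (ae_filter_ringOfSetsType mu).
move=> s /= h /andP[s0 sb]; apply: eq_integrable h => // t /set_mem/=.
by rewrite in_itv/= => /andP[t0 ts]; rewrite KbE//; apply/andP; split; lra.
Qed.

End derivatives_of_convolution.

(** * The two k-Prabhakar derivatives *)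

Section components.
Context {R : realType}.
Local Notation mu := (@lebesgue_measure R).
Implicit Types (c : bool) (z : R[i]) (x : R).

(** The boolean lets each argument be made once for both components. *)
Definition part c z : R := if c then Re z else Im z.

Lemma part_inj z w : (forall c, part c z = part c w) -> z = w.
Proof. by move=> zw; apply: complex_eqP; [exact: zw true|exact: zw false]. Qed.

Lemma part_realM c x z : part c (x%:C * z) = x * part c z.
Proof. by case: c; rewrite /= ?Re_realM ?Im_realM. Qed.

Lemma partD c z w : part c (z + w) = part c z + part c w.
Proof. by case: c; rewrite /= ?ReD ?ImD. Qed.

Lemma partN c z : part c (- z) = - part c z.
Proof. by case: c; rewrite /= ?ReN ?ImN. Qed.

Lemma part_sum c n (F : 'I_n -> R[i]) : part c (\sum_(i < n) F i) = \sum_(i < n) part c (F i).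
Proof. by apply: (big_morph _ (partD c)); case: c. Qed.

Lemma part_cintegral c D (F : R -> R[i]) :
  part c (cintegral D F) = \int[mu]_(t in D) part c (F t).
Proof. by case: c. Qed.

Lemma cintegrable_part D (F : R -> R[i]) :
  (forall c, mu.-integrable D (fun t => (part c (F t))%:E)) -> cintegrable D F.
Proof. by move=> iF; split; [exact: iF true|exact: iF false]. Qed.

Lemma is_cderive_part c (F : R -> R[i]) x z : is_cderive F x z ->
  is_derive x (1 : R) (fun u => part c (F u)) (part c z).
Proof. by case: c => -[]. Qed.

Lemma part_cderiven c n (F : R -> R[i]) x :
  part c (cderiven n F x) = derive1n n (fun s => part c (F s)) x.
Proof.
elim: n x => [//|n IH] x; rewrite derive1nS.
rewrite (_ : derive1n n _ = (fun s => part c (cderiven n F s))).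
  by case: c {IH}.
by apply/funext.
Qed.

Lemma cderivable_cderiven n (F : R -> R[i]) x :
  (forall c, derivable (derive1n n (fun s => part c (F s))) x 1) ->
  cderivable (cderiven n F) x.
Proof.
have E c : derive1n n (fun s => part c (F s)) = (fun s => part c (cderiven n F s)).
  by apply/funext => s; rewrite part_cderiven.
move=> dF; split; first by move: (dF true); rewrite (E true).
by move: (dF false); rewrite (E false).
Qed.

Lemma cnderivable_itv a b n (F : R -> R[i]) :
  (forall i x, (i < n)%N -> a < x < b -> cderivable (cderiven i F) x) ->
  forall x, a < x < b -> cnderivable n F x.
Proof.
elim: n => [//|n IH] dF x xab; split; last exact: dF.
have xin : x \in `]a, b[ by rewrite in_itv.
near=> y; apply: IH => [i z lin zab|].
  by apply: dF => //; exact: ltnW.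
by have : y \in `]a, b[ by near: y; exact: near_in_itvoo.
Unshelve. all: by end_near. Qed.

Lemma eq_derive1n_itv a b n (g h : R -> R) : (forall x, a < x < b -> g x = h x) ->
  forall x, a < x < b -> derive1n n g x = derive1n n h x.
Proof.
move=> gh; elim: n => [//|n IH] x xab; rewrite !derive1nS !derive1E.
apply: near_eq_derive; have xin : x \in `]a, b[ by rewrite in_itv.
near=> y; apply: IH.
by have : y \in `]a, b[ by near: y; exact: near_in_itvoo.
Unshelve. all: by end_near. Qed.

Lemma eq_derivable_itv a b (g h : R -> R) x : (forall x, a < x < b -> g x = h x) ->
  a < x < b -> derivable h x 1 -> derivable g x 1.
Proof.
move=> gh xab; apply: near_eq_derivable; have xin : x \in `]a, b[ by rewrite in_itv.
near=> y; apply/esym/gh.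
by have : y \in `]a, b[ by near: y; exact: near_in_itvoo.
Unshelve. all: by end_near. Qed.

End components.

Section prabhakar_kernel.
Context {R : realType} (k b : R) (alpha omega g nu : R[i]) (m : nat).
Local Notation mu := (@lebesgue_measure R).
Hypotheses (k0 : 0 < k) (b0 : 0 < b) (alpha0 : 0 < Re alpha) (nu0 : 0 < Re nu).
Implicit Types (c : bool) (p : nat) (u x t : R) (h : R -> R).

(** A component of the p-th derivative of k ^ (m - 1) u ^ (nu / k - 1)
E (omega u ^ (alpha / k)), the kernel of the Prabhakar integral times k ^ m. *)
Definition prabhakar_kernel c p u : R :=
  part c ((k ^+ m / k ^+ p.+1)%:C * kker k alpha omega g (nu - (p%:R * k)%:C) u).

Lemma is_derive_prabhakar_kernel c p u : 0 < u ->
  is_derive u (1 : R) (prabhakar_kernel c p) (prabhakar_kernel c p.+1 u).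
Proof.
move=> u0; apply: is_cderive_part.
have := is_cderiveZ (k ^+ m / k ^+ p.+1)%:C
  (is_cderive_kker omega g k0 alpha0 (nu - (p%:R * k)%:C) u0).
congr is_cderive; rewrite mulrA -rmorphM.
congr (_%:C * kker _ _ _ _ _ _).
  by rewrite [k ^+ p.+2]exprSr invfM mulrA.
by rewrite -addrA -opprD -rmorphD -natr1 mulrDl mul1r.
Qed.

(** Near 0 the kernel is bounded by a multiple of u ^ (Re nu / k - 1), which on a
bounded interval is comparable to the integrand of Gamma (Re nu / k). *)
Lemma integrable_prabhakar_kernel c : mu.-integrable `]0, b[ (EFin \o prabhakar_kernel c 0).
Proof.
have [C C0 B] := kker_bound omega g k0 alpha0 nu b0.
pose p := Re nu / k; have p0 : 0 < p by rewrite divr_gt0.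
pose N := `|k ^+ m / k| * (C * expR b).
have int : mu.-integrable `]0, b[ (fun t => N%:E * (rgamma_fun p t)%:E)%E.
  apply: integrableZl => //; apply: integrableS (rgamma_fun_integrable p0) => //.
  by move=> t /=; rewrite !in_itv/= andbT => /andP[].
apply: (le_integrable _ _ _ int) => //.
  apply/measurable_EFinP; apply: (@measurable_funS _ _ (measurableTypeR R) R _ _ _ _ _ (@measurable_pos _ (prabhakar_kernel c 0) _)).
  - exact: measurable_itv.
  - by move=> t /=; rewrite !in_itv/= andbT => /andP[].
  - move=> t t0; apply: differentiable_continuous; apply/derivable1_diffP.
    exact: (@ex_derive _ _ _ _ _ _ _ (is_derive_prabhakar_kernel c 0 t0)).
move=> t; rewrite /= in_itv/= => /andP[t0 tb].
rewrite /prabhakar_kernel expr1 mul0r subr0 part_realM lee_fin normrM.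
have tb' : 0 < t <= b by rewrite t0 ltW.
have {B} B : `|part c (kker k alpha omega g nu t)| <= C * t `^ (p - 1).
  by case: c (B t tb') => -[].
have N0 : 0 <= N by rewrite !mulr_ge0 ?expR_ge0.
rewrite (ger0_norm (mulr_ge0 N0 (rgamma_fun_ge0 _ _))) /N -[leRHS]mulrA ler_wpM2l//.
apply: (le_trans B); rewrite -mulrA ler_wpM2l// /rgamma_fun mulrA -expRD.
rewrite ler_peMl ?powR_ge0// -[leLHS]expR0 ler_expR subr_ge0; exact: ltW.
Qed.

Lemma part_kPrabhakar_integrand c h x t : 0 < t < x ->
  k ^+ m * part c (kPrabhakar_integrand k alpha nu omega g h x t) =
  prabhakar_kernel c 0 (x - t) * h t.
Proof.
move=> /andP[t0 tx]; have xt : 0 < x - t by rewrite subr_gt0.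
rewrite -part_realM /prabhakar_kernel [RHS]mulrC -part_realM; congr part.
rewrite /kPrabhakar_integrand mul0r subr0 -(kMittagLeffler_kker omega g k0 alpha0 nu xt).
rewrite expr1 rmorphM/= -invC.
set y := cpowR _ _; set w := kMittagLeffler _ _ _ _ _.
by move: (k%:C)^-1 => v; ring.
Qed.

Lemma kPrabhakar_cvg_kernel h x :
  (forall c, mu.-integrable `]0, x[ (fun t => (prabhakar_kernel c 0 (x - t) * h t)%:E)) ->
  kPrabhakar_cvg k alpha nu omega g h x /\
  forall c, part c ((k ^+ m)%:C * kPrabhakar k alpha nu omega g h x) =
    \int[mu]_(t in `]0, x[) (prabhakar_kernel c 0 (x - t) * h t).
Proof.
move=> iK; have km : k ^+ m != 0 by rewrite expf_neq0// gt_eqF.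
have E c t : t \in `]0, x[ -> part c (kPrabhakar_integrand k alpha nu omega g h x t) =
    (k ^+ m)^-1 * (prabhakar_kernel c 0 (x - t) * h t).
  by rewrite in_itv/= => tx; rewrite -part_kPrabhakar_integrand// mulKf.
split=> [|c].
  apply: cintegrable_part => c.
  have iZ : mu.-integrable `]0, x[
      (fun t => ((k ^+ m)^-1)%:E * (prabhakar_kernel c 0 (x - t) * h t)%:E)%E.
    exact: integrableZl.
  by apply: eq_integrable iZ => // t /set_mem tx; rewrite E.
rewrite part_realM part_cintegral.
have -> : \int[mu]_(t in `]0, x[) part c (kPrabhakar_integrand k alpha nu omega g h x t) =
    \int[mu]_(t in `]0, x[) ((k ^+ m)^-1 * (prabhakar_kernel c 0 (x - t) * h t)).
  by apply: eq_Rintegral => t /set_mem; exact: E.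
by rewrite (RintegralZl _ _ (iK c))// mulVKf.
Qed.

Lemma prabhakar_kernel_coef c p t : (p < m)%N -> 0 < t ->
  prabhakar_kernel c (m.-1 - p) t =
  part c ((k ^+ p)%:C * (cpowR t ((nu - ((m.-1 - p)%:R * k)%:C) / k%:C - 1) *
    kMittagLeffler k alpha (nu - ((m.-1 - p)%:R * k)%:C) g (omega * cpowR t (alpha / k%:C)))).
Proof.
move=> pm t0; rewrite kMittagLeffler_kker// /prabhakar_kernel; congr (part c (_%:C * _)).
have kp : k ^+ (m.-1 - p).+1 != 0 by rewrite expf_neq0// gt_eqF.
have m0 : (0 < m)%N := leq_ltn_trans (leq0n p) pm.
apply: (mulIf kp); rewrite divfK// -exprD; congr (_ ^+ _).
by rewrite addnS subnKC ?prednK// -ltnS prednK.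
Qed.

End prabhakar_kernel.

Section regularization.
Context {R : realType} (k b : R) (alpha omega g nu : R[i]) (n : nat) (f : R -> R).
Local Notation mu := (@lebesgue_measure R).
Hypotheses (k0 : 0 < k) (b0 : 0 < b) (alpha0 : 0 < Re alpha) (nu0 : 0 < Re nu).
Hypothesis hf : ACn n.+1 0 b f.
Implicit Types (c : bool) (i : nat) (x t : R).

Local Notation K := (prabhakar_kernel k alpha omega g nu n.+1).
Local Notation psi := (AC_density b f).
Local Notation P := (fun x => (k ^+ n.+1)%:C * kPrabhakar k alpha nu omega g f x).

Let dK c p (u : R) : 0 < u -> is_derive u (1 : R) (K c p) (K c p.+1 u).
Proof. exact: is_derive_prabhakar_kernel. Qed.

Let iK c : mu.-integrable `]0, b[ (EFin \o K c 0).
Proof. exact: integrable_prabhakar_kernel. Qed.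

Let ipsi i (lin : (i <= n.+1)%N) := integrable_AC_density b0 hf lin.

Let psi_out i (t : R) (tb : t <= 0 \/ b <= t) := AC_density_out f i tb.

Let psiE i (t : R) (lin : (i <= n)%N) (tb : 0 < t < b) := AC_density_primitive b0 hf lin tb.

Let kPrabhakar_conv i x : 0 < x < b ->
  (forall c, mu.-integrable `]0, x[ (fun t => (K c 0 (x - t) * psi i t)%:E)) ->
  kPrabhakar_cvg k alpha nu omega g (derive1n i f) x /\
  forall c, part c ((k ^+ n.+1)%:C * kPrabhakar k alpha nu omega g (derive1n i f) x) =
    conv (K c) psi i x.
Proof.
move=> /andP[x0 xb] iKp.
have E t : t \in `]0, x[ -> psi i t = derive1n i f t.
  rewrite in_itv/= => /andP[t0 tx]; rewrite /AC_density in_itv/= t0 (lt_trans tx)//.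
have [|cvgP partP] := kPrabhakar_cvg_kernel (m := n.+1) (omega := omega) (g := g) (h := derive1n i f)
    (x := x) (nu := nu) k0 alpha0.
  move=> c; apply: eq_integrable (iKp c) => // t /set_mem tx.
  by rewrite E.
split => // c; rewrite partP; apply: eq_Rintegral => t /set_mem tx.
by rewrite E.
Qed.

Let kPrabhakar_conv0 x : 0 < x < b -> kPrabhakar_cvg k alpha nu omega g f x /\
  forall c, part c (P x) = conv (K c) psi 0 x.
Proof.
move=> xb; apply: (kPrabhakar_conv (i := 0) xb) => c.
exact: (integrable_conv (@iK c) ipsi psiE).
Qed.

Lemma derive1n_kPrabhakar c i x : 0 < x < b ->
  derive1n i (fun s => part c (P s)) x = derive1n i (conv (K c) psi 0) x.
Proof. by apply: eq_derive1n_itv => y yb; exact: (kPrabhakar_conv0 yb).2. Qed.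

Lemma cderivable_kPrabhakar i x : 0 < x < b ->
  (forall c, derivable (derive1n i (conv (K c) psi 0)) x 1) ->
  cderivable (cderiven i P) x.
Proof.
move=> xb dF; apply: cderivable_cderiven => c.
by apply: eq_derivable_itv xb (dF c) => y; exact: derive1n_kPrabhakar.
Qed.

Lemma ae_regularized_kPrabhakar : {ae mu, forall t, 0 < t < b ->
  [/\ kPrabhakar_cvg k alpha nu omega g (derive1n n.+1 f) t,
      \forall s \near t, kPrabhakar_cvg k alpha nu omega g f s,
      cnderivable n.+1 P t &
      (k ^+ n.+1)%:C * kPrabhakar k alpha nu omega g (derive1n n.+1 f) t =
      cderiven n.+1 P t -
      \sum_(p < n.+1)
        (k ^+ p)%:C * (cpowR t ((nu - ((n - p)%:R * k)%:C) / k%:C - 1) *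
          kMittagLeffler k alpha (nu - ((n - p)%:R * k)%:C) g (omega * cpowR t (alpha / k%:C))) *
        (AC_deriv b f p 0)%:C]}.
Proof.
have aeF := ae_filter_ringOfSetsType mu.
have D c := ae_derive1n_conv (@dK c) (@iK c) ipsi psi_out psiE.
have I c := ae_integrable_conv (@iK c) ipsi.
apply: filterS (filterI (filterI (D true) (D false)) (filterI (I true) (I false))).
move=> t [[Dt Df] [It If]] tb.
have {Dt Df} D' c : derivable (derive1n n (conv (K c) psi 0)) t 1 /\
    derive1n n.+1 (conv (K c) psi 0) t =
    conv (K c) psi n.+1 t + \sum_(p < n.+1) AC_deriv b f p 0 * K c (n - p) t.
  by case: c; [exact: Dt tb|exact: Df tb].
have [cvgn1 partn1] : kPrabhakar_cvg k alpha nu omega g (derive1n n.+1 f) t /\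
    forall c, part c ((k ^+ n.+1)%:C * kPrabhakar k alpha nu omega g (derive1n n.+1 f) t) =
      conv (K c) psi n.+1 t.
  by apply: kPrabhakar_conv => // -[]; [exact: It tb|exact: If tb].
have tin : t \in `]0, b[ by rewrite in_itv.
have nearb (Q : R -> Prop) : (forall y, 0 < y < b -> Q y) -> \forall y \near t, Q y.
  move=> QE; near=> y; apply: QE.
  by have : y \in `]0, b[ by near: y; exact: near_in_itvoo.
split => //.
- by apply: nearb => y yb; exact: (kPrabhakar_conv0 yb).1.
- split; last by apply: cderivable_kPrabhakar => // c; exact: (D' c).1.
  apply: nearb => y yb; apply: (cnderivable_itv _ yb) => i x lin xb.
  apply: cderivable_kPrabhakar => // c.
  exact: (derivable_derive1n_conv (@dK c) (@iK c) ipsi psi_out psiE).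
apply: part_inj => c; rewrite partD partN part_sum part_cderiven derive1n_kPrabhakar//.
rewrite (D' c).2 partn1 -addrA -sumrB big1 ?addr0// => p _.
have /andP[t0 _] := tb.
rewrite [X in part c X]mulrC part_realM (prabhakar_kernel_coef omega g nu k0 alpha0 c (ltn_ord p) t0).
by rewrite subrr.
Unshelve. all: by end_near. Qed.

End regularization.

Unset Implicit Arguments.
Set Strict Implicit.
Set Printing Implicit Defensive.

Theorem mainTheorem3 (R : realType) (k b : R) (alpha mu omega gamma : R[i])
    (m : nat) (f : R -> R)
    (hk : 0 < k) (hb : 0 < b)
    (halpha : 0 < complex.Re alpha) (hmu : 0 < complex.Re mu)
    (hm : m = (Num.truncn (complex.Re mu / k)).+1)
    (hf : ACn m 0 b f) :
  {ae (@lebesgue_measure R), forall t : R, t \in `]0, b[ ->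
    [/\ kPrabhakarCD_exists k alpha mu omega gamma f t,
        kPrabhakarD_exists k alpha mu omega gamma f t &
        kPrabhakarCD k alpha mu omega gamma f t =
        kPrabhakarD k alpha mu omega gamma f t -
        \sum_(n < m)
          (k ^+ n)%:C * cpowR t (((n%:R * k)%:C - mu) / k%:C) *
          kMittagLeffler k alpha ((n.+1%:R * k)%:C - mu) (- gamma)
            (omega * cpowR t (alpha / k%:C)) *
          (lim (derive1n n f s @[s --> 0^'+]))%:C]}.
Proof.
subst m; set n := Num.truncn (complex.Re mu / k) in hf *.
pose nu := (n.+1%:R * k)%:C - mu.
have nu0 : 0 < complex.Re nu.
  by rewrite /nu ReD ReN/= subr_gt0 -ltr_pdivrMr// truncnS_gt.
have := ae_regularized_kPrabhakar omega (- gamma) hk hb halpha nu0 hf.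
apply: filterS; first exact: (ae_filter_ringOfSetsType lebesgue_measure).
move=> t H; rewrite in_itv/= => tb; have [cvgC cvgD nD E] := H tb.
split; [exact: cvgC|by split; [exact: cvgD|exact: nD]|].
rewrite /kPrabhakarCD /kPrabhakarD /kPrabhakar_order -/n -/nu E.
congr (_ - _); apply: eq_bigr => p _.
have pn : (p <= n)%N by rewrite -ltnS.
rewrite (lim_derive1n_AC hb hf pn).
have nuE : nu - ((n - p)%:R * k)%:C = (p.+1%:R * k)%:C - mu.
  rewrite /nu addrAC -rmorphB -mulrBl; congr (_%:C - _); congr (_ * _).
  by rewrite -natrB ?leqW ?leq_subr//; congr (_%:R); rewrite subnBA// addSn -addnS addKn.
have kC0 : k%:C != 0 :> R[i] by rewrite eq_complex/= gt_eqF.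
rewrite nuE; congr (_ * _); rewrite mulrA; congr (_ * cpowR t _ * _).
rewrite -natr1 (mulrDl _ 1 k) mul1r rmorphD/= addrAC.
by rewrite (mulrDl _ k%:C) divff// addrK.
Qed.
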